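(* Let $\mathcal{H}$ be a separable complex Hilbert space, let $S_{j,n}$, $n\in\mathbb{N}$, and $S_j$, $j=1,2$, be self-adjoint operators in $\mathcal{H}$, and assume that $S_{j,n}$ converges in strong resolvent sense to $S_j$ as $n\to\infty$, for $j=1,2$, respectively. Suppose that for some $m\in\mathbb{N}$ and some $p\in[1,\infty)$, $$\big[(S_{2,n}-zI_{\mathcal{H}})^{-m}-(S_{1,n}-zI_{\mathcal{H}})^{-m}\big],\ \big[(S_2-zI_{\mathcal{H}})^{-m}-(S_1-zI_{\mathcal{H}})^{-m}\big]\in\mathcal{B}_p(\mathcal{H}),\quad z\in\mathbb{C}\setminus\mathbb{R},\ n\in\mathbb{N}. \tag{a}$$ If $$\lim_{n\to\infty}\Big\|\big[(S_{2,n}-zI_{\mathcal{H}})^{-m}-(S_{1,n}-zI_{\mathcal{H}})^{-m}\big]-\big[(S_2-zI_{\mathcal{H}})^{-m}-(S_1-zI_{\mathcal{H}})^{-m}\big]\Big\|_{\mathcal{B}_p(\mathcal{H})}=0,\quad z\in\mathbb{C}\setminus\mathbb{R}, \tag{b}$$ and for some $z_0\in\mathbb{C}\setminus\mathbb{R}$, $$(S_{1,n}-z_0I_{\mathcal{H}})^{-m}\big[(S_{2,n}-z_0I_{\mathcal{H}})^{-1}-(S_{1,n}-z_0I_{\mathcal{H}})^{-1}\big],\ (S_1-z_0I_{\mathcal{H}})^{-m}\big[(S_2-z_0I_{\mathcal{H}})^{-1}-(S_1-z_0I_{\mathcal{H}})^{-1}\big]\in\mathcal{B}_p(\mathcal{H}),\quad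 n\in\mathbb{N}, \tag{c}$$ with $$\lim_{n\to\infty}\Big\|(S_{1,n}-z_0I_{\mathcal{H}})^{-m}\big[(S_{2,n}-z_0I_{\mathcal{H}})^{-1}-(S_{1,n}-z_0I_{\mathcal{H}})^{-1}\big]-(S_1-z_0I_{\mathcal{H}})^{-m}\big[(S_2-z_0I_{\mathcal{H}})^{-1}-(S_1-z_0I_{\mathcal{H}})^{-1}\big]\Big\|_{\mathcal{B}_p(\mathcal{H})}=0, \tag{d}$$ then $$\lim_{n\to\infty}\big\|[f(S_{2,n})-f(S_{1,n})]-[f(S_2)-f(S_1)]\big\|_{\mathcal{B}_p(\mathcal{H})}=0,\quad f\in C_0^\infty(\mathbb{R}). \tag{e}$$ In addition, these results hold upon systematically replacing $\mathcal{B}_p(\mathcal{H})$ by $\mathcal{B}(\mathcal{H})$ in (a)--(e).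
   Context: $I_{\mathcal{H}}$ is the identity operator in $\mathcal{H}$. $\mathcal{B}(\mathcal{H})$ denotes the bounded linear operators on $\mathcal{H}$ with the operator norm, and $\mathcal{B}_p(\mathcal{H})$, $p\in[1,\infty)$, denotes the $\ell^p$-based trace ideal (Schatten--von Neumann class) with its norm $\|\cdot\|_{\mathcal{B}_p(\mathcal{H})}$. $C_0^\infty(\mathbb{R})$ is the space of $C^\infty$-functions of compact support on $\mathbb{R}$. For $S$ self-adjoint (possibly unbounded), $f(S)$ is defined by the functional calculus for self-adjoint operators. Convergence of $S_{j,n}$ to $S_j$ in strong resolvent sense means that $(S_{j,n}-zI_{\mathcal{H}})^{-1}\to(S_j-zI_{\mathcal{H}})^{-1}$ in the strong operator topology for $z\in\mathbb{C}\setminus\mathbb{R}$. *)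

(* Defs.v *)
From HB Require Import structures.
From mathcomp Require Import all_boot all_order all_algebra.
From mathcomp Require Import all_classical all_reals all_analysis.
From mathcomp Require Import complex.

Set Implicit Arguments.
Unset Strict Implicit.
Unset Printing Implicit Defensive.

Import Order.TTheory GRing.Theory Num.Theory numFieldNormedType.Exports.

Local Open Scope classical_set_scope.
Local Open Scope ring_scope.
Local Open Scope complex_scope.

Definition separable_space (T : topologicalType) : Prop :=
  exists2 D : set T, countable D & dense D.

Section Functions.
Variable R : realType.
Implicit Types f : R -> R[i].

Definition smooth (g : R -> R) : Prop := forall k t, derivable (derive1n k g) t 1.

                                                                          
                                                             
Definition C0oo f : Prop :=
  [/\ smooth (fun t => complex.Re (f t)), smooth (fun t => complex.Im (f t))
    & compact (closure [set t | f t != 0])].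

                                                                          
Definition vanishing_continuous f : Prop :=
  [/\ continuous (f : R -> R[i]^o),
      (f t : R[i]^o) @[t --> +oo] --> (0 : R[i]^o)
    & (f t : R[i]^o) @[t --> -oo] --> (0 : R[i]^o)].

End Functions.

Section Operators.
Variables (R : realType) (H : completeNormedModType R[i]).
Variable dot : {dot H for Num.conj}.
Implicit Types T : H -> H.

                                                                             
                 
Record operator := Operator { op_dom : set H; op_fun : H -> H }.

Implicit Type A : operator.

Definition linear_operator A : Prop :=
  op_dom A 0 /\
  forall (a : R[i]) x y, op_dom A x -> op_dom A y ->
    op_dom A (a *: x + y) /\ op_fun A (a *: x + y) = a *: op_fun A x + op_fun A y.

                                                       
Definition adjoint_graph A (y w : H) : Prop :=
  forall x, op_dom A x -> dot (op_fun A x) y = dot x w.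

Definition self_adjoint A : Prop :=
  [/\ linear_operator A, dense (op_dom A)
    & forall y w, adjoint_graph A y w <-> op_dom A y /\ op_fun A y = w].

Definition everywhere T : operator := Operator setT T.

                                                                     
Definition resolvent A (z : R[i]) : H -> H := fun x =>
  xget 0 [set y | op_dom A y /\ op_fun A y - z *: y = x].

Definition resolvent_pow A (z : R[i]) (m : nat) : H -> H :=
  iter m (resolvent A z).

Definition strong_resolvent_cvg (A_ : nat -> operator) A : Prop :=
  forall z : R[i], z \isn't Num.real -> forall x : H,
    resolvent (A_ n) z x @[n --> \oo] --> resolvent A z x.

Definition operator_norm T : \bar R :=
  ereal_sup [set (complex.Re `|T x|)%:E | x in [set x : H | `|x| <= 1]].

Definition bounded_operator T : Prop :=
  linear T /\ (operator_norm T < +oo)%E.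

Definition compact_operator T : Prop :=
  linear T /\ precompact (T @` [set x : H | `|x| <= 1]).

                                                                            
                                                                            
                                                                            
                                                                          
                                                                              
                     
Definition singular_values T (s : nat -> R) : Prop :=
  (forall k, 0 <= s k) /\ (forall k l, (k <= l)%N -> s l <= s k) /\
  exists e : nat -> H,
    [/\ forall k l, 0 < s k -> 0 < s l -> dot (e k) (e l) = (k == l)%:R,
        forall k, 0 < s k ->
          adjoint_graph (everywhere T) (T (e k)) ((s k ^+ 2)%:C *: e k)
      & forall x, (forall k, 0 < s k -> dot x (e k) = 0) -> T x = 0].

Definition singular_value T : nat -> R := xget (fun=> 0) (singular_values T).

Definition schatten_norm (p : R) T : \bar R :=
  ((\sum_(0 <= k <oo) (singular_value T k `^ p)%:E) `^ p^-1)%E.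

Definition schatten (p : R) T : Prop :=
  compact_operator T /\ (schatten_norm p T < +oo)%E.

                                                                               
                                                                     
                                                                          
Definition functional_calculus A (Phi : (R -> R[i]) -> H -> H) : Prop :=
  [/\ forall f, vanishing_continuous f -> bounded_operator (Phi f),
      forall (a : R[i]) f g, vanishing_continuous f -> vanishing_continuous g ->
        Phi (fun t => a * f t + g t) = (fun x => a *: Phi f x + Phi g x),
      forall f g, vanishing_continuous f -> vanishing_continuous g ->
        Phi (fun t => f t * g t) = Phi f \o Phi g,
      forall f, vanishing_continuous f -> forall y,
        adjoint_graph (everywhere (Phi f)) y (Phi (fun t => (f t)^*) y)
    & forall z : R[i], z \isn't Num.real ->
        Phi (fun t => (t%:C - z)^-1) = resolvent A z].

                                                                             
Definition fcalc A : (R -> R[i]) -> H -> H :=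
  xget (fun _ _ => 0) (functional_calculus A).

                                                     
Variant operator_ideal := Schatten of R | Bounded.

Definition admissible_ideal (J : operator_ideal) : Prop :=
  if J is Schatten p then 1 <= p else True.

Definition in_ideal (J : operator_ideal) : (H -> H) -> Prop :=
  if J is Schatten p then schatten p else bounded_operator.

Definition ideal_norm (J : operator_ideal) : (H -> H) -> \bar R :=
  if J is Schatten p then schatten_norm p else operator_norm.

End Operators.

Arguments Bounded {R}.

(* Main.v *)
(* The Cayley transforms U_j of S_j at z0 are unitary, and a continuous function
   vanishing at infinity becomes a continuous function on the unit circle, hence a
   norm limit of the Fejer means of its Fourier series in U_j; the rate depends only
   on the function. This yields the functional calculus, its contractivity and its
   strong continuity under strong resolvent convergence.

   Operator norm. The functions f for which f(S_{2,n}) - f(S_{1,n}) converges in norm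
   form a closed subspace containing (t - z)^{-m} for all nonreal z. Moving z towards
   infinity along vertical lines (telescoping) and differentiating in z gives all
   powers of the resolvents, so by Fejer's theorem this subspace is everything.

   Schatten classes. Write f = (t - z0)^{-m} g with g smooth of compact support. Then
   f(S_2) - f(S_1) is the sum of [R_2^m - R_1^m] g(S_2) and of
   R_1^m [g(S_2) - g(S_1)]. The first summand converges by Gruemm's theorem. In the
   second one replace g by its Fejer means: telescoping R_1^m (U_2^k - U_1^k) expresses
   it through k copies of R_1^m (R_2 - R_1), each of which converges by Gruemm's
   theorem, while the Fourier coefficients decay like k^{-3}, so that the tails are
   uniformly small. Schatten norms are handled through sums over Bessel families,
   which makes them subadditive and lower semicontinuous. *)
Require Import Defs.
From mathcomp Require Import all_boot all_order all_algebra.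
From mathcomp Require Import all_classical all_reals all_analysis.
From mathcomp Require Import complex ring lra.
Import Order.TTheory GRing.Theory Num.Theory numFieldNormedType.Exports.
Import ComplexField.Normc.
Local Open Scope classical_set_scope.
Local Open Scope ring_scope.
Local Open Scope complex_scope.
Set Implicit Arguments.
Unset Strict Implicit.
Unset Printing Implicit Defensive.

(** * Hilbert space geometry *)

Section ComplexModulus.
Variable R : realType.
Implicit Types a b z : R[i].

(** Uniform approximation of f controls f(S_2) - f(S_1) in operator norm only, so the density
    argument has no Schatten counterpart. Its substitute is a bound that does not depend on the
    degree of the Fejer mean: k copies against decay k^{-3} leave a sum of k^{-2}, and lower
    semicontinuity carries the bound to the limit. Three is the least integer exponent for which
    this sum converges; it costs three differences of the transported function. Fourier coefficients
    are never integrals. They are sums over M-th roots of unity, and periodic summation by parts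
    gives their decay uniformly in M once the degree is at most M/4. Negative powers use V_2 - V_1 =
    - V_1 (U_2 - U_1) V_2 with V_j the inverse of U_j, so that everything is expressed through R_1^m
    (R_2 - R_1) at z0, never at its conjugate. [fcalc] is a choice among the maps satisfying
    [functional_calculus], so existence must precede every statement about it. No spectral measure
    enters: f(S) is the unique operator commuting with U that acts on truncated orbit sums of U as
    the expected scalar, up to a negligible error. *)

Lemma normcE_norm a : `|a| = (normc a)%:C.
Proof. by rewrite normc_def; case: a. Qed.

Lemma normc_ge0 a : 0 <= normc a.
Proof. by have := normr_ge0 a; rewrite normcE_norm ler0c. Qed.

Lemma normcR (c : R) : normc c%:C = `|c|.
Proof. by rewrite /normc /= expr0n addr0 sqrtr_sqr. Qed.

Lemma normc_eq0 a : (normc a == 0) = (a == 0).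
Proof.
by apply/eqP/eqP => [|->]; [exact: eq0_normc | exact: normc0].
Qed.

Lemma normc_conj a : normc (conjc a) = normc a.
Proof. by case: a => x y; rewrite /normc /= sqrrN. Qed.

Lemma normcX a n : normc (a ^+ n) = normc a ^+ n.
Proof. by elim: n => [|n IH]; rewrite ?normc1// !exprS normcM IH. Qed.

Lemma normcB a b : normc (a - b) = normc (b - a).
Proof. by rewrite -normcN opprB. Qed.

Lemma ler_normcB a b : normc a <= normc b + normc (a - b).
Proof. by rewrite -{1}(subrK b a) addrC le_normcD. Qed.

Lemma le_normcB a b : normc (a - b) <= normc a + normc b.
Proof. by rewrite -(normcN b) le_normcD. Qed.

Lemma normc_sum (I : Type) (r : seq I) (P : pred I) (F : I -> R[i]) :
  normc (\sum_(i <- r | P i) F i) <= \sum_(i <- r | P i) normc (F i).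
Proof.
elim/big_rec2: _ => [|i y x _ H]; first by rewrite normc0.
by apply: le_trans (le_normcD _ _) _; rewrite lerD2l.
Qed.

Lemma conjcD a b : conjc (a + b) = conjc a + conjc b.
Proof. exact: rmorphD. Qed.

Lemma conjcM a b : conjc (a * b) = conjc a * conjc b.
Proof. exact: rmorphM. Qed.

Lemma conjcB a b : conjc (a - b) = conjc a - conjc b.
Proof. exact: rmorphB. Qed.

Lemma conjcX a n : conjc (a ^+ n) = conjc a ^+ n.
Proof. exact: rmorphXn. Qed.

Lemma conjc_sum (I : Type) (r : seq I) (P : pred I) (F : I -> R[i]) :
  conjc (\sum_(i <- r | P i) F i) = \sum_(i <- r | P i) conjc (F i).
Proof. exact: rmorph_sum. Qed.

Lemma normc_nat n : normc (n%:R : R[i]) = n%:R.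
Proof. by rewrite -(rmorph_nat (real_complex R)) normcR normr_nat. Qed.

Lemma conjcZ (c : R) a : conjc (c%:C * a) = c%:C * conjc a.
Proof. by rewrite rmorphM; congr (_ * _); exact: conjc_real. Qed.

Lemma ReD a b : complex.Re (a + b) = complex.Re a + complex.Re b.
Proof. by case: a b => [? ?] [? ?]. Qed.

Lemma ReN a : complex.Re (- a) = - complex.Re a.
Proof. by case: a. Qed.

Lemma ReM_real (c : R) a : complex.Re (c%:C * a) = c * complex.Re a.
Proof. by case: a => x y /=; rewrite mul0r subr0. Qed.

Lemma sqr_normcE a : (normc a ^+ 2)%:C = a * conjc a.
Proof. by rewrite -sqr_normc normcE_norm rmorphXn. Qed.

Lemma sqr_normc_ReIm a : normc a ^+ 2 = complex.Re a ^+ 2 + complex.Im a ^+ 2.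
Proof. by case: a => x y; rewrite /normc sqr_sqrtr // addr_ge0 // sqr_ge0. Qed.

Lemma ImN_le_normc a : `|complex.Im a| <= normc a.
Proof.
rewrite -(ger0_norm (normc_ge0 a)) -ler_sqr ?nnegrE // ?normr_ge0 //.
by rewrite !real_normK ?num_real // sqr_normc_ReIm lerDr sqr_ge0.
Qed.

Lemma normc_le_ReIm a : normc a <= `|complex.Re a| + `|complex.Im a|.
Proof.
rewrite -ler_sqr ?nnegrE ?normc_ge0 ?addr_ge0 //.
rewrite sqr_normc_ReIm sqrrD !real_normK ?num_real // lerD2r lerDl.
by rewrite mulrn_wge0 // mulr_ge0.
Qed.

Lemma nonrealE z : (z \isn't Num.real) = (complex.Im z != 0).
Proof. by case: z => x y; rewrite complex_real. Qed.

Lemma nonreal_conj z : z \isn't Num.real -> conjc z \isn't Num.real.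
Proof. by rewrite !nonrealE; case: z => x y /=; rewrite oppr_eq0. Qed.

End ComplexModulus.

(** * Inner product, sequential limits and orthogonal projection *)

Section Hilbert.
Variables (R : realType) (H : completeNormedModType R[i]).
Variable dot : {dot H for Num.conj}.
Hypothesis dot_norm : forall x : H, `|x| ^+ 2 = dot x x.
Implicit Types (x y : H) (a : R[i]) (S T : H -> H).

(** The norm of a module over [R[i]] is complex valued; its real part makes real order arguments and
    [lra] available. *)
Definition hnorm (x : H) : R := complex.Re `|x|.

Lemma hnormE x : `|x| = (hnorm x)%:C.
Proof. by rewrite /hnorm RRe_real // ger0_real. Qed.

Lemma hnorm_ge0 x : 0 <= hnorm x.
Proof. by have := normr_ge0 x; rewrite hnormE ler0c. Qed.

Lemma hnorm0 : hnorm 0 = 0.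
Proof. by rewrite /hnorm normr0. Qed.

Lemma hnorm_eq0 x : (hnorm x == 0) = (x == 0).
Proof. by rewrite -(normr_eq0 x) hnormE eq_complex /= eqxx andbT. Qed.

Lemma hnorm_le0 x : hnorm x <= 0 -> x = 0.
Proof.
by move=> h; apply/eqP; rewrite -hnorm_eq0 eq_le h hnorm_ge0.
Qed.

Lemma hnormD x y : hnorm (x + y) <= hnorm x + hnorm y.
Proof. by rewrite -lecR rmorphD /= -!hnormE ler_normD. Qed.

Lemma hnormN x : hnorm (- x) = hnorm x.
Proof. by rewrite /hnorm normrN. Qed.

Lemma hnormB x y : hnorm (x - y) = hnorm (y - x).
Proof. by rewrite -hnormN opprB. Qed.

Lemma hnormDB x y : hnorm (x - y) <= hnorm x + hnorm y.
Proof. by rewrite -(hnormN y) hnormD. Qed.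

Lemma hnorm_triangle y x z : hnorm (x - z) <= hnorm (x - y) + hnorm (y - z).
Proof. by rewrite -{1}(subrK y x) -addrA hnormD. Qed.

Lemma hnormZ a x : hnorm (a *: x) = normc a * hnorm x.
Proof.
apply: (@complexI R); rewrite -hnormE normrZ normcE_norm hnormE.
by rewrite -rmorphM.
Qed.

Lemma hnorm_sum (I : Type) (r : seq I) (P : pred I) (F : I -> H) :
  hnorm (\sum_(i <- r | P i) F i) <= \sum_(i <- r | P i) hnorm (F i).
Proof.
elim/big_rec2: _ => [|i y x _ h]; first by rewrite hnorm0.
by apply: le_trans (hnormD _ _) _; rewrite lerD2l.
Qed.

Lemma dotDl x y z : dot (x + y) z = dot x z + dot y z.
Proof. exact: linearDl. Qed.
Lemma dotDr x y z : dot x (y + z) = dot x y + dot x z.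
Proof. exact: linearDr. Qed.
Lemma dotNl x y : dot (- x) y = - dot x y.
Proof. exact: linearNl. Qed.
Lemma dotNr x y : dot x (- y) = - dot x y.
Proof. exact: linearNr. Qed.
Lemma dotBl x y z : dot (x - y) z = dot x z - dot y z.
Proof. by rewrite dotDl dotNl. Qed.
Lemma dotBr x y z : dot x (y - z) = dot x y - dot x z.
Proof. by rewrite dotDr dotNr. Qed.
Lemma dotZl a x y : dot (a *: x) y = a * dot x y.
Proof. exact: linearZl_LR. Qed.
Lemma dotZr a x y : dot x (a *: y) = conjc a * dot x y.
Proof. exact: linearZr_LR. Qed.
Lemma dot0l x : dot 0 x = 0.
Proof. exact: linear0l. Qed.
Lemma dot0r x : dot x 0 = 0.
Proof. exact: linear0r. Qed.
Lemma dot_conj x y : dot y x = conjc (dot x y).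
Proof. by rewrite hermC expr0 mul1r. Qed.
Lemma dot_suml (I : Type) (r : seq I) (P : pred I) (F : I -> H) y :
  dot (\sum_(i <- r | P i) F i) y = \sum_(i <- r | P i) dot (F i) y.
Proof.
by elim/big_rec2: _ => [|i u v _ <-]; rewrite ?dot0l ?dotDl.
Qed.
Lemma dot_sumr (I : Type) (r : seq I) (P : pred I) (F : I -> H) y :
  dot y (\sum_(i <- r | P i) F i) = \sum_(i <- r | P i) dot y (F i).
Proof.
by elim/big_rec2: _ => [|i u v _ <-]; rewrite ?dot0r ?dotDr.
Qed.

Lemma dotxx x : dot x x = (hnorm x ^+ 2)%:C.
Proof. by rewrite -dot_norm hnormE rmorphXn. Qed.

Lemma dotxx_eq0 x : dot x x = 0 -> x = 0.
Proof.
rewrite dotxx => /eqP; rewrite (fmorph_eq0 (real_complex R)) sqrf_eq0.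
by rewrite hnorm_eq0 => /eqP.
Qed.

Lemma sqr_hnormD x y :
  hnorm (x + y) ^+ 2 = hnorm x ^+ 2 + hnorm y ^+ 2 + 2 * complex.Re (dot x y).
Proof.
have := dotxx (x + y); rewrite dotDl !dotDr (dot_conj x y) !dotxx.
by move/(congr1 (@complex.Re R)); case: (dot x y) => u v /=; lra.
Qed.

Lemma sqr_hnormB x y :
  hnorm (x - y) ^+ 2 = hnorm x ^+ 2 + hnorm y ^+ 2 - 2 * complex.Re (dot x y).
Proof. by rewrite sqr_hnormD hnormN dotNr ReN mulrN. Qed.

Lemma parallelogram x y :
  hnorm (x + y) ^+ 2 + hnorm (x - y) ^+ 2 = 2 * (hnorm x ^+ 2 + hnorm y ^+ 2).
Proof. by rewrite sqr_hnormD sqr_hnormB; ring. Qed.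

Lemma cauchy_schwarz x y : normc (dot x y) <= hnorm x * hnorm y.
Proof.
have [->|y0] := eqVneq y 0; first by rewrite dot0r normc0 hnorm0 mulr0.
have yp : 0 < hnorm y by rewrite lt_def hnorm_ge0 hnorm_eq0 y0.
rewrite -ler_sqr ?nnegrE ?normc_ge0 ?mulr_ge0 ?hnorm_ge0 //.
(* [c *: y] is the orthogonal projection of [x] on [y]; the inequality is the nonnegativity of the
   squared distance. *)
pose c := (hnorm y ^- 2)%:C * dot x y.
have := sqr_ge0 (hnorm (x - c *: y)).
rewrite sqr_hnormB hnormZ dotZr /c normcM normcR conjcZ.
rewrite -[_ * conjc _ * _]mulrA ReM_real -(mulrC (dot x y)) -sqr_normcE /=.
have y2 : 0 < hnorm y ^+ 2 by rewrite exprn_gt0.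
have iy : 0 <= hnorm y ^- 2 by rewrite invr_ge0 ltW.
rewrite (ger0_norm iy) !exprMn.
set d := normc _; set Y := hnorm y; set X := hnorm x.
have -> : Y ^- 2 ^+ 2 * d ^+ 2 * Y ^+ 2 = d ^+ 2 / Y ^+ 2.
  by field; rewrite /Y hnorm_eq0.
have -> : 2 * (Y ^- 2 * d ^+ 2) = 2 * (d ^+ 2 / Y ^+ 2) by ring.
move=> h; rewrite -ler_pdivrMr // -/Y.
lra.
Qed.

Definition hlim (u : nat -> H) (l : H) : Prop :=
  forall e : R, 0 < e -> exists N, forall n, (N <= n)%N -> hnorm (u n - l) <= e.

Lemma cvg_hlim (u : nat -> H) l : u n @[n --> \oo] --> l -> hlim u l.
Proof.
move=> /cvgrPdist_le h e e0.
have /h [N _ hN] : 0 < e%:C by rewrite ltcR.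
by exists N => n /hN; rewrite hnormE lecR hnormB.
Qed.

Lemma hlim_uniq (u : nat -> H) l l' : hlim u l -> hlim u l' -> l = l'.
Proof.
move=> h h'; apply/eqP; rewrite -subr_eq0 -hnorm_eq0 eq_le hnorm_ge0 andbT.
apply/ler_addgt0Pl => e e0; rewrite addr0.
have e2 : 0 < e / 2 by rewrite divr_gt0.
have [N1 h1] := h _ e2; have [N2 h2] := h' _ e2.
apply: le_trans (hnorm_triangle (u (maxn N1 N2)) _ _) _.
rewrite [e]splitr lerD //; first by rewrite hnormB h1 ?leq_maxl.
by rewrite h2 ?leq_maxr.
Qed.

Lemma hcomplete (u : nat -> H) :
  (forall e : R, 0 < e -> exists N, forall n m, (N <= n)%N -> (N <= m)%N ->
     hnorm (u n - u m) <= e) -> exists l, hlim u l.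
Proof.
move=> h; suff /cvg_ex [l /cvg_hlim hl] : cvg (u n @[n --> \oo]) by exists l.
apply/cauchy_cvgP; apply/cauchyP => e e0.
have eE : e = (complex.Re e)%:C by rewrite RRe_real // gtr0_real.
have e'0 : 0 < complex.Re e by rewrite -ltcR -eE.
have [N hN] := h _ (divr_gt0 e'0 (ltr0n _ 2)).
exists (u N); exists N => // n hn; rewrite -ball_normE /= hnormE eE ltcR.
apply: (le_lt_trans (hN _ _ (leqnn N) hn)).
by rewrite ltr_pdivrMr // mulrDr mulr1 ltrDl.
Qed.

Lemma sqr_hnorm_le x (c : R) : 0 <= c -> hnorm x ^+ 2 <= c ^+ 2 -> hnorm x <= c.
Proof. by move=> c0; rewrite ler_sqr ?nnegrE ?hnorm_ge0. Qed.

Definition hsubspace (M : set H) : Prop :=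
  M 0 /\ (forall a x y, M x -> M y -> M (a *: x + y)).

Definition hclosed (M : set H) : Prop :=
  forall u l, (forall n, M (u n)) -> hlim u l -> M l.

(* A sequence in a convex set whose norms approach the infimum is Cauchy, by
   the parallelogram identity. *)
Lemma minimizing_cauchy (u : nat -> H) (d : R) :
  0 <= d -> (forall n m, 2 * d <= hnorm (u n + u m)) ->
  (forall n, hnorm (u n) ^+ 2 <= d ^+ 2 + n.+1%:R^-1) -> exists l, hlim u l.
Proof.
move=> d0 hd hu; apply: hcomplete => e e0.
have e2 : 0 < e ^+ 2 / 4 by rewrite divr_gt0 // exprn_gt0.
have [N _ hN] := near_infty_natSinv_lt (PosNum e2).
exists N => n m hn hm; apply: sqr_hnorm_le; first exact: ltW.
have := parallelogram (u n) (u m).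
have : (2 * d) ^+ 2 <= hnorm (u n + u m) ^+ 2.
  by rewrite ler_sqr ?nnegrE ?hnorm_ge0 ?mulr_ge0.
have := hu n; have := hu m; move: (hN _ hn) (hN _ hm) => /=.
rewrite exprMn; set a := n.+1%:R^-1; set b := m.+1%:R^-1.
move: a b => a b; lra.
Qed.

Lemma hlim_le (u : nat -> H) l (c : R) :
  hlim u l -> (forall n, hnorm (u n) <= c) -> hnorm l <= c.
Proof.
move=> hl hc; apply/ler_addgt0Pl => e e0.
have [N hN] := hl _ e0.
have := hnormD (u N) (l - u N); rewrite subrKC hnormB => /le_trans; apply.
by rewrite addrC lerD // hN.
Qed.

(** The distance from [x] to [M] is attained, and the minimal residual [l] is orthogonal to [M],
    hence zero by the last hypothesis. *)
Lemma hclosed_full (M : set H) : hsubspace M -> hclosed M ->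
  (forall y, (forall x, M x -> dot x y = 0) -> y = 0) -> forall x, M x.
Proof.
move=> [M0 ML] Mc Mo x.
have MN y : M y -> M (- y) by move=> h; rewrite -scaleN1r -[_ *: _]addr0; exact: ML.
have MD y z : M y -> M z -> M (y + z) by rewrite -{2}(scale1r y); exact: ML.
have MZ a y : M y -> M (a *: y) by move=> h; rewrite -[_ *: _]addr0; exact: ML.
pose E := [set hnorm (x - y) | y in M].
have Einf : has_inf E.
  split; first by exists (hnorm (x - 0)), 0.
  by exists 0 => _ [y _ <-]; exact: hnorm_ge0.
pose d := inf E.
have d0 : 0 <= d by apply: lb_le_inf => [|_ [y _ <-]]; [case: Einf|exact: hnorm_ge0].
have dle y : M y -> d <= hnorm (x - y).
  by move=> My; apply: ge_inf; [case: Einf|exists y].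
have ex n : exists y, M y /\ hnorm (x - y) ^+ 2 <= d ^+ 2 + n.+1%:R^-1.
  pose e := Num.sqrt (d ^+ 2 + n.+1%:R^-1).
  have e0 : 0 <= d ^+ 2 + n.+1%:R^-1 by rewrite addr_ge0 // sqr_ge0.
  have : d < e.
    rewrite -ltr_sqr ?nnegrE // ?sqrtr_ge0 // sqr_sqrtr // ltrDl.
    by rewrite invr_gt0.
  case/inf_lt => [|_ [y My <-] he]; first by case: Einf.
  exists y; split=> //.
  rewrite -(sqr_sqrtr e0) ler_sqr ?nnegrE ?hnorm_ge0 ?sqrtr_ge0 //.
  exact: ltW.
have [y hy] := choice ex.
have [l hl] : exists l, hlim (fun n => x - y n) l.
  apply: (@minimizing_cauchy _ d) => // [n m|n]; last by case: (hy n).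
  have -> : x - y n + (x - y m) = 2 *: (x - 2^-1 *: (y n + y m)).
    rewrite scalerBr scalerA divff ?pnatr_eq0 // scale1r.
    by rewrite scaler_nat mulr2n opprD addrACA.
  rewrite hnormZ (_ : normc 2 = 2); last first.
    by rewrite -(rmorph_nat (real_complex R)) normcR ger0_norm.
  rewrite ler_pM2l //; apply: dle; apply: MZ; apply: MD.
    by case: (hy n).
  by case: (hy m).
have Mxl : M (x - l).
  apply: (Mc y) => [n|e /hl [N hN]]; first by case: (hy n).
  exists N => n /hN; rewrite hnormB.
  by rewrite !opprB addrCA.
have dl : hnorm l ^+ 2 <= d ^+ 2.
  apply/ler_addgt0Pl => e e0.
  suff : hnorm l <= Num.sqrt (e + d ^+ 2).
    rewrite -ler_sqr ?nnegrE ?hnorm_ge0 ?sqrtr_ge0 // sqr_sqrtr //.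
    by rewrite addr_ge0 ?sqr_ge0 // ltW.
  have [N _ hN] := near_infty_natSinv_lt (PosNum e0).
  apply: (@hlim_le (fun n => x - y (N + n)%N)).
    move=> e' /hl [N' hN']; exists N' => n hn; apply: hN'.
    exact: leq_trans hn (leq_addl _ _).
  move=> n; rewrite -ler_sqr ?nnegrE ?hnorm_ge0 ?sqrtr_ge0 // sqr_sqrtr //.
    case: (hy (N + n)%N) => _ /le_trans; apply; rewrite addrC lerD2r.
    by apply: ltW; apply: hN => /=; exact: leq_addr.
  by rewrite addr_ge0 ?sqr_ge0 // ltW.
suff l0 : l = 0 by move: Mxl; rewrite l0 subr0.
apply: Mo => z Mz.
(* first variation at the minimiser *)
have key a : 0 <= normc a ^+ 2 * hnorm z ^+ 2 - 2 * complex.Re (conjc a * dot l z).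
  have := dle _ (MD _ _ Mxl (MZ a _ Mz)).
  have -> : x - (x - l + a *: z) = l - a *: z.
    by rewrite opprD opprB addrA addrCA subrr addr0.
  rewrite -ler_sqr ?nnegrE ?hnorm_ge0 // sqr_hnormB hnormZ dotZr exprMn.
  by move=> h; move: (le_trans dl h); lra.
suff -> : dot z l = conjc 0 by rewrite conjc0.
rewrite dot_conj; congr conjc; apply/eqP; rewrite -normc_eq0.
apply: contraT => nz.
(* With the step [t%:C * dot l z] along [z], the bound [t * hnorm z ^+ 2 <= 1] makes the quadratic
   cost at most half of the linear gain, which contradicts minimality. *)
pose t := (hnorm z ^+ 2 + 1)^-1.
have z1 : 0 < hnorm z ^+ 2 + 1 by rewrite ltr_wpDl // sqr_ge0.
have t0 : 0 < t by rewrite invr_gt0.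
have := key (t%:C * dot l z).
rewrite conjcZ -mulrA (mulrC (conjc _)) -sqr_normcE -rmorphM /=.
rewrite normcM normcR (ger0_norm (ltW t0)) exprMn.
have p0 : 0 < normc (dot l z) ^+ 2 by rewrite exprn_even_gt0.
have tz : t * hnorm z ^+ 2 <= 1.
  by rewrite /t mulrC ler_pdivrMr // mul1r lerDl.
move=> h; exfalso.
have : t ^+ 2 * normc (dot l z) ^+ 2 * hnorm z ^+ 2 = (t * hnorm z ^+ 2) * (t * normc (dot l z) ^+ 2) by ring.
have tp : 0 < t * normc (dot l z) ^+ 2 by rewrite mulr_gt0.
move=> e; move: h; rewrite e.
have : t * hnorm z ^+ 2 * (t * normc (dot l z) ^+ 2) <= 1 * (t * normc (dot l z) ^+ 2).
  by rewrite ler_pM2r.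
move: (t * normc (dot l z) ^+ 2) tp => w; lra.
Qed.

End Hilbert.

(** * Self-adjoint operators and resolvents *)

Section SelfAdjoint.
Variables (R : realType) (H : completeNormedModType R[i]).
Variable dot : {dot H for Num.conj}.
Hypothesis dot_norm : forall x : H, `|x| ^+ 2 = dot x x.
Implicit Types (x y : H) (a z : R[i]).

(** Reduces vector identities to scalar ones: after testing against an arbitrary [w] and expanding
    with [dotE], [ring] closes them. This pattern recurs throughout. *)
Lemma dot_inj x y : (forall w, dot x w = dot y w) -> x = y.
Proof.
move=> h; apply/eqP; rewrite -subr_eq0; apply/eqP/(dotxx_eq0 dot_norm).
by rewrite dotBl h subrr.
Qed.

Definition dotE := (@dotDl R H dot, @dotNl R H dot, @dotZl R H dot,
  @dotDr R H dot, @dotNr R H dot, @dotZr R H dot).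

Lemma linear_op0 (T : H -> H) : linear T -> T 0 = 0.
Proof. by move=> /(_ (-1) 0 0); rewrite scaleN1r addNr scaleN1r addNr. Qed.

Lemma linear_opD (T : H -> H) x y : linear T -> T (x + y) = T x + T y.
Proof. by move=> /(_ 1 x y); rewrite !scale1r. Qed.

Lemma linear_opZ (T : H -> H) a x : linear T -> T (a *: x) = a *: T x.
Proof. by move=> h; have := h a x 0; rewrite !addr0 linear_op0 // addr0. Qed.

Lemma linear_opN (T : H -> H) x : linear T -> T (- x) = - T x.
Proof. by move=> h; rewrite -scaleN1r linear_opZ // scaleN1r. Qed.

Lemma linear_opB (T : H -> H) x y : linear T -> T (x - y) = T x - T y.
Proof. by move=> h; rewrite linear_opD // linear_opN. Qed.

Lemma linear_op_sum (T : H -> H) (I : Type) (r : seq I) (P : pred I) (F : I -> H) :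
  linear T -> T (\sum_(i <- r | P i) F i) = \sum_(i <- r | P i) T (F i).
Proof.
move=> hT; elim/big_rec2: _ => [|i u v _ <-]; first exact: linear_op0.
exact: linear_opD.
Qed.

Lemma linear_op_comp (S T : H -> H) : linear S -> linear T -> linear (S \o T).
Proof. by move=> hS hT a x y /=; rewrite hT hS. Qed.

Lemma linear_op_lin a (S T : H -> H) : linear S -> linear T ->
  linear (fun x => a *: S x + T x).
Proof.
move=> hS hT b x y; rewrite hS hT; apply: dot_inj => w; rewrite !dotE; ring.
Qed.

Lemma linear_op_sub (S T : H -> H) : linear S -> linear T -> linear (S \- T).
Proof.
move=> hS hT b x y /=; rewrite hS hT; apply: dot_inj => w; rewrite !dotE; ring.
Qed.

Variable A : operator H.
Hypothesis saA : self_adjoint dot A.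

Lemma sa_sym x y : op_dom A x -> op_dom A y ->
  dot (op_fun A x) y = dot x (op_fun A y).
Proof. by case: saA => _ _ h hx hy; have [_] := h y (op_fun A y); apply. Qed.

Lemma sa_lin a x y : op_dom A x -> op_dom A y ->
  op_dom A (a *: x + y) /\ op_fun A (a *: x + y) = a *: op_fun A x + op_fun A y.
Proof. by case: saA => [[_ h] _ _]; apply: h. Qed.

Lemma sa_dom0 : op_dom A 0.
Proof. by case: saA => [[h _] _ _]. Qed.

Lemma sa_domB x y : op_dom A x -> op_dom A y ->
  op_dom A (x - y) /\ op_fun A (x - y) = op_fun A x - op_fun A y.
Proof.
move=> hx hy; have := sa_lin (-1) hy hx.
by rewrite !scaleN1r ![- _ + _]addrC.
Qed.

(** Since [dot (op_fun A y) y] is real, pairing [op_fun A y - z *: y] with [y] has imaginary part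
    [- (complex.Im z * hnorm y ^+ 2)]; Cauchy-Schwarz does the rest. *)
Lemma sa_lower_bound z y : op_dom A y ->
  `|complex.Im z| * hnorm y <= hnorm (op_fun A y - z *: y).
Proof.
move=> hy; have [->|y0] := eqVneq y 0; first by rewrite hnorm0 mulr0 hnorm_ge0.
have yp : 0 < hnorm y by rewrite lt_def hnorm_ge0 hnorm_eq0 y0.
rewrite -(ler_pM2r yp).
apply: le_trans (cauchy_schwarz dot_norm _ _).
apply: le_trans (ImN_le_normc _).
have real0 : complex.Im (dot (op_fun A y) y) = 0.
  have := sa_sym hy hy; rewrite [in RHS](dot_conj dot).
  by case: (dot _ y) => u v [] /=; lra.
have -> : complex.Im (dot (op_fun A y - z *: y) y) = - (complex.Im z * hnorm y ^+ 2).
  rewrite dotBl dotZl (dotxx dot_norm).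
  case: (dot _ y) real0 => u v /= ->; case: z => p q /=; ring.
by rewrite normrN normrM -mulrA -expr2 (@ger0_norm _ (_ ^+ 2)) // sqr_ge0.
Qed.

Variable z : R[i].
Hypothesis zr : z \isn't Num.real.

(** The range of A - w is closed: the lower bound makes preimages of a Cauchy sequence Cauchy, and a
    self-adjoint operator is closed. A vector orthogonal to the range lies in the kernel of A -
    [conjc w], which the lower bound at [conjc w] reduces to zero. *)
Lemma resolvent_ex w x : w \isn't Num.real ->
  exists y, op_dom A y /\ op_fun A y - w *: y = x.
Proof.
move=> wr; have imw : 0 < `|complex.Im w| by rewrite normr_gt0 -nonrealE.
pose M := [set x | exists y, op_dom A y /\ op_fun A y - w *: y = x].
apply: (@hclosed_full _ _ _ dot_norm M).
- split.
    exists 0; split; first exact: sa_dom0.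
    have := (sa_domB sa_dom0 sa_dom0).2; rewrite subr0 => ->.
    by rewrite subrr scaler0 subr0.
  move=> a u v [u' [du <-]] [v' [dv <-]]; exists (a *: u' + v').
  have [d ->] := sa_lin a du dv; split=> //.
  by apply: dot_inj => p; rewrite !dotE; ring.
- move=> u l hu ul; have [y hy] := choice hu.
  have yC n m : `|complex.Im w| * hnorm (y n - y m) <= hnorm (u n - u m).
    have [dn en] := hy n; have [dm em] := hy m.
    have [d e] := sa_domB dn dm.
    suff <- : op_fun A (y n - y m) - w *: (y n - y m) = u n - u m.
      exact: sa_lower_bound.
    by rewrite e -en -em; apply: dot_inj => p; rewrite !dotE; ring.
  have [y0 yl] : exists l, hlim y l.
    apply: hcomplete => e e0.
    have ep : 0 < `|complex.Im w| * e / 2 by rewrite divr_gt0 // mulr_gt0.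
    have [N hN] := ul _ ep; exists N => n m hn hm.
    rewrite -(ler_pM2l imw); apply: le_trans (yC _ _) _.
    rewrite [_ * e]splitr; apply: le_trans (hnorm_triangle l _ _) _.
    by rewrite lerD ?hN // hnormB hN.
  have [_ _ hadj] := saA; exists y0.
  (* The graph of [A] is its adjoint graph, and a relation tested against a fixed [x0] survives
     limits; this puts [y0] in the domain. *)
  have : adjoint_graph dot A y0 (l + w *: y0).
    move=> x0 dx; apply/eqP; rewrite -subr_eq0 -normc_eq0 eq_le normc_ge0 andbT.
    apply/ler_addgt0Pl => e e0; rewrite addr0.
    pose c := hnorm (op_fun A x0) + hnorm x0 * (1 + normc w).
    have c0 : 0 <= c.
      by rewrite addr_ge0 ?mulr_ge0 ?addr_ge0 ?hnorm_ge0 ?normc_ge0.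
    have ec : 0 < e / (c + 1) by rewrite divr_gt0 // ltr_wpDl.
    have [N1 h1] := ul _ ec; have [N2 h2] := yl _ ec.
    pose n := maxn N1 N2.
    have [dn en] := hy n.
    have -> : dot (op_fun A x0) y0 - dot x0 (l + w *: y0) =
       dot x0 ((u n - l) + w *: (y n - y0)) - dot (op_fun A x0) (y n - y0).
      rewrite !dotE (sa_sym dx dn) -en !dotE; ring.
    apply: le_trans (le_normcB _ _) _.
    have hu1 : hnorm (u n - l) <= e / (c + 1) by rewrite h1 // leq_maxl.
    have hy1 : hnorm (y n - y0) <= e / (c + 1) by rewrite h2 // leq_maxr.
    apply: (@le_trans _ _ (c * (e / (c + 1)))).
      rewrite /c mulrDl addrC lerD //.
        apply: le_trans (cauchy_schwarz dot_norm _ _) _.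
        by rewrite ler_wpM2l ?hnorm_ge0.
      apply: le_trans (cauchy_schwarz dot_norm _ _) _.
      rewrite -mulrA ler_wpM2l ?hnorm_ge0 // mulrDl mul1r.
      apply: le_trans (hnormD _ _) _; rewrite lerD // hnormZ.
      by rewrite ler_wpM2l ?normc_ge0.
    rewrite mulrCA ger_pMr // ler_pdivrMr ?mul1r ?lerDl //.
    by rewrite ltr_wpDl.
  by move/hadj => [d ->]; rewrite addrK.
- move=> y hy; have [_ _ hadj] := saA.
  have : adjoint_graph dot A y (conjc w *: y).
    move=> x0 dx; have := hy (op_fun A x0 - w *: x0) (ex_intro _ x0 (conj dx erefl)).
    by rewrite !dotE => /eqP; rewrite conjcK subr_eq0 => /eqP.
  move/hadj => [d e].
  have := sa_lower_bound (conjc w) d; rewrite e subrr hnorm0.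
  rewrite pmulr_rle0; first exact: hnorm_le0.
  by rewrite normr_gt0 -nonrealE nonreal_conj.
Qed.

Lemma resolventP w x : w \isn't Num.real ->
  op_dom A (resolvent A w x) /\
  op_fun A (resolvent A w x) - w *: resolvent A w x = x.
Proof.
move=> wr; rewrite /resolvent.
by case: xgetP => [y -> //|]; have [y hy] := resolvent_ex x wr => /(_ y).
Qed.

Lemma resolvent_uniq w y : w \isn't Num.real -> op_dom A y ->
  resolvent A w (op_fun A y - w *: y) = y.
Proof.
move=> wr dy; have [d e] := resolventP (op_fun A y - w *: y) wr.
have [d1 e1] := sa_domB d dy.
have := sa_lower_bound w d1; rewrite e1.
set r := resolvent _ _ _ in e d1 e1 *.
have -> : op_fun A r - op_fun A y - w *: (r - y) = 0.
  transitivity ((op_fun A r - w *: r) - (op_fun A y - w *: y)).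
    by apply: dot_inj => p; rewrite !dotE; ring.
  by rewrite e subrr.
rewrite hnorm0 pmulr_rle0 ?normr_gt0 -?nonrealE // => /hnorm_le0 /eqP.
by rewrite subr_eq0 => /eqP.
Qed.

Lemma resolvent_linear w : w \isn't Num.real -> linear (resolvent A w).
Proof.
move=> wr a x y.
have [dx ex] := resolventP x wr; have [dy ey] := resolventP y wr.
have [d e] := sa_lin a dx dy.
rewrite -[RHS](resolvent_uniq wr d) e; congr (resolvent A w).
rewrite -[in LHS]ex -[in LHS]ey.
by apply: dot_inj => p; rewrite !dotE; ring.
Qed.

Lemma resolvent_bound w x : w \isn't Num.real ->
  hnorm (resolvent A w x) <= `|complex.Im w|^-1 * hnorm x.
Proof.
move=> wr; have [d e] := resolventP x wr.
have iw : 0 < `|complex.Im w| by rewrite normr_gt0 -nonrealE.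
by rewrite mulrC ler_pdivlMr // mulrC -{2}e sa_lower_bound.
Qed.

Lemma resolvent_identity w v x : w \isn't Num.real -> v \isn't Num.real ->
  resolvent A w x - resolvent A v x = (w - v) *: resolvent A w (resolvent A v x).
Proof.
move=> wr vr; have [d e] := resolventP x vr.
have lw := resolvent_linear wr.
transitivity (resolvent A w x -
  resolvent A w (op_fun A (resolvent A v x) - w *: resolvent A v x)).
  by rewrite resolvent_uniq.
rewrite -(linear_opB _ _ lw) -(linear_opZ _ _ lw); congr (resolvent A w _).
by rewrite -[X in X - _]e; apply: dot_inj => p; rewrite !dotE; ring.
Qed.

Lemma resolventC w v x : w \isn't Num.real -> v \isn't Num.real ->
  resolvent A w (resolvent A v x) = resolvent A v (resolvent A w x).
Proof.
move=> wr vr; have [->//|wv] := eqVneq w v.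
apply: (@scalerI _ _ (w - v)); first by rewrite subr_eq0.
rewrite -resolvent_identity // -(opprB v w) scaleNr -resolvent_identity //.
by rewrite opprB.
Qed.

Lemma resolvent_adjoint w x y : w \isn't Num.real ->
  dot (resolvent A w x) y = dot x (resolvent A (conjc w) y).
Proof.
move=> wr; have wr' := nonreal_conj wr.
have [d e] := resolventP x wr; have [d' e'] := resolventP y wr'.
rewrite -[in LHS]e' -[in RHS]e !dotE conjcK (sa_sym d d'); ring.
Qed.

(** The everywhere defined form of (A - [conjc w]) (A - w)^{-1}. Conjugating [w] gives both its
    inverse and its adjoint. *)
Definition cayley w x := x + (w - conjc w) *: resolvent A w x.

Lemma cayley_linear w : w \isn't Num.real -> linear (cayley w).
Proof.
move=> wr a x y; rewrite /cayley (resolvent_linear wr).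
by apply: dot_inj => p; rewrite !dotE; ring.
Qed.

Lemma cayleyK w x : w \isn't Num.real -> cayley w (cayley (conjc w) x) = x.
Proof.
move=> wr; have wr' := nonreal_conj wr; have lw := resolvent_linear wr.
rewrite /cayley conjcK (linear_opD _ _ lw) (linear_opZ _ _ lw).
apply: dot_inj => p; move: (congr1 (dot^~ p) (resolvent_identity x wr wr')).
rewrite !dotE => h.
have -> : dot (resolvent A (conjc w) x) p = dot (resolvent A w x) p -
   (w - conjc w) * dot (resolvent A w (resolvent A (conjc w) x)) p.
  by rewrite -h; ring.
ring.
Qed.

Lemma cayley_adjoint w x y : w \isn't Num.real ->
  dot (cayley w x) y = dot x (cayley (conjc w) y).
Proof.
move=> wr; rewrite /cayley !dotE resolvent_adjoint // conjcK rmorphB /= conjcK.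
by [].
Qed.

Lemma hnorm_cayley w x : w \isn't Num.real -> hnorm (cayley w x) = hnorm x.
Proof.
move=> wr; apply/eqP; rewrite -(@eqrXn2 _ 2) ?hnorm_ge0 //; apply/eqP.
apply: (@complexI R); rewrite -!(dotxx dot_norm) cayley_adjoint //.
by have := cayleyK x (nonreal_conj wr); rewrite conjcK => ->.
Qed.

End SelfAdjoint.

(** * Functions vanishing at infinity *)

Section VanishingFunctions.
Variable R : realType.
Implicit Types (f g : R -> R[i]) (z : R[i]) (s t e : R).

Definition vanishing_eps f : Prop :=
  (forall t e, 0 < e -> exists d : R, 0 < d /\
     forall s, `|s - t| <= d -> normc (f s - f t) <= e) /\
  (forall e, 0 < e -> exists L : R, forall t, L <= `|t| -> normc (f t) <= e).

Lemma posC (e : R[i]) : 0 < e -> exists2 e' : R, 0 < e' & e = e'%:C.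
Proof.
move=> e0; exists (complex.Re e); last by rewrite RRe_real // gtr0_real.
by move: e0; rewrite ltcE => /andP[].
Qed.

Lemma vanishingP f : vanishing_continuous f <-> vanishing_eps f.
Proof.
split=> [[fc fp fn]|[fc fl]].
  split=> [t e e0|e e0].
    have e0' : 0 < e%:C by rewrite ltcR.
    have /cvgr_dist_le /(_ _ e0') := fc t.
    case/nbhs_ballP => d /= d0 hd; exists (d / 2); split; first exact: divr_gt0.
    move=> s hs; rewrite normcB -lecR -normcE_norm.
    by apply: hd; rewrite /ball /= distrC (le_lt_trans hs) // ltr_pdivrMr // mulr_natr mulr2n ltrDl.
  have e0' : 0 < e%:C by rewrite ltcR.
  have /cvgr0Pnorm_le /(_ _ e0') [M1 [_ h1]] := fp.
  have /cvgr0Pnorm_le /(_ _ e0') [M2 [_ h2]] := fn.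
  exists (`|M1| + `|M2| + 1) => t ht; rewrite -lecR -normcE_norm.
  have [t0|t0] := leP 0 t.
    apply: h1; rewrite (ger0_norm t0) in ht; apply: lt_le_trans ht.
    have := ler_norm M1; have := normr_ge0 M2; lra.
  apply: h2; rewrite (ltr0_norm t0) in ht.
  have := ler_norm (- M2); rewrite normrN; have := normr_ge0 M1; lra.
split.
- move=> t; apply/cvgrPdist_le => e /posC [e' e0 ->].
  have [d [d0 hd]] := fc t e' e0.
  apply/nbhs_ballP; exists d => //= s hs.
  by rewrite normcE_norm normcB lecR hd // distrC ltW.
- apply/cvgr0Pnorm_le => e /posC [e' e0 ->]; have [L hL] := fl _ e0.
  exists L; split; first exact: num_real.
  move=> t Lt; rewrite normcE_norm lecR hL //.
  by apply: le_trans (ltW Lt) _; exact: ler_norm.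
- apply/cvgr0Pnorm_le => e /posC [e' e0 ->]; have [L hL] := fl _ e0.
  exists (- L); split; first exact: num_real.
  move=> t Lt; rewrite normcE_norm lecR hL // -normrN.
  by apply: le_trans (ler_norm _); move: Lt => /=; lra.
Qed.

(** A failure at every scale [n.+1%:R^-1] would give pairs accumulating at one point, against
    continuity there. Only [t] is confined to the bounded interval, so pairs with [s] outside are
    covered as well. *)
Lemma vanishing_uniform f : vanishing_eps f -> forall L e, 0 < e ->
  exists d : R, 0 < d /\ forall s t, `|t| <= L -> `|s - t| <= d ->
    normc (f s - f t) <= e.
Proof.
move=> [fc _] L e e0; apply: contrapT => hn.
have ex n : exists p : R * R, [/\ `|p.2| <= L, `|p.1 - p.2| <= n.+1%:R^-1
    & e < normc (f p.1 - f p.2)].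
  apply: contrapT => h; apply: hn; exists n.+1%:R^-1; split=> // s t ht hst.
  rewrite leNgt; apply/negP => he; apply: h; by exists (s, t).
have [p hp] := choice ex.
have bp : bounded_fun (fun n => (p n).2).
  exists L; split; first exact: num_real.
  by move=> M LM n _ /=; case: (hp n) => h _ _; exact: le_trans h (ltW LM).
have [g gi /cvg_ex [l gl]] := bolzano_weierstrass bp.
have e2 : 0 < e / 2 by rewrite divr_gt0.
have [d [d0 hd]] := fc l _ e2.
have d2 : 0 < d / 2 by rewrite divr_gt0.
have [N1 _ h1] := (cvgrPdist_le _ _).1 gl _ d2.
have [N2 _ h2] := near_infty_natSinv_lt (PosNum d2).
pose n := maxn N1 N2.
have gn k : (k <= g k)%N.
  elim: k => // k IH; apply: leq_ltn_trans IH _.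
  by have e' : (g k < g k.+1)%N = (k < k.+1)%N := leW_mono gi k k.+1; rewrite e'.
have [_ hst hlt] := hp (g n).
have hN1 : `|(p (g n)).2 - l| <= d / 2 by rewrite distrC; apply: h1; exact: leq_maxl.
have hN2 : `|(p (g n)).1 - (p (g n)).2| <= d / 2.
  apply: le_trans hst _; apply: ltW; apply: h2 => /=.
  exact: leq_trans (leq_maxr _ _) (gn _).
have a2 : `|(p (g n)).2 - l| <= d by apply: le_trans hN1 _; lra.
have a1 : `|(p (g n)).1 - l| <= d.
  have := ler_normD ((p (g n)).1 - (p (g n)).2) ((p (g n)).2 - l).
  rewrite addrA subrK => /le_trans; apply; lra.
move: hlt; apply/negP; rewrite -leNgt.
have := le_normcB (f (p (g n)).1 - f l) (f (p (g n)).2 - f l).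
rewrite opprB addrA subrK => /le_trans; apply.
rewrite [e]splitr lerD //; exact: hd.
Qed.

(** Outside [[-L, L]] the modulus is at most 1; walking outwards from a point inside takes at most
    [K] steps of length [d], each changing [f] by at most 1. *)
Lemma vanishing_bounded f : vanishing_eps f -> exists B : R, forall t, normc (f t) <= B.
Proof.
move=> vf; have [_ /(_ 1 ltr01) [L0 hL0]] := vf.
pose L := `|L0|.
have hL t : L <= `|t| -> normc (f t) <= 1.
  by move=> ht; apply: hL0; apply: le_trans ht; exact: ler_norm.
have [d [d0 hd]] := vanishing_uniform vf L ltr01.
pose K := Num.bound (L / d).
have hK : L < d * K%:R.
  rewrite mulrC -ltr_pdivrMr //; apply: archi_boundP.
  by rewrite divr_ge0 // ?normr_ge0 // ltW.
have claim k : forall t, L - d * k%:R <= `|t| -> normc (f t) <= 1 + k%:R.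
  elim: k => [|k IH] t; first by rewrite mulr0 subr0 addr0; exact: hL.
  move=> ht; have [/hL h|tL] := leP L `|t|.
    by apply: le_trans h _; rewrite lerDl.
  pose s := t + (if 0 <= t then d else - d).
  have hs : `|s| = `|t| + d.
    rewrite /s; case: leP => t0; first by rewrite !ger0_norm // addr_ge0 // ltW.
    by rewrite !ltr0_norm // ?opprD ?opprK //; lra.
  have st : `|s - t| <= d.
    rewrite /s addrC addKr; case: ifP => _; rewrite ?normrN ger0_norm //; exact: ltW.
  have := IH s; rewrite hs => IHs.
  have := hd s t (ltW tL) st => hst.
  have := ler_normcB (f t) (f s); rewrite normcB => /le_trans; apply.
  rewrite -natr1 addrA lerD // IHs //.
  by move: ht; rewrite -natr1; lra.
exists (1 + K%:R) => t; apply: claim; have := normr_ge0 t; lra.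
Qed.

Lemma vanishing_lin a f g : vanishing_eps f -> vanishing_eps g ->
  vanishing_eps (fun t => a * f t + g t).
Proof.
move=> [fc fl] [gc gl].
have half e : 0 < e -> [/\ 0 < e / 2 / (1 + normc a), 0 < e / 2 &
    forall u, u <= e / 2 / (1 + normc a) -> normc a * u <= e / 2].
  move=> e0; have a1 : 0 < 1 + normc a by rewrite ltr_pwDl // normc_ge0.
  have e2 : 0 < e / 2 by rewrite divr_gt0.
  split=> [|//|u hu]; first by rewrite !divr_gt0.
  apply: le_trans (ler_wpM2l (normc_ge0 a) hu) _.
  rewrite mulrCA ger_pMr // ler_pdivrMr // mul1r; lra.
split=> [t e /half [e1 e2 h]|e /half [e1 e2 h]].
  have [d1 [d10 h1]] := fc t _ e1; have [d2 [d20 h2]] := gc t _ e2.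
  exists (Num.min d1 d2); rewrite lt_min d10 d20; split=> // s.
  rewrite le_min => /andP[s1 s2].
  have -> : a * f s + g s - (a * f t + g t) = a * (f s - f t) + (g s - g t) by ring.
  apply: le_trans (le_normcD _ _) _; rewrite [e]splitr lerD ?h2 //.
  by rewrite normcM h // h1.
have [L1 h1] := fl _ e1; have [L2 h2] := gl _ e2.
exists (Num.max L1 L2) => t; rewrite ge_max => /andP[t1 t2].
apply: le_trans (le_normcD _ _) _; rewrite [e]splitr lerD ?h2 //.
by rewrite normcM h // h1.
Qed.

(** The factor [f] is only continuous and bounded: this serves the square root factor in
    [fcalc_bound], which does not vanish at infinity. *)
Lemma vanishing_mul f g : vanishing_eps g ->
  (forall t e, 0 < e -> exists d : R, 0 < d /\
     forall s, `|s - t| <= d -> normc (f s - f t) <= e) ->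
  (exists B : R, forall t, normc (f t) <= B) ->
  vanishing_eps (fun t => f t * g t).
Proof.
move=> vg fc [B hB]; have [gc gl] := vg; have [C hC] := vanishing_bounded vg.
have B0 : 0 <= B := le_trans (normc_ge0 _) (hB 0).
have C0 : 0 <= C := le_trans (normc_ge0 _) (hC 0).
have half K e : 0 <= K -> 0 < e -> 0 < e / 2 / (1 + K) /\
    forall u, u <= e / 2 / (1 + K) -> K * u <= e / 2.
  move=> K0 e0; have a1 : 0 < 1 + K by rewrite ltr_pwDl.
  have e2 : 0 < e / 2 by rewrite divr_gt0.
  split=> [|u hu]; first by rewrite !divr_gt0.
  apply: le_trans (ler_wpM2l K0 hu) _.
  rewrite mulrCA ger_pMr // ler_pdivrMr // mul1r; lra.
split=> [t e e0|e e0].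
  have [e1 k1] := half C e C0 e0; have [e2 k2] := half B e B0 e0.
  have [d1 [d10 h1]] := fc t _ e1; have [d2 [d20 h2]] := gc t _ e2.
  exists (Num.min d1 d2); rewrite lt_min d10 d20; split=> // s.
  rewrite le_min => /andP[s1 s2].
  have -> : f s * g s - f t * g t = (f s - f t) * g s + f t * (g s - g t) by ring.
  apply: le_trans (le_normcD _ _) _; rewrite [e]splitr lerD // normcM.
    rewrite mulrC; apply: le_trans (k1 _ (h1 _ s1)).
    by rewrite ler_wpM2r ?normc_ge0.
  apply: le_trans (k2 _ (h2 _ s2)).
  by rewrite ler_wpM2r ?normc_ge0.
have [e2 k2] := half B e B0 e0; have [L h] := gl _ e2.
exists L => t /h ht; rewrite normcM; apply: (@le_trans _ _ (B * normc (g t))).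
  by rewrite ler_wpM2r ?normc_ge0.
apply: le_trans (k2 _ ht) _; lra.
Qed.

Lemma vanishing_prod f g : vanishing_eps f -> vanishing_eps g ->
  vanishing_eps (fun t => f t * g t).
Proof.
move=> vf vg; apply: vanishing_mul => //; first by case: vf.
exact: vanishing_bounded.
Qed.

Lemma vanishing_conj f : vanishing_eps f -> vanishing_eps (fun t => conjc (f t)).
Proof.
move=> [fc fl]; split=> [t e /(fc t) [d [d0 h]]|e /fl [L h]].
  by exists d; split=> // s /h; rewrite -rmorphB normc_conj.
by exists L => t /h; rewrite normc_conj.
Qed.

Lemma subr_nonreal t z : z \isn't Num.real -> t%:C - z != 0.
Proof.
by apply: contraNneq => /eqP; rewrite subr_eq0 => /eqP <-; rewrite complex_real.
Qed.

Lemma normc_ge_Im t z : `|complex.Im z| <= normc (t%:C - z).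
Proof.
by apply: le_trans (ImN_le_normc _); case: z => x y /=; rewrite sub0r normrN.
Qed.

Lemma normc_resf t z : z \isn't Num.real ->
  normc (t%:C - z)^-1 <= `|complex.Im z|^-1.
Proof.
move=> zr; rewrite normcV lef_pV2 ?normc_ge_Im // posrE ?normr_gt0 -?nonrealE //.
by rewrite lt_def normc_ge0 normc_eq0 subr_nonreal.
Qed.

Lemma vanishing_resf z : z \isn't Num.real -> vanishing_eps (fun t => (t%:C - z)^-1).
Proof.
move=> zr; have y0 : 0 < `|complex.Im z| by rewrite normr_gt0 -nonrealE.
split=> [t e e0|e e0].
  exists (e * `|complex.Im z| ^+ 2); split; first by rewrite mulr_gt0 ?exprn_gt0.
  move=> s hs.
  have -> : (s%:C - z)^-1 - (t%:C - z)^-1 =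
      (t%:C - s%:C) * ((s%:C - z)^-1 * (t%:C - z)^-1).
    by field; rewrite ?subr_nonreal.
  rewrite !normcM -rmorphB normcR distrC.
  have h := ler_pM (normc_ge0 _) (normc_ge0 _) (normc_resf s zr) (normc_resf t zr).
  apply: le_trans (ler_pM _ _ hs h) _; rewrite ?mulr_ge0 ?normc_ge0 //.
  have y1 : `|complex.Im z| != 0 by rewrite gt_eqF.
  rewrite le_eqVlt; apply/orP; left; apply/eqP; by field.
exists (e^-1 + normc z) => t ht; rewrite normcV -(invrK e).
have h : e^-1 <= normc (t%:C - z).
  have := ler_normcB t%:C z; rewrite normcR; lra.
by rewrite lef_pV2 // posrE ?invr_gt0 // (lt_le_trans _ h) // invr_gt0.
Qed.

Lemma vanishing_resf_exp z j : z \isn't Num.real ->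
  vanishing_eps (fun t => (t%:C - z)^-1 ^+ j.+1).
Proof.
move=> zr; elim: j => [|j IH]; first exact: vanishing_resf.
by under eq_fun do rewrite exprS; apply: vanishing_prod => //; exact: vanishing_resf.
Qed.

End VanishingFunctions.

(** * Fejer means on the unit circle *)

Section Fejer.
Variable R : realType.
Implicit Types (v w : R[i]) (G : R[i] -> R[i]) (a b : R).

Definition expi a : R[i] := cos a +i* sin a.

Lemma expiD a b : expi (a + b) = expi a * expi b.
Proof. by rewrite /expi cosD sinD; simpc; congr (_ +i* _); ring. Qed.

Lemma expi0 : expi 0 = 1.
Proof. by rewrite /expi cos0 sin0. Qed.

Lemma normc_expi a : normc (expi a) = 1.
Proof. by rewrite /normc /= cos2Dsin2 sqrtr1. Qed.

Lemma expiX a n : expi a ^+ n = expi (n%:R * a).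
Proof.
elim: n => [|n IH]; first by rewrite mul0r expi0.
by rewrite exprS IH -expiD -natr1 mulrDl mul1r addrC.
Qed.

Lemma expi_neq1 a : 0 < a -> a < 2 * pi -> expi a != 1.
Proof.
move=> a0 a2; apply/eqP => /(congr1 (@complex.Re R)) /= h.
have : cos (a / 2 *+ 2) = 1 by rewrite -mulr_natr divfK.
rewrite cos_mulr2n cos2sin2 => h'.
have : 0 < sin (a / 2) by apply: sin_gt0_pi; lra.
move=> sp; have : 0 < sin (a / 2) ^+ 2 by rewrite exprn_gt0.
by move: h'; rewrite mulr2n; lra.
Qed.

Lemma mulrJ_circle w : normc w = 1 -> w * conjc w = 1.
Proof. by move=> h; rewrite -sqr_normcE h expr1n. Qed.

Lemma circle_conjV w : normc w = 1 -> conjc w = w^-1.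
Proof.
move=> h; have w0 : w != 0 by rewrite -normc_eq0 h oner_eq0.
by apply: (mulfI w0); rewrite mulrJ_circle // mulfV.
Qed.

Definition root_unity M : R[i] := expi (2 * pi / M%:R).

Lemma normc_root M q : normc (root_unity M ^+ q) = 1.
Proof. by rewrite expiX normc_expi. Qed.

Lemma root_unity_exp M : (0 < M)%N -> root_unity M ^+ M = 1.
Proof.
move=> M0; rewrite expiX mulrC divfK ?pnatr_eq0 -?lt0n //.
by rewrite /expi mulr_natl cos2pi sin2pi.
Qed.

Lemma root_unity_neq1 M k : (0 < k)%N -> (k < M)%N -> root_unity M ^+ k != 1.
Proof.
move=> k0 kM; have M0 : (0 < M)%N by apply: leq_trans kM.
rewrite expiX; apply: expi_neq1.
  by rewrite mulr_gt0 ?divr_gt0 ?mulr_gt0 ?ltr0n // pi_gt0.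
rewrite mulrCA gtr_pMr ?mulr_gt0 ?pi_gt0 //.
by rewrite ltr_pdivrMr ?ltr0n // mul1r ltr_nat.
Qed.

Lemma sum_root_exp M (x : R[i]) : x ^+ M = 1 -> x != 1 ->
  \sum_(q < M) x ^+ q = 0.
Proof.
move=> xM x1; have x10 : x - 1 != 0 by rewrite subr_eq0.
by apply: (mulfI x10); rewrite mulr0 -subrX1 xM subrr.
Qed.

Lemma root_unity_orth M j l : (j < M)%N -> (l < M)%N ->
  \sum_(q < M) conjc (root_unity M ^+ q) ^+ j * (root_unity M ^+ q) ^+ l =
  (if j == l then M%:R else 0).
Proof.
move=> jM lM; have M0 : (0 < M)%N by apply: leq_trans jM.
set w := root_unity M.
have w1 k : normc (w ^+ k) = 1 by exact: normc_root.
have E (q : nat) : conjc (w ^+ q) ^+ j * (w ^+ q) ^+ l = (conjc w ^+ j * w ^+ l) ^+ q.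
  by rewrite exprMn -!exprM conjcX -exprM mulnC (mulnC q).
under eq_bigr do rewrite E.
have cM : conjc w ^+ M = 1 by rewrite -conjcX root_unity_exp // rmorph1.
have xM : (conjc w ^+ j * w ^+ l) ^+ M = 1.
  by rewrite exprMn -!exprM !(mulnC _ M) !exprM cM root_unity_exp // !expr1n mulr1.
have cw k : conjc w ^+ k * w ^+ k = 1.
  by rewrite -conjcX mulrC mulrJ_circle.
case: (ltngtP j l) => [jl|lj|->].
- apply: sum_root_exp => //.
  rewrite -(subnKC (ltnW jl)) exprD mulrA cw mul1r root_unity_neq1 ?subn_gt0 //.
  exact: leq_ltn_trans (leq_subr _ _) lM.
- apply: sum_root_exp => //.
  rewrite -(subnKC (ltnW lj)) exprD mulrAC cw mul1r.
  rewrite -conjcX -(rmorph1 (@conjc R)) (inj_eq (can_inj (@conjcK R))).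
  rewrite root_unity_neq1 ?subn_gt0 //.
  exact: leq_ltn_trans (leq_subr _ _) jM.
- under eq_bigr do rewrite cw expr1n.
  by rewrite sumr_const card_ord.
Qed.

(* The Fourier coefficients are computed by a quadrature over the [M]-th roots
   of unity, which is exact for trigonometric polynomials of degree below [M]. *)
Definition fcoef G M (j l : nat) : R[i] :=
  M%:R^-1 * \sum_(q < M) G (root_unity M ^+ q) *
    (conjc (root_unity M ^+ q) ^+ j * (root_unity M ^+ q) ^+ l).

(** The Cesaro mean with weights 1 - |k|/N, written as a double sum over k = j - l. In this form the
    kernel is visibly a square, and operators can be substituted for [w] and its conjugate. *)
Definition fejer G N M w : R[i] :=
  N%:R^-1 * \sum_(j < N) \sum_(l < N) fcoef G M j l * (w ^+ j * conjc w ^+ l).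

Definition geom N w : R[i] := \sum_(j < N) w ^+ j.

(** Discrete convolution with a nonnegative kernel, the squared modulus of a geometric sum. *)
Lemma fejerE G N M w : fejer G N M w =
  N%:R^-1 * (M%:R^-1 * \sum_(q < M) G (root_unity M ^+ q) *
    (normc (geom N (w * conjc (root_unity M ^+ q))) ^+ 2)%:C).
Proof.
rewrite /fejer; congr (_ * _).
rewrite /fcoef.
transitivity (\sum_(j < N) \sum_(l < N) \sum_(q < M) M%:R^-1 *
    (G (root_unity M ^+ q) * ((w * conjc (root_unity M ^+ q)) ^+ j *
       conjc ((w * conjc (root_unity M ^+ q)) ^+ l)))).
  apply: eq_bigr => j _; apply: eq_bigr => l _.
  rewrite -mulrA mulr_suml mulr_sumr; apply: eq_bigr => q _.
  rewrite (conjcX (_ * _)) conjcM conjcK !exprMn; ring.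
transitivity (\sum_(j < N) \sum_(q < M) \sum_(l < N) M%:R^-1 *
    (G (root_unity M ^+ q) * ((w * conjc (root_unity M ^+ q)) ^+ j *
       conjc ((w * conjc (root_unity M ^+ q)) ^+ l)))).
  by apply: eq_bigr => j _; rewrite exchange_big.
rewrite exchange_big mulr_sumr; apply: eq_bigr => q _.
rewrite sqr_normcE /geom conjc_sum mulr_suml !mulr_sumr.
apply: eq_bigr => j _; rewrite !mulr_sumr; apply: eq_bigr => l _.
by [].
Qed.

(** The left side is the Fejer mean of the constant 1. Because [N <= M], orthogonality of the
    characters leaves only the [N] diagonal terms, each equal to 1. *)
Lemma fejer_mass N M w : (0 < N)%N -> (N <= M)%N -> normc w = 1 ->
  N%:R^-1 * (M%:R^-1 * \sum_(q < M)
    normc (geom N (w * conjc (root_unity M ^+ q))) ^+ 2) = 1 :> R.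
Proof.
move=> N0 NM w1; have M0 : (0 < M)%N by exact: leq_trans NM.
apply: (@complexI R).
transitivity (fejer (fun=> 1) N M w).
  rewrite fejerE !rmorphM rmorph_sum !fmorphV !rmorph_nat.
  by congr (_ * (_ * _)); apply: eq_bigr => q _; rewrite mul1r.
rewrite /fejer.
transitivity (N%:R^-1 * \sum_(j < N) (1 : R[i])).
  congr (_ * _); apply: eq_bigr => j _.
  rewrite (bigD1 j) //= big1 ?addr0; last first.
    move=> l lj; rewrite /fcoef.
    under eq_bigr do rewrite mul1r.
    rewrite root_unity_orth ?(leq_trans (ltn_ord _)) // ifN ?mulr0 ?mul0r //.
    by rewrite eq_sym.
  rewrite /fcoef; under eq_bigr do rewrite mul1r.
  rewrite root_unity_orth ?(leq_trans (ltn_ord _)) // eqxx.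
  rewrite mulVf ?pnatr_eq0 -?lt0n // mul1r -conjcX.
  by rewrite mulrJ_circle // normcX w1 expr1n.
by rewrite sumr_const card_ord mulVf ?pnatr_eq0 -?lt0n // rmorph1.
Qed.

(** Multiplying the geometric sum by its ratio minus 1 gives a difference of two unimodular numbers,
    of modulus at most 2, while that factor has modulus at least [d]. *)
Lemma normc_geom N v w (d : R) : 0 < d -> normc v = 1 -> normc w = 1 ->
  d <= normc (v - w) -> normc (geom N (w * conjc v)) ^+ 2 <= 4 / d ^+ 2.
Proof.
move=> d0 v1 w1 dvw; rewrite ler_pdivlMr ?exprn_gt0 // -exprMn.
have -> : 4 = 2 ^+ 2 :> R by rewrite expr2; ring.
rewrite ler_sqr ?nnegrE ?mulr_ge0 ?normc_ge0 ?(ltW d0) //.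
apply: (@le_trans _ _ (normc ((w * conjc v - 1) * geom N (w * conjc v)))).
  rewrite normcM mulrC ler_wpM2r ?normc_ge0 //.
  have -> : w * conjc v - 1 = (w - v) * conjc v by rewrite mulrBl (mulrJ_circle v1).
  by rewrite normcM normc_conj v1 mulr1 normcB.
rewrite -subrX1; apply: le_trans (le_normcB _ _) _.
by rewrite normcX normcM normc_conj v1 w1 mulr1 expr1n normc1 -mulr2n.
Qed.

Lemma fejer_cvg G (B : R) :
  (forall w, normc w = 1 -> normc (G w) <= B) ->
  (forall e : R, 0 < e -> exists d : R, 0 < d /\ forall v w, normc v = 1 ->
     normc w = 1 -> normc (v - w) <= d -> normc (G v - G w) <= e) ->
  forall e : R, 0 < e -> exists N0 : nat, forall N M w, (N0 < N)%N -> (N <= M)%N ->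
    normc w = 1 -> normc (fejer G N M w - G w) <= e.
Proof.
move=> GB Gu e e0; have e2 : 0 < e / 2 by rewrite divr_gt0.
have B0 : 0 <= B by apply: le_trans (normc_ge0 _) (GB 1 (normc1 _)).
have [d [d0 hd]] := Gu _ e2.
(* Bounds one far node: [2 * B] for the oscillation of [G], the rest for the kernel. After the
   averaging it contributes [K / N%:R]. *)
pose K := 2 * B * (4 / d ^+ 2).
have K0 : 0 <= K by rewrite !mulr_ge0 ?invr_ge0 ?exprn_ge0 // ltW.
pose N0 := Num.bound (K / (e / 2)); exists N0 => N M w N0N NM w1.
have N0' : (0 < N)%N by apply: leq_trans N0N.
have M0 : (0 < M)%N by exact: leq_trans NM.
have Nr : 0 < N%:R :> R by rewrite ltr0n.
have Mr : 0 < M%:R :> R by rewrite ltr0n.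
have hK : K / N%:R <= e / 2.
  rewrite ler_pdivrMr // mulrC -ler_pdivrMr //.
  apply: (@le_trans _ _ N0%:R); last by rewrite ler_nat ltnW.
  by apply: ltW; apply: archi_boundP; rewrite divr_ge0 // ltW.
set g := fun q : nat => normc (geom N (w * conjc (root_unity M ^+ q))) ^+ 2.
have mass := fejer_mass N0' NM w1.
have E : \sum_(q < M) (G (root_unity M ^+ q) - G w) * (g q)%:C =
    \sum_(q < M) G (root_unity M ^+ q) * (g q)%:C - G w * (\sum_(q < M) g q)%:C.
  rewrite rmorph_sum mulr_sumr -sumrB; apply: eq_bigr => q _; exact: mulrBl.
have -> : fejer G N M w - G w = N%:R^-1 * (M%:R^-1 * \sum_(q < M)
   (G (root_unity M ^+ q) - G w) * (g q)%:C).
  transitivity (fejer G N M w - G w * (1 : R)%:C); first by rewrite mulr1.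
  rewrite -mass fejerE E !rmorphM !fmorphV !rmorph_nat.
  ring.
rewrite !normcM !normcV -!(rmorph_nat (real_complex R)) !normcR !normr_nat.
apply: (@le_trans _ _ (N%:R^-1 * (M%:R^-1 * \sum_(q < M) (e / 2 * g q + K)))).
  rewrite !ler_pM2l ?invr_gt0 //.
  apply: le_trans (normc_sum _ _ _) _; apply: ler_sum => q _.
  have g0 : 0 <= g q by rewrite sqr_ge0.
  rewrite normcM normcR (ger0_norm g0).
  have [le_d|gt_d] := leP (normc (root_unity M ^+ q - w)) d.
    apply: ler_wpDr => //; apply: ler_wpM2r => //.
    by apply: hd; rewrite ?normc_root.
  apply: ler_wpDl; first by rewrite mulr_ge0 // ltW.
  apply: ler_pM; rewrite ?normc_ge0 //.
    apply: le_trans (le_normcB _ _) _.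
    by rewrite mulr_natl mulr2n lerD ?GB ?normc_root.
  by apply: normc_geom; rewrite ?normc_root // ltW.
rewrite big_split /= -mulr_sumr sumr_const card_ord -(mulr_natr K).
have -> : N%:R^-1 * (M%:R^-1 * (e / 2 * (\sum_(i < M) g i) + K * M%:R)) =
  e / 2 * (N%:R^-1 * (M%:R^-1 * \sum_(i < M) g i)) + K / N%:R.
  by field; rewrite !gt_eqF.
by rewrite mass mulr1 [leRHS]splitr lerD2l.
Qed.

End Fejer.

(** * Density of resolvent powers *)

Section CayleyFunction.
Variable R : realType.
Variable z : R[i].
Hypothesis zr : z \isn't Num.real.
Implicit Types (f : R -> R[i]) (v w : R[i]) (s t : R).

Definition cayf t : R[i] := (t%:C - conjc z) / (t%:C - z).

Lemma cayfE t : cayf t = 1 + (z - conjc z) * (t%:C - z)^-1.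
Proof. by rewrite /cayf; field; exact: subr_nonreal. Qed.

Lemma subr_conj_neq0 : z - conjc z != 0.
Proof.
move: zr; rewrite nonrealE; case: z => x y /= y0; rewrite eq_complex /=.
by rewrite negb_and subrr eqxx /= opprK -mulr2n mulrn_eq0.
Qed.

Lemma normc_cayf t : normc (cayf t) = 1.
Proof.
rewrite /cayf normcM normcV -(normc_conj (_ - conjc z)) conjcB conjcK.
rewrite (conjc_real t) mulfV // normc_eq0; exact: subr_nonreal.
Qed.

Lemma cayf_neq1 t : cayf t != 1.
Proof.
rewrite cayfE -subr_eq0 addrC addKr mulf_neq0 ?subr_conj_neq0 //.
by rewrite invr_neq0 // subr_nonreal.
Qed.

(** Solves [cayf t = v] for [t]. On the circle the expression is already real ([invcayE]); the real
    part only fixes the type. *)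
Definition invcay v : R := complex.Re (z + (z - conjc z) / (v - 1)).

Lemma invcayE v : normc v = 1 -> v != 1 ->
  (invcay v)%:C = z + (z - conjc z) / (v - 1).
Proof.
move=> v1 v11; apply: RRe_real; rewrite CrealE; apply/eqP.
have v0 : v != 0 by rewrite -normc_eq0 v1 oner_eq0.
have v10 : v - 1 != 0 by rewrite subr_eq0.
change (conjc (z + (z - conjc z) / (v - 1)) = z + (z - conjc z) / (v - 1)).
rewrite conjcD conjcM conjc_inv !conjcB conjcK conjc1 (circle_conjV v1).
have h : v^-1 - 1 != 0.
  by rewrite subr_eq0 -(invr1 R[i]) (inj_eq invr_inj).
have -> : v^-1 - 1 = - (v - 1) / v by field.
by field; apply/andP; split.
Qed.

Lemma invcayK v : normc v = 1 -> v != 1 -> cayf (invcay v) = v.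
Proof.
move=> v1 v11; rewrite cayfE invcayE // addrAC subrr add0r invfM invrK.
by rewrite mulrA mulfV ?subr_conj_neq0 // mul1r addrC subrK.
Qed.

Lemma cayfK t : invcay (cayf t) = t.
Proof.
apply: (@complexI R); rewrite invcayE ?normc_cayf ?cayf_neq1 // cayfE.
rewrite addrAC subrr add0r invfM invrK mulrA mulfV ?subr_conj_neq0 // mul1r.
by rewrite addrC subrK.
Qed.

(** The point 1 of the circle plays infinity, where a vanishing function has value 0. *)
Definition circ f v : R[i] := if v == 1 then 0 else f (invcay v).

Lemma circ_cayf f t : circ f (cayf t) = f t.
Proof. by rewrite /circ (negbTE (cayf_neq1 t)) cayfK. Qed.

Lemma circ1 f : circ f 1 = 0.
Proof. by rewrite /circ eqxx. Qed.

Lemma circ_case (P : R[i] -> Prop) : P 1 -> (forall t, P (cayf t)) ->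
  forall v, normc v = 1 -> P v.
Proof.
move=> P1 Pt v v1; have [->//|v11] := eqVneq v 1.
by rewrite -(invcayK v1 v11).
Qed.

Lemma normc_cayfB s t : normc (cayf s - cayf t) * normc (s%:C - z) *
  normc (t%:C - z) = normc (z - conjc z) * `|s - t|.
Proof.
rewrite -!normcM distrC -normcR rmorphB -normcM; congr normc.
by rewrite !cayfE; field; rewrite !subr_nonreal.
Qed.

Lemma normc_cayf1 t : normc (cayf t - 1) * normc (t%:C - z) = normc (z - conjc z).
Proof.
rewrite -normcM cayfE addrAC subrr add0r -mulrA mulVf ?mulr1 //.
exact: subr_nonreal.
Qed.

(** Points close to 1 correspond to large arguments, where [f] is at most [e / 2]. For the others,
    [normc_cayfB] converts the chord into the distance on the line, with constants depending on [L]
    alone. *)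
Lemma circ_uniform f : vanishing_eps f -> forall e : R, 0 < e ->
  exists d : R, 0 < d /\ forall v w, normc v = 1 -> normc w = 1 ->
    normc (v - w) <= d -> normc (circ f v - circ f w) <= e.
Proof.
move=> vf e e0; have e2 : 0 < e / 2 by rewrite divr_gt0.
have [_ fl] := vf; have [L0 hL0] := fl _ e2.
pose L := `|L0|.
have hL t : L <= `|t| -> normc (f t) <= e / 2.
  by move=> ht; apply: hL0; apply: le_trans ht; exact: ler_norm.
have L00 : 0 <= L by exact: normr_ge0.
have [d1 [d10 hd1]] := vanishing_uniform vf L e0.
pose y2 := normc (z - conjc z).
have y20 : 0 < y2 by rewrite lt_def normc_ge0 normc_eq0 subr_conj_neq0.
pose C := L + normc z + 1.
have C0 : 0 < C by rewrite ltr_wpDl // addr_ge0 // normc_ge0.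
have hC t : `|t| < L -> normc (t%:C - z) < C.
  move=> tL; apply: le_lt_trans (le_normcB _ _) _; rewrite normcR /C.
  by move: tL; set a := normc z; set b := `|t|; lra.
(* With [a] the distance on the line, [y2 * a <= d * (a + C) * C]. The first entry bounds
   [a * (d * C)] by half of the left side, the second bounds [d * C ^+ 2] by [d1 * y2 / 2]; hence
   [a <= d1]. *)
pose d := Num.min (y2 / (2 * C)) (d1 * y2 / (2 * C ^+ 2)).
have d0 : 0 < d by rewrite lt_min !divr_gt0 ?mulr_gt0 ?exprn_gt0.
have dy : d * C < y2.
  apply: (@le_lt_trans _ _ (y2 / (2 * C) * C)); first by rewrite ler_pM2r // ge_min lexx.
  by rewrite (_ : y2 / (2 * C) * C = y2 / 2); [lra|field; rewrite gt_eqF].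
have inf t : normc (cayf t - 1) <= d -> normc (f t) <= e / 2.
  move=> h; apply: hL; rewrite leNgt; apply/negP => /hC tC.
  have := normc_cayf1 t; apply/eqP; rewrite lt_eqF //.
  apply: le_lt_trans dy; apply: ler_pM; rewrite ?normc_ge0 //; exact: ltW.
have fin s t : normc (cayf s - cayf t) <= d -> normc (f s - f t) <= e.
  wlog: s t / `|t| < L => [wl|tL h].
    move=> h; have [tL|tL] := ltP `|t| L; first exact: wl.
    have [sL|sL] := ltP `|s| L; first by rewrite normcB; apply: wl; rewrite // normcB.
    by apply: le_trans (le_normcB _ _) _; rewrite [e]splitr lerD ?hL.
  apply: (hd1 _ _ (ltW tL)).
  have tC := hC _ tL.
  set a := `|s - t|.
  have sC : normc (s%:C - z) <= a + C.
    apply: le_trans (ler_normcB _ (t%:C - z)) _.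
    have -> : s%:C - z - (t%:C - z) = (s - t)%:C by rewrite rmorphB; ring.
    by rewrite normcR addrC lerD2l ltW.
  have E := normc_cayfB s t; rewrite -/a -/y2 in E.
  have a0 : 0 <= a by exact: normr_ge0.
  have : y2 * a <= d * (a + C) * C.
    by rewrite -E; repeat (apply: ler_pM; rewrite ?mulr_ge0 ?normc_ge0 ?(ltW tC) //).
  have dC : d * C <= y2 / 2.
    apply: (@le_trans _ _ (y2 / (2 * C) * C)); first by rewrite ler_pM2r // ge_min lexx.
    by rewrite (_ : y2 / (2 * C) * C = y2 / 2) //; field; rewrite gt_eqF.
  have dC2 : d * C ^+ 2 <= d1 * y2 / 2.
    apply: (@le_trans _ _ (d1 * y2 / (2 * C ^+ 2) * C ^+ 2)).
      by rewrite ler_pM2r ?exprn_gt0 // ge_min lexx orbT.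
    rewrite (_ : d1 * y2 / (2 * C ^+ 2) * C ^+ 2 = d1 * y2 / 2) //.
    by field; rewrite gt_eqF.
  have : d * (a + C) * C = a * (d * C) + d * C ^+ 2 by ring.
  move=> -> h2.
  have h3 : a * (d * C) <= a * (y2 / 2) by rewrite ler_wpM2l.
  by rewrite -(ler_pM2l y20) -/a; lra.
exists d; split=> // v w v1 w1.
move: v v1; apply: (circ_case) => [|t]; move: w w1; apply: circ_case => [|s].
- by move=> _; rewrite !circ1 subrr normc0 ltW.
- rewrite circ1 circ_cayf sub0r normcN normcB => /inf h; apply: le_trans h _; lra.
- rewrite circ1 circ_cayf subr0 => /inf h; apply: le_trans h _; lra.
- by rewrite !circ_cayf; exact: fin.
Qed.

Lemma circ_bounded f : vanishing_eps f -> exists B : R, forall v, normc v = 1 ->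
  normc (circ f v) <= B.
Proof.
move=> /vanishing_bounded [B hB]; exists B; apply: circ_case.
  by rewrite circ1 normc0; apply: le_trans (hB 0); exact: normc_ge0.
by move=> t; rewrite circ_cayf.
Qed.

Lemma fejer_circ f : vanishing_eps f -> forall e : R, 0 < e -> exists N0 : nat,
  forall N M w, (N0 < N)%N -> (N <= M)%N -> normc w = 1 ->
    normc (fejer (circ f) N M w - circ f w) <= e.
Proof.
move=> vf; have [B hB] := circ_bounded vf.
by apply: (fejer_cvg hB); exact: circ_uniform.
Qed.

End CayleyFunction.

(** * Linear classes of functions closed under uniform limits *)

Section Density.
Variable R : realType.
Variable P : (R -> R[i]) -> Prop.
Implicit Types (f g : R -> R[i]) (z : R[i]) (s t : R).
Hypothesis Plin : forall a f g, P f -> P g -> P (fun t => a * f t + g t).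
Hypothesis Plim : forall f, vanishing_eps f -> (forall e : R, 0 < e ->
  exists2 g, P g & forall t, normc (f t - g t) <= e) -> P f.

Local Notation r z t := (t%:C - z)^-1.

Let Pext f g : P f -> (forall t, f t = g t) -> P g.
Proof. by move=> Pf /funext <-. Qed.

(* The remainder [E_j = a^j - b^j - j h b^(j+1)] satisfies
   [E_(j+1) = a E_j + (j+1) h^2 a b^(j+2)]. *)
Lemma resolvent_pow_diff (a b h : R[i]) (rho : R) j :
  a - b = h * a * b -> normc a <= rho -> normc b <= rho ->
  normc (a ^+ j - b ^+ j - j%:R * h * b ^+ j.+1) <=
    (j ^ 2)%N%:R * (normc h ^+ 2 * rho ^+ j.+2).
Proof.
move=> ab ha hb; have rho0 : 0 <= rho by apply: le_trans ha; exact: normc_ge0.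
elim: j => [|j IH].
  by rewrite !expr0 subrr sub0r mul0r mul0r oppr0 normc0 mul0r.
have -> : a ^+ j.+1 - b ^+ j.+1 - j.+1%:R * h * b ^+ j.+2 =
  a * (a ^+ j - b ^+ j - j%:R * h * b ^+ j.+1) + j.+1%:R * h ^+ 2 * (a * b ^+ j.+2).
  have -> : a ^+ j.+1 - b ^+ j.+1 - j.+1%:R * h * b ^+ j.+2 =
    a * (a ^+ j - b ^+ j - j%:R * h * b ^+ j.+1) + (a - b) * b ^+ j +
      j%:R * h * (a - b) * b ^+ j.+1 - h * b ^+ j.+2.
    by rewrite -natr1 !exprS; ring.
  rewrite ab.
  have -> : h * b ^+ j.+2 = h * b ^+ j.+1 * (a - (a - b)) by rewrite exprS; ring.
  rewrite ab -natr1 !exprS; ring.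
apply: le_trans (le_normcD _ _) _.
apply: (@le_trans _ _ (rho * ((j ^ 2)%N%:R * (normc h ^+ 2 * rho ^+ j.+2)) +
   j.+1%:R * normc h ^+ 2 * (rho * rho ^+ j.+2))).
  apply: lerD; first by rewrite normcM; apply: ler_pM; rewrite ?normc_ge0.
  rewrite normcM (normcM j.+1%:R) (normcM a) !normcX normc_nat.
  apply: ler_wpM2l; first by rewrite mulr_ge0 ?ler0n ?exprn_ge0 ?normc_ge0.
  by apply: ler_pM; rewrite ?exprn_ge0 ?normc_ge0 // lerXn2r // ?nnegrE ?normc_ge0.
rewrite -exprS.
have -> : rho * ((j ^ 2)%N%:R * (normc h ^+ 2 * rho ^+ j.+2)) +
   j.+1%:R * normc h ^+ 2 * rho ^+ j.+3 =
   (j ^ 2 + j.+1)%N%:R * (normc h ^+ 2 * rho ^+ j.+3).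
  by rewrite natrD !exprS; ring.
apply: ler_wpM2r; first by rewrite mulr_ge0 ?exprn_ge0 ?normc_ge0.
by rewrite ler_nat -!mulnn mulSn addnC leq_add2l leq_mul2l leqnSn orbT.
Qed.

Lemma resf_diff z (h : R[i]) t : z \isn't Num.real -> z + h \isn't Num.real ->
  r (z + h) t - r z t = h * r (z + h) t * r z t.
Proof. by move=> zr zr'; field; rewrite !subr_nonreal. Qed.

Lemma inv_nat_eps (C e : R) : 0 <= C -> 0 < e ->
  exists n : nat, (0 < n)%N /\ forall k, (n <= k)%N -> C / k%:R <= e.
Proof.
move=> C0 e0; exists (Num.bound (C / e)).+1; split=> // k hk.
have k0 : (0 < k)%N by apply: leq_trans hk.
rewrite ler_pdivrMr ?ltr0n // mulrC -ler_pdivrMr //.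
apply: (@le_trans _ _ (Num.bound (C / e))%:R); last by rewrite ler_nat ltnW.
by apply: ltW; apply: archi_boundP; rewrite divr_ge0 // ltW.
Qed.

(** The difference quotient in z of the lower power, with real step [h], tends uniformly in t to
    [j.+1] times the next power; a real step leaves the distance to the axis unchanged. *)
Lemma P_resf_up z j : (forall z, z \isn't Num.real -> P (fun t => r z t ^+ j.+1)) ->
  z \isn't Num.real -> P (fun t => r z t ^+ j.+2).
Proof.
move=> Pj zr; apply: Plim; first exact: vanishing_resf_exp.
move=> e e0; set y := `|complex.Im z|.
have y0 : 0 < y by rewrite normr_gt0 -nonrealE.
have C0 : 0 <= (j.+1 ^ 2)%N%:R * y^-1 ^+ j.+3.
  by rewrite mulr_ge0 ?ler0n // exprn_ge0 // invr_ge0 ltW.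
have [n [n0 hn]] := inv_nat_eps C0 e0.
pose h : R := n%:R^-1.
have h0 : 0 < h by rewrite invr_gt0 ltr0n.
have zhr : z + h%:C \isn't Num.real.
  by move: zr; rewrite !nonrealE; case: (z) => p q /=; rewrite addr0.
set c := (j.+1%:R * h%:C)^-1.
pose F t := -1 * r z t ^+ j.+1 + r (z + h%:C) t ^+ j.+1.
have PF : P F by apply: Plin; exact: Pj.
(* This is [c * F t], written in the only shape that [Plin] provides. *)
exists (fun t => (c - 1) * F t + F t); first exact: Plin.
move=> t; rewrite /F; set a := r (z + _) t; set b := r z t.
have nz : j.+1%:R * h%:C != 0.
  by rewrite mulf_neq0 ?pnatr_eq0 // (fmorph_eq0 (real_complex R)) gt_eqF.
have h0C : h%:C != 0 by rewrite (fmorph_eq0 (real_complex R)) gt_eqF.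
have -> : b ^+ j.+2 - ((c - 1) * (-1 * b ^+ j.+1 + a ^+ j.+1) +
   (-1 * b ^+ j.+1 + a ^+ j.+1)) =
   - c * (a ^+ j.+1 - b ^+ j.+1 - j.+1%:R * h%:C * b ^+ j.+2).
  have cE : c * (j.+1%:R * h%:C) = 1 by rewrite mulVf.
  transitivity (- c * (a ^+ j.+1 - b ^+ j.+1) + (c * (j.+1%:R * h%:C)) * b ^+ j.+2).
    by rewrite cE; ring.
  ring.
have := @resolvent_pow_diff a b h%:C y^-1 j.+1 (resf_diff t zr zhr).
have hy : `|complex.Im (z + h%:C)| = y.
  by rewrite /y; case: (z) => p q /=; rewrite addr0.
have := normc_resf t zhr; rewrite hy => /[swap] /[apply].
have /[swap] /[apply] := normc_resf t zr => H.
rewrite normcM normcN normcV (normcM j.+1%:R) normc_nat normcR (ger0_norm (ltW h0)).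
rewrite normcR (ger0_norm (ltW h0)) in H.
apply: le_trans (ler_wpM2l _ H) _; first by rewrite invr_ge0 mulr_ge0 // ltW.
apply: le_trans (hn n (leqnn n)).
have -> : (j.+1%:R * h)^-1 * ((j.+1 ^ 2)%N%:R * (h ^+ 2 * y^-1 ^+ j.+3)) =
   j.+1%:R^-1 * ((j.+1 ^ 2)%N%:R * y^-1 ^+ j.+3 * h).
  field; rewrite nat1r pnatr_eq0 /=.
  exact: lt0r_neq0 h0.
apply: ler_piMl.
  apply: mulr_ge0; last exact: ltW.
  by apply: mulr_ge0; rewrite ?ler0n // exprn_ge0 // invr_ge0 ltW.
by rewrite invf_le1 ?ler1n ?ltr0n.
Qed.

Lemma P_sum (n : nat) (c : nat -> R[i]) (F : nat -> R -> R[i]) f0 :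
  P f0 -> (forall k, P (F k)) -> P (fun t => \sum_(k < n) c k * F k t).
Proof.
move=> P0 PF; elim: n => [|n IH].
  by apply: (Pext (Plin (-1) P0 P0)) => t; rewrite big_ord0 mulN1r addNr.
by apply: (Pext (Plin (c n) (PF n) IH)) => t; rewrite big_ord_recr /= addrC.
Qed.

(** Riemann sum of 1/x^2: apart from the first term, each summand is dominated by a telescoping
    difference of 1/x. *)
Lemma sum_inv_sq (y s : R) Q : 0 < y -> 0 < s ->
  s * \sum_(q < Q.+1) (y + s * q%:R)^-1 ^+ 2 <= s * y^-1 ^+ 2 + y^-1 - (y + s * Q%:R)^-1.
Proof.
move=> y0 s0; elim: Q => [|Q IH].
  by rewrite big_ord_recr big_ord0 /= mulr0 addr0 add0r addrK.
rewrite big_ord_recr /= mulrDr.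
have p k : 0 < y + s * k%:R by rewrite ltr_wpDr // mulr_ge0 // ltW.
apply: le_trans (lerD IH (lexx _)) _.
suff : s * (y + s * Q.+1%:R)^-1 ^+ 2 <= (y + s * Q%:R)^-1 - (y + s * Q.+1%:R)^-1 by lra.
have -> : (y + s * Q%:R)^-1 - (y + s * Q.+1%:R)^-1 =
    s * ((y + s * Q%:R)^-1 * (y + s * Q.+1%:R)^-1).
  have p1 := p Q; have p2 := p Q.+1; rewrite -natr1 in p2 *.
  by field; rewrite !gt_eqF.
rewrite ler_pM2l // expr2 ler_pM2r ?invr_gt0 // lef_pV2 ?posrE //.
by rewrite lerD2l ler_pM2l // ler_nat.
Qed.

(* Moving [z] away from the real axis by steps [s] and telescoping replaces
   [r_z^j] by a Riemann sum of [- j r^(j+1)]. *)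
Lemma P_resf_down z j : (forall z, z \isn't Num.real -> P (fun t => r z t ^+ j.+2)) ->
  z \isn't Num.real -> P (fun t => r z t ^+ j.+1).
Proof.
move=> Pj zr; apply: Plim; first exact: vanishing_resf_exp.
move=> e e0; set y := `|complex.Im z|.
have y0 : 0 < y by rewrite normr_gt0 -nonrealE.
pose K : R := (j.+1 ^ 2)%N%:R * y^-1 ^+ j.+1 * (y^-1 ^+ 2 + y^-1).
have K0 : 0 <= K.
  by rewrite !mulr_ge0 ?addr_ge0 ?exprn_ge0 ?invr_ge0 ?(ltW y0).
have e2 : 0 < e / 2 by rewrite divr_gt0.
have [n1 [n10 hn1]] := inv_nat_eps K0 e2.
have C1 : 0 <= y^-1 ^+ j by rewrite exprn_ge0 // invr_ge0 ltW.
have [n2 [n20 hn2]] := inv_nat_eps C1 e2.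
pose n := maxn n1 n2.
have n0 : (0 < n)%N by rewrite leq_max n10.
pose s : R := n%:R^-1.
have s0 : 0 < s by rewrite invr_gt0 ltr0n.
(* The sign directs the step away from the real axis, on whichever side [z] lies. *)
pose h : R[i] := 0 +i* (Num.sg (complex.Im z) * s).
pose zq (q : nat) := z + q%:R * h.
have imq q : `|complex.Im (zq q)| = y + s * q%:R.
  rewrite /zq /h -(rmorph_nat (real_complex R)) /y; case: (z) zr => p x.
  rewrite nonrealE /= => x0; rewrite !mul0r addr0.
  rewrite {1}[x]numEsg mulrCA -mulrDr normrM normr_sg x0 mul1r.
  by rewrite mulrC ger0_norm // addr_ge0 // mulr_ge0 // ltW.
have pos q : 0 < y + s * q%:R by rewrite ltr_wpDr // mulr_ge0 // ltW.
have zqr q : zq q \isn't Num.real by rewrite nonrealE -normr_gt0 imq.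
have zqS q : zq q.+1 = zq q + h by rewrite /zq -natr1 mulrDl mul1r addrA.
have nh : normc h = s.
  rewrite /normc /h expr0n add0r sqrtr_sqr normrM normr_sg -nonrealE zr mul1r.
  by rewrite ger0_norm // ltW.
(* [n * n] steps of length [n%:R^-1] climb by [n]: the mesh tends to 0 while the endpoint escapes to
   infinity, so that [normc (u Q) <= s]. *)
pose Q := (n * n)%N.
have Qpos : (0 < Q)%N by rewrite muln_gt0 n0.
exists (fun t => \sum_(q < Q) (- (j.+1%:R * h)) * r (zq q) t ^+ j.+2).
  by apply: (P_sum Q (fun=> _) (F := fun q t => r (zq q) t ^+ j.+2) (Pj _ zr)) => q; exact: Pj.
move=> t; set u := fun q => r (zq q) t.
have rho q : normc (u q) <= (y + s * q%:R)^-1 by rewrite -imq; exact: normc_resf.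
have -> : r z t ^+ j.+1 - \sum_(q < Q) - (j.+1%:R * h) * r (zq q) t ^+ j.+2 =
  u Q ^+ j.+1 - \sum_(q < Q) (u q.+1 ^+ j.+1 - u q ^+ j.+1 - j.+1%:R * h * u q ^+ j.+2).
  rewrite sumrB -(big_mkord xpredT (fun q => u q.+1 ^+ j.+1 - u q ^+ j.+1)) telescope_sumr //.
  have -> : u 0%N = r z t by rewrite /u /zq mul0r addr0.
  have -> : \sum_(i < Q) - (j.+1%:R * h) * r (zq i) t ^+ j.+2 =
            - \sum_(i < Q) j.+1%:R * h * u i ^+ j.+2.
    by rewrite -sumrN; apply: eq_bigr => i _; rewrite mulNr.
  ring.
apply: le_trans (le_normcB _ _) _; rewrite addrC [e]splitr lerD //.
  apply: le_trans (normc_sum _ _ _) _.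
  apply: (@le_trans _ _ (\sum_(q < Q) (j.+1 ^ 2)%N%:R * (s ^+ 2 * (y + s * q%:R)^-1 ^+ j.+3))).
    apply: ler_sum => q _; rewrite -nh.
    apply: resolvent_pow_diff.
    - by rewrite /u zqS; apply: resf_diff => //; rewrite -zqS.
    - apply: le_trans (rho _) _; rewrite nh lef_pV2 ?posrE // lerD2l ler_pM2l //.
      by rewrite ler_nat.
    - by rewrite nh.
  apply: (@le_trans _ _ ((j.+1 ^ 2)%N%:R * y^-1 ^+ j.+1 * s *
      (s * \sum_(q < Q) (y + s * q%:R)^-1 ^+ 2))).
    rewrite mulr_sumr mulr_sumr; apply: ler_sum => q _.
    have -> : (j.+1 ^ 2)%N%:R * (s ^+ 2 * (y + s * q%:R)^-1 ^+ j.+3) =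
      (j.+1 ^ 2)%N%:R * (y + s * q%:R)^-1 ^+ j.+1 * s * (s * (y + s * q%:R)^-1 ^+ 2).
      by rewrite !exprS expr0; ring.
    apply: ler_wpM2r; first by rewrite mulr_ge0 ?sqr_ge0 // ltW.
    apply: ler_wpM2r; first exact: ltW.
    apply: ler_wpM2l; first by rewrite ler0n.
    rewrite lerXn2r ?nnegrE ?invr_ge0 ?(ltW y0) ?(ltW (pos q)) //.
    by rewrite lef_pV2 ?posrE // lerDl mulr_ge0 // ltW.
  have := sum_inv_sq Q.-1 y0 s0; rewrite prednK // => hs.
  have s1 : s <= 1 by rewrite invf_le1 ?ler1n ?ltr0n.
  have hs' : s * \sum_(q < Q) (y + s * q%:R)^-1 ^+ 2 <= y^-1 ^+ 2 + y^-1.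
    apply: le_trans hs _; rewrite -addrA lerD //.
      by rewrite ger_pMl ?exprn_gt0 ?invr_gt0.
    by rewrite lerBlDr lerDl invr_ge0 ltW.
  apply: le_trans (ler_wpM2l _ hs') _.
    by rewrite !mulr_ge0 ?exprn_ge0 ?invr_ge0 ?(ltW y0) ?(ltW s0).
  apply: le_trans (hn1 n (leq_maxl _ _)); rewrite /K -/s.
  by rewrite le_eqVlt; apply/orP; left; apply/eqP; ring.
rewrite normcX exprS.
apply: le_trans (hn2 n (leq_maxr _ _)); rewrite mulrC -/s.
have uy : normc (u Q) <= y^-1.
  by apply: le_trans (rho Q) _; rewrite lef_pV2 ?posrE // lerDl mulr_ge0 // ltW.
apply: ler_pM; rewrite ?normc_ge0 ?exprn_ge0 ?normc_ge0 //.
  by rewrite lerXn2r // nnegrE ?normc_ge0 // invr_ge0 ltW.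
apply: le_trans (rho Q) _; rewrite lef_pV2 ?posrE ?ltr0n //.
rewrite /Q natrM mulrA /s mulVf ?pnatr_eq0 -?lt0n // mul1r.
by rewrite lerDr ltW.
Qed.

Lemma P_all_powers m : (0 < m)%N ->
  (forall z, z \isn't Num.real -> P (fun t => r z t ^+ m)) ->
  forall j z, z \isn't Num.real -> P (fun t => r z t ^+ j.+1).
Proof.
case: m => // m _ Pm; elim=> [|j IH] z zr; last exact: P_resf_up.
by elim: m Pm z zr => [//|m IH] Pm; apply: IH => z; exact: P_resf_down.
Qed.

(** A monomial in [cayf z] and its conjugate is a power of [cayf] at [z] or at [conjc z]; minus 1 it
    becomes a polynomial in one resolvent function without constant term, hence satisfies [P]. Fejer
    means then reach every vanishing function. The point ['i] is an arbitrary base point. *)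
Lemma vanishing_density m : (0 < m)%N ->
  (forall z, z \isn't Num.real -> P (fun t => r z t ^+ m)) ->
  forall f, vanishing_eps f -> P f.
Proof.
move=> m0 Pm f vf; have Pj := P_all_powers m0 Pm.
pose z : R[i] := 'i%C.
have zr : z \isn't Num.real by rewrite nonrealE /= oner_eq0.
have Pur w k : w \isn't Num.real -> forall i, P (fun t => cayf w t ^+ k * r w t ^+ i.+1).
  move=> wr; elim: k => [|k IH] i.
    by apply: (Pext (Pj i w wr)) => t; rewrite mul1r.
  apply: (Pext (Plin (w - conjc w) (IH i.+1) (IH i))) => t.
  by rewrite (exprS _ k) [r w t ^+ i.+2]exprS [X in _ = X * _ * _]cayfE //; ring.
have Pu1 w k : w \isn't Num.real -> P (fun t => cayf w t ^+ k - 1).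
  move=> wr; elim: k => [|k IH].
    apply: (Pext (Plin (-1) (Pj 0%N _ wr) (Pj 0%N _ wr))) => t.
    by rewrite expr0 subrr mulN1r addNr.
  apply: (Pext (Plin (w - conjc w) (Pur w k wr 0%N) IH)) => t.
  by rewrite (exprS _ k) [X in _ = X * _ - 1]cayfE // expr1; ring.
have conj_cayf t : conjc (cayf z t) = cayf (conjc z) t.
  by rewrite /cayf conjcK conjcM conjc_inv !conjcB (conjc_real t) conjcK.
have Puu j l : P (fun t => cayf z t ^+ j * conjc (cayf z t) ^+ l - 1).
  have cj t : cayf z t * conjc (cayf z t) = 1 by rewrite mulrJ_circle // normc_cayf.
  case: (leqP l j) => [lj|/ltnW jl].
    apply: (Pext (Pu1 z (j - l)%N zr)) => t.
    by rewrite -{2}(subnK lj) exprD -mulrA -exprMn cj expr1n mulr1.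
  apply: (Pext (Pu1 (conjc z) (l - j)%N (nonreal_conj zr))) => t.
  by rewrite -{2}(subnKC jl) exprD mulrA -exprMn cj expr1n mul1r conj_cayf.
apply: Plim => // e e0; have e2 : 0 < e / 2 by rewrite divr_gt0.
have [N0 hN] := fejer_circ zr vf e2.
pose N := N0.+1; pose c j l := N%:R^-1 * fcoef (circ z f) N j l.
(* Removing 1 from each monomial subtracts the Fejer mean at the point 1, which is at most [e / 2]
   since the transported function is 0 there. *)
exists (fun t => \sum_(j < N) 1 * \sum_(l < N) c j l * (cayf z t ^+ j * conjc (cayf z t) ^+ l - 1)).
  apply: (P_sum N (fun=> 1) (F := fun j t => \sum_(l < N) c j l *
     (cayf z t ^+ j * conjc (cayf z t) ^+ l - 1)) (Pj 0%N _ zr)) => j.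
  apply: (P_sum N (c j) (F := fun l t => (cayf z t ^+ j * conjc (cayf z t) ^+ l - 1))
    (Pj 0%N _ zr)) => l.
  exact: Puu.
move=> t.
have -> : \sum_(j < N) 1 * \sum_(l < N) c j l * (cayf z t ^+ j * conjc (cayf z t) ^+ l - 1)
   = fejer (circ z f) N N (cayf z t) - fejer (circ z f) N N 1.
  rewrite /fejer -mulrBr -sumrB mulr_sumr; apply: eq_bigr => j _.
  rewrite mul1r -sumrB mulr_sumr; apply: eq_bigr => l _.
  by rewrite /c rmorph1 !expr1n; ring.
have h1 := hN N N 1 (ltnSn _) (leqnn _) (normc1 _).
have h2 := hN N N (cayf z t) (ltnSn _) (leqnn _) (normc_cayf zr t).
rewrite circ1 subr0 in h1; rewrite circ_cayf // in h2.
have -> : f t - (fejer (circ z f) N N (cayf z t) - fejer (circ z f) N N 1) =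
  fejer (circ z f) N N 1 - (fejer (circ z f) N N (cayf z t) - f t) by ring.
by apply: le_trans (le_normcB _ _) _; rewrite [e]splitr lerD.
Qed.

End Density.

(** * Existence of the functional calculus *)

Section OperatorBounds.
Variables (R : realType) (H : completeNormedModType R[i]).
Implicit Types (T S : H -> H) (c : R).

Definition opbound T c : Prop := forall x, hnorm (T x) <= c * hnorm x.

Lemma operator_norm_le T c : 0 <= c -> opbound T c -> (operator_norm T <= c%:E)%E.
Proof.
move=> c0 hT; apply: ge_ereal_sup => _ [x /= x1 <-]; rewrite lee_fin.
apply: le_trans (hT x) _; apply: ler_piMr => //.
by move: x1; rewrite hnormE -(rmorph1 (real_complex R)) lecR.
Qed.

Lemma opbound_operator_norm T c : linear T -> 0 <= c ->
  (operator_norm T <= c%:E)%E -> opbound T c.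
Proof.
move=> lT c0 hT x; have [->|x0] := eqVneq x 0.
  by rewrite linear_op0 // hnorm0 mulr0.
have xp : 0 < hnorm x by rewrite lt_def hnorm_ge0 hnorm_eq0 x0.
pose y := ((hnorm x)^-1)%:C *: x.
have : ((hnorm (T y))%:E <= c%:E)%E.
  apply: le_trans hT; apply: ereal_sup_ubound; exists y => //=.
  rewrite hnormE /y hnormZ normcR ger0_norm ?invr_ge0 ?hnorm_ge0 //.
  by rewrite mulVf ?gt_eqF.
rewrite lee_fin /y linear_opZ // hnormZ normcR ger0_norm ?invr_ge0 ?hnorm_ge0 //.
by rewrite mulrC ler_pdivrMr.
Qed.

Lemma bounded_operatorP T : bounded_operator T <->
  linear T /\ exists c : R, 0 <= c /\ opbound T c.
Proof.
split=> [[lT hT]|[lT [c [c0 hc]]]].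
  split=> //; have T0 : (0 <= operator_norm T)%E.
    apply: ereal_sup_ubound; exists 0 => /=; first by rewrite normr0.
    by rewrite linear_op0 // normr0.
  have fn : operator_norm T \is a fin_num by rewrite ge0_fin_numE.
  exists (fine (operator_norm T)); split; first exact: fine_ge0.
  by apply: opbound_operator_norm => //; rewrite ?fine_ge0 // fineK.
split=> //; apply: le_lt_trans (operator_norm_le c0 hc) _; exact: ltry.
Qed.

End OperatorBounds.

(** * Operators as functions of the Cayley transform *)

Section Symbol.
Variables (R : realType) (H : completeNormedModType R[i]).
Variable dot : {dot H for Num.conj}.
Hypothesis dot_norm : forall x : H, `|x| ^+ 2 = dot x x.
Variable A : operator H.
Hypothesis saA : self_adjoint dot A.
Variable z : R[i].
Hypothesis zr : z \isn't Num.real.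
Implicit Types (x y : H) (v w : R[i]) (phi psi : R[i] -> R[i]) (S T : H -> H).

Let zr' : conjc z \isn't Num.real := nonreal_conj zr.
Local Notation U := (cayley A z).
Local Notation V := (cayley A (conjc z)).

Lemma cayleyUV x : U (V x) = x.
Proof. by rewrite (cayleyK dot_norm saA). Qed.

Lemma cayleyVU x : V (U x) = x.
Proof. by rewrite -{2}(cayleyK dot_norm saA x zr') conjcK. Qed.

Lemma cayleyU_lin : linear U.
Proof. exact: (cayley_linear dot_norm saA). Qed.

Lemma cayleyV_lin : linear V.
Proof. exact: (cayley_linear dot_norm saA). Qed.

Lemma hnorm_iterU j x : hnorm (iter j U x) = hnorm x.
Proof. by elim: j => //= j <-; rewrite (hnorm_cayley dot_norm saA). Qed.

Lemma iter_linear T j : linear T -> linear (iter j T).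
Proof. by move=> lT; elim: j => [|j IH] a x y //=; rewrite IH lT. Qed.

Definition wave N v x : H := \sum_(j < N) conjc v ^+ j *: iter j U x.

(** The sum telescopes, and its two boundary terms each have the norm of [x]. *)
Lemma cayley_wave N v x : normc v = 1 ->
  hnorm (U (wave N v x) - v *: wave N v x) <= 2 * hnorm x.
Proof.
move=> v1; pose g j := (v * conjc v ^+ j) *: iter j U x.
have -> : U (wave N v x) - v *: wave N v x = g N - g 0%N.
  rewrite /wave (linear_op_sum _ _ _ cayleyU_lin) scaler_sumr -sumrB.
  rewrite -(telescope_sumr g) // big_mkord; apply: eq_bigr => j _.
  rewrite (linear_opZ _ _ cayleyU_lin) /g scalerA exprS mulrA mulrJ_circle //.
  by rewrite mul1r.
apply: le_trans (hnormDB _ _) _.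
have hg j : hnorm (g j) = hnorm x.
  by rewrite /g hnormZ hnorm_iterU normcM normcX normc_conj v1 expr1n !mul1r.
by rewrite !hg mulr_natl mulr2n.
Qed.

(** Parseval over the [N]-th roots of unity: orthogonality keeps the [N] diagonal terms, each [N]
    times the squared norm, as [U] is isometric. *)
Lemma sum_wave N x : (0 < N)%N ->
  \sum_(q < N) hnorm (wave N (root_unity R N ^+ q) x) ^+ 2 = N%:R ^+ 2 * hnorm x ^+ 2.
Proof.
move=> N0; apply: (@complexI R); rewrite rmorph_sum /=.
transitivity (\sum_(q < N) \sum_(j < N) \sum_(l < N)
   (conjc (root_unity R N ^+ q) ^+ j * (root_unity R N ^+ q) ^+ l) *
   dot (iter j U x) (iter l U x)).
  apply: eq_bigr => q _; rewrite -(dotxx dot_norm) /wave dot_suml.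
  apply: eq_bigr => j _; rewrite dotZl dot_sumr mulr_sumr.
  by apply: eq_bigr => l _; rewrite dotZr (conjcX (conjc _)) conjcK mulrA.
rewrite exchange_big /=.
transitivity (\sum_(j < N) N%:R * (hnorm x ^+ 2)%:C : R[i]).
  apply: eq_bigr => j _; rewrite exchange_big /= (bigD1 j) //= [X in _ + X]big1 ?addr0.
    by rewrite -mulr_suml root_unity_orth // eqxx (dotxx dot_norm) hnorm_iterU.
  move=> l lj; rewrite -mulr_suml root_unity_orth // ifN ?mul0r //.
  by rewrite eq_sym.
rewrite sumr_const card_ord -mulr_natl !rmorphM !rmorph_nat; ring.
Qed.

(* [T] acts on the approximate eigenvectors [wave N v x] of [U] like
   multiplication by [phi v]; the error [C * hnorm x] is negligible because the
   waves have mean square norm [N * hnorm x ^+ 2]. *)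
Definition symbol phi T : Prop :=
  [/\ linear T, (forall x, T (U x) = U (T x)),
      (exists B : R, forall v, normc v = 1 -> normc (phi v) <= B)
    & forall e : R, 0 < e -> exists C : R, 0 <= C /\ forall N v x, normc v = 1 ->
        hnorm (T (wave N v x) - phi v *: wave N v x) <=
          e * hnorm (wave N v x) + C * hnorm x].

Lemma comm_wave T N v x : linear T -> (forall x, T (U x) = U (T x)) ->
  T (wave N v x) = wave N v (T x).
Proof.
move=> lT TU; rewrite /wave linear_op_sum //; apply: eq_bigr => j _.
rewrite linear_opZ //; congr (_ *: _).
by elim: (j : nat) => //= k <-; rewrite TU.
Qed.

Lemma sqrD_le (a b e : R) : 0 < e ->
  (a + b) ^+ 2 <= (1 + e) * a ^+ 2 + (1 + e^-1) * b ^+ 2.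
Proof.
move=> e0; rewrite -subr_ge0.
have -> : (1 + e) * a ^+ 2 + (1 + e^-1) * b ^+ 2 - (a + b) ^+ 2 =
   e^-1 * (e * a - b) ^+ 2 by field; rewrite gt_eqF.
by rewrite mulr_ge0 ?sqr_ge0 // invr_ge0 ltW.
Qed.

(** [T] commutes with [U], so it maps the waves of [x] to the waves of [T x], and Parseval applies
    to both vectors. The total error [K * N] is negligible against [N ^ 2]. *)
Lemma symbol_bound phi T (c : R) : symbol phi T ->
  (forall v, normc v = 1 -> normc (phi v) <= c) -> opbound T c.
Proof.
move=> [lT TU _ h] hc x.
have c0 : 0 <= c by apply: le_trans (normc_ge0 _) (hc 1 (normc1 _)).
apply: sqr_hnorm_le; first by rewrite mulr_ge0 // hnorm_ge0.
rewrite exprMn.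
have step (e : R) : 0 < e -> hnorm (T x) ^+ 2 <= (1 + e) * (c + e) ^+ 2 * hnorm x ^+ 2.
  move=> e0; have [C [C0 hC]] := h _ e0.
  apply/ler_addgt0Pl => d d0.
  pose K := (1 + e^-1) * (C * hnorm x) ^+ 2.
  have K0 : 0 <= K by rewrite mulr_ge0 ?sqr_ge0 // addr_ge0 // invr_ge0 ltW.
  have [N [N0 /(_ N (leqnn N)) hN]] := inv_nat_eps K0 d0.
  have Np : 0 < N%:R ^+ 2 :> R by rewrite exprn_gt0 // ltr0n.
  rewrite -(ler_pM2l Np) -sum_wave //.
  apply: (@le_trans _ _ (\sum_(q < N) ((1 + e) * (c + e) ^+ 2 *
     hnorm (wave N (root_unity R N ^+ q) x) ^+ 2 + K))).
    apply: ler_sum => q _; set v := root_unity R N ^+ q.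
    have v1 : normc v = 1 by exact: normc_root.
    rewrite -comm_wave //; set y := wave N v x.
    apply: (@le_trans _ _ (((c + e) * hnorm y + C * hnorm x) ^+ 2)).
      rewrite ler_sqr ?nnegrE ?hnorm_ge0 ?addr_ge0 ?mulr_ge0 ?hnorm_ge0 ?addr_ge0 ?(ltW e0) //.
      rewrite -[T y](subrK (phi v *: y)); apply: le_trans (hnormD _ _) _.
      have := hC N v x v1; rewrite -/y hnormZ.
      have : normc (phi v) * hnorm y <= c * hnorm y.
        by rewrite ler_wpM2r ?hnorm_ge0 ?hc.
      lra.
    apply: le_trans (sqrD_le _ _ e0) _.
    by rewrite exprMn mulrA.
  rewrite big_split /= -mulr_sumr sum_wave // sumr_const card_ord -(mulr_natr K).
  have : N%:R ^+ 2 * (K / N%:R) <= N%:R ^+ 2 * d by rewrite ler_pM2l.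
  have -> : N%:R ^+ 2 * (K / N%:R) = K * N%:R.
    by field; rewrite pnatr_eq0 -lt0n.
  have -> : (1 + e) * (c + e) ^+ 2 * (N%:R ^+ 2 * hnorm x ^+ 2) =
    N%:R ^+ 2 * ((1 + e) * (c + e) ^+ 2 * hnorm x ^+ 2) by ring.
  by rewrite mulrDr; lra.
apply/ler_addgt0Pl => d d0.
(* Chosen so that for [e <= 1] the excess of [(1 + e) * (c + e) ^+ 2] over [c ^+ 2], times
   [hnorm x ^+ 2], is at most [e * M]. *)
pose M := (2 * (2 * c + 1) + c ^+ 2) * hnorm x ^+ 2.
have M0 : 0 <= M.
  by rewrite mulr_ge0 ?sqr_ge0 // addr_ge0 ?sqr_ge0 // mulr_ge0 // addr_ge0 // mulr_ge0.
pose e := Num.min 1 (d / (M + 1)).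
have M1 : 0 < M + 1 by rewrite ltr_wpDl.
have e0 : 0 < e by rewrite lt_min ltr01 divr_gt0.
have e1 : e <= 1 by rewrite ge_min lexx.
apply: le_trans (step _ e0) _.
have : e * M <= d.
  apply: (@le_trans _ _ (d / (M + 1) * M)).
    by rewrite ler_wpM2r // ge_min lexx orbT.
  rewrite -mulrA ger_pMr // mulrC ler_pdivrMr // mul1r lerDl //.
suff : (1 + e) * (c + e) ^+ 2 * hnorm x ^+ 2 <= c ^+ 2 * hnorm x ^+ 2 + e * M by lra.
rewrite /M (mulrA e) -mulrDl; apply: ler_wpM2r; first exact: sqr_ge0.
rewrite -subr_ge0.
have -> : c ^+ 2 + e * (2 * (2 * c + 1) + c ^+ 2) - (1 + e) * (c + e) ^+ 2 =
  e * ((1 - e) * (2 * c + e + 2) ) by ring.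
by rewrite !mulr_ge0 ?subr_ge0 ?addr_ge0 ?mulr_ge0 ?(ltW e0).
Qed.

Lemma symbol_ext phi psi T : (forall v, normc v = 1 -> phi v = psi v) ->
  symbol phi T -> symbol psi T.
Proof.
move=> E [lT TU [B hB] h]; split=> //.
  by exists B => v v1; rewrite -E // hB.
move=> e /h [C [C0 hC]]; exists C; split=> // N v x v1.
by rewrite -E // hC.
Qed.

Lemma symbol_id : symbol (fun=> 1) id.
Proof.
split=> //; first by exists 1 => v _; rewrite normc1.
move=> e e0; exists 0; split=> // N v x _.
by rewrite scale1r subrr hnorm0 mul0r addr0 mulr_ge0 ?hnorm_ge0 // ltW.
Qed.

Lemma symbol_U : symbol id U.
Proof.
split=> //; [exact: cayleyU_lin | by exists 1 => v -> |].
move=> e e0; exists 2; split=> // N v x v1.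
by apply: ler_wpDl; [rewrite mulr_ge0 ?hnorm_ge0 // ltW | exact: cayley_wave].
Qed.

Lemma symbol_V : symbol (@conjc R) V.
Proof.
split=> //; [exact: cayleyV_lin | by move=> x; rewrite cayleyUV cayleyVU |
  by exists 1 => v v1; rewrite normc_conj v1 |].
move=> e e0; exists 2; split=> // N v x v1.
apply: ler_wpDl; first by rewrite mulr_ge0 ?hnorm_ge0 // ltW.
set y := wave N v x.
have -> : V y - conjc v *: y = - conjc v *: V (U y - v *: y).
  have lV := cayleyV_lin.
  rewrite (linear_opB _ _ lV) (linear_opZ _ _ lV) cayleyVU scalerBr scalerA mulNr.
  by rewrite (mulrC (conjc v)) mulrJ_circle // scaleN1r opprK scaleNr addrC.
rewrite hnormZ normcN normc_conj v1 mul1r (hnorm_cayley dot_norm saA) //.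
exact: cayley_wave.
Qed.

Lemma symbol_lin a phi psi S T : symbol phi S -> symbol psi T ->
  symbol (fun v => a * phi v + psi v) (fun x => a *: S x + T x).
Proof.
move=> [lS SU [B hB] hS] [lT TU [B' hB'] hT]; split.
- exact: (linear_op_lin dot_norm).
- by move=> x; rewrite SU TU (linear_opD _ _ cayleyU_lin) (linear_opZ _ _ cayleyU_lin).
- exists (normc a * B + B') => v v1; apply: le_trans (le_normcD _ _) _.
  by rewrite normcM lerD ?hB' // ler_wpM2l ?normc_ge0 // hB.
move=> e e0; have a1 : 0 < 1 + normc a by rewrite ltr_pwDl // normc_ge0.
have e1 : 0 < e / (1 + normc a) by rewrite divr_gt0.
have [C [C0 hC]] := hS _ e1; have [C' [C0' hC']] := hT _ e1.
exists (normc a * C + C'); split; first by rewrite addr_ge0 ?mulr_ge0 ?normc_ge0.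
move=> N v x v1; set y := wave N v x.
have -> : a *: S y + T y - (a * phi v + psi v) *: y =
   a *: (S y - phi v *: y) + (T y - psi v *: y).
  by apply: (dot_inj dot_norm) => w; rewrite !dotE; ring.
apply: le_trans (hnormD _ _) _; rewrite hnormZ.
have h1 := hC N v x v1; have h2 := hC' N v x v1; rewrite -/y in h1 h2.
have h3 := ler_wpM2l (normc_ge0 a) h1.
have -> : e * hnorm y + (normc a * C + C') * hnorm x =
  normc a * (e / (1 + normc a) * hnorm y + C * hnorm x) +
   (e / (1 + normc a) * hnorm y + C' * hnorm x).
  by field; rewrite gt_eqF.
exact: lerD.
Qed.

(** The error of [T] passes through [S], whose boundedness comes from its own symbol by
    [symbol_bound]. *)
Lemma symbol_mul phi psi S T : symbol phi S -> symbol psi T ->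
  symbol (fun v => phi v * psi v) (S \o T).
Proof.
move=> sS sT; move: (sS) (sT) => [lS SU [B hB] hS] [lT TU [B' hB'] hT].
have B0 : 0 <= B by apply: le_trans (normc_ge0 _) (hB 1 (normc1 _)).
have B0' : 0 <= B' by apply: le_trans (normc_ge0 _) (hB' 1 (normc1 _)).
have bS := symbol_bound sS hB.
split.
- exact: linear_op_comp.
- by move=> x /=; rewrite TU SU.
- exists (B * B') => v v1; rewrite normcM; apply: ler_pM; rewrite ?normc_ge0 ?hB ?hB' //.
move=> e e0; have D0 : 0 < 1 + B + B' by rewrite ltr_wpDr // ltr_wpDr.
have e1 : 0 < e / (1 + B + B') by rewrite divr_gt0.
have [C [C0 hC]] := hS _ e1; have [C' [C0' hC']] := hT _ e1.
exists (B * C' + B' * C); split; first by rewrite addr_ge0 ?mulr_ge0.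
move=> N v x v1; set y := wave N v x => /=.
have -> : S (T y) - (phi v * psi v) *: y =
   S (T y - psi v *: y) + psi v *: (S y - phi v *: y).
  rewrite (linear_opB _ _ lS) (linear_opZ _ _ lS).
  by apply: (dot_inj dot_norm) => w; rewrite !dotE; ring.
apply: le_trans (hnormD _ _) _; rewrite hnormZ.
have h1 := hC N v x v1; have h2 := hC' N v x v1; rewrite -/y in h1 h2.
have h3 := le_trans (bS _) (ler_wpM2l B0 h2).
have h4 := ler_pM (normc_ge0 _) (hnorm_ge0 _) (hB' v v1) h1.
apply: le_trans (lerD h3 h4) _.
have -> : B * (e / (1 + B + B') * hnorm y + C' * hnorm x) +
   B' * (e / (1 + B + B') * hnorm y + C * hnorm x) =
   (e * ((B + B') / (1 + B + B'))) * hnorm y + (B * C' + B' * C) * hnorm x.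
  by field; rewrite gt_eqF.
rewrite lerD2r ler_wpM2r ?hnorm_ge0 // ger_pMr // ler_pdivrMr // mul1r; lra.
Qed.

Lemma symbol_lim phi T : linear T ->
  (forall e : R, 0 < e -> exists psi S, [/\ symbol psi S,
     (forall v, normc v = 1 -> normc (phi v - psi v) <= e)
     & opbound (T \- S) e]) -> symbol phi T.
Proof.
move=> lT h; split=> //.
- move=> x; apply/eqP; rewrite -subr_eq0 -hnorm_eq0 eq_le hnorm_ge0 andbT.
  apply/ler_addgt0Pl => e e0; rewrite addr0.
  have d0 : 0 < e / (2 * (hnorm x + 1)).
    by rewrite divr_gt0 // mulr_gt0 // ltr_wpDl // hnorm_ge0.
  have [psi [S [[lS SU _ _] _ hS]]] := h _ d0.
  have -> : T (U x) - U (T x) = (T (U x) - S (U x)) - U (T x - S x).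
    by rewrite (linear_opB _ _ cayleyU_lin) -SU opprB addrA subrK.
  apply: le_trans (hnormDB _ _) _.
  rewrite (hnorm_cayley dot_norm saA) //.
  apply: le_trans (lerD (hS (U x)) (hS x)) _.
  rewrite (hnorm_cayley dot_norm saA) //.
  have x0 := hnorm_ge0 x; have x1 : 0 < hnorm x + 1 by rewrite ltr_wpDl.
  have -> : e / (2 * (hnorm x + 1)) * hnorm x + e / (2 * (hnorm x + 1)) * hnorm x
     = e * (hnorm x / (hnorm x + 1)) by field; rewrite gt_eqF.
  by rewrite ger_pMr // ler_pdivrMr // mul1r lerDl.
- have [psi [S [[_ _ [B hB] _] hphi _]]] := h 1 ltr01.
  exists (1 + B) => v v1; apply: le_trans (ler_normcB _ (psi v)) _.
  by rewrite addrC lerD ?hphi ?hB.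
move=> e e0; have e3 : 0 < e / 3 by rewrite divr_gt0.
have [psi [S [[lS SU _ hS] hphi hT]]] := h _ e3.
have [C [C0 hC]] := hS _ e3; exists C; split=> // N v x v1; set y := wave N v x.
have -> : T y - phi v *: y = (T y - S y) + (S y - psi v *: y) - (phi v - psi v) *: y.
  by apply: (dot_inj dot_norm) => w; rewrite !dotE; ring.
apply: le_trans (hnormDB _ _) _; apply: le_trans (lerD (hnormD _ _) (lexx _)) _.
rewrite hnormZ; have := hT y; have := hC N v x v1; rewrite -/y.
have := ler_wpM2r (hnorm_ge0 y) (hphi v v1); move=> /=; lra.
Qed.

Lemma symbol_uniq phi S T : symbol phi S -> symbol phi T -> S = T.
Proof.
move=> sS sT; apply/funext => x; apply/eqP; rewrite -subr_eq0 -hnorm_eq0.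
rewrite eq_le hnorm_ge0 andbT.
have h : symbol (fun=> 0) (fun x => -1 *: T x + S x).
  by apply: symbol_ext (symbol_lin (-1) sT sS) => v _; rewrite mulN1r addNr.
have hb := symbol_bound h (c := 0) (fun v _ => eq_ind_r (fun u => u <= 0) (lexx 0) (@normc0 R)).
by have := hb x; rewrite mul0r scaleN1r addrC.
Qed.

Local Notation circz f := (circ z f).
Local Notation res w := (fun t : R => (t%:C - w)^-1).

(** At [z] the resolvent is (U - 1)/c, so its defect on a wave is that of [U] divided by c. The
    resolvent identity transfers it to [w]: if p and q are the scalars belonging to [z] and [w],
    then q = k p with k (1 - (w - z) p) = 1. At v = 1 these are p = 0 and k = 1. *)
Lemma symbol_resolvent w : w \isn't Num.real -> symbol (circz (res w)) (resolvent A w).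
Proof.
move=> wr; have lw := resolvent_linear dot_norm saA wr.
have z0 := subr_conj_neq0 zr.
pose c := z - conjc z; rewrite -/c in z0.
(* Bounds both the scalar [k] and the operator 1 + (w - z) R(w). *)
pose D := 1 + normc (w - z) * `|complex.Im w|^-1.
have D0 : 0 <= D by rewrite addr_ge0 // mulr_ge0 ?normc_ge0 // invr_ge0.
have key v : normc v = 1 -> exists k, [/\ normc k <= D,
    circz (res w) v = k * ((v - 1) / c) & k * (1 - (w - z) * ((v - 1) / c)) = 1].
  move: v; apply: (circ_case zr) => [|t].
    exists 1; rewrite circ1 subrr mul0r mulr0 mulr0 subr0 mulr1; split=> //.
    by rewrite normc1 lerDl mulr_ge0 ?normc_ge0 // invr_ge0.
  exists ((t%:C - z) / (t%:C - w)); rewrite circ_cayf //.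
  have -> : (cayf z t - 1) / c = (t%:C - z)^-1.
    by rewrite cayfE // addrAC subrr add0r mulrAC mulfV // mul1r.
  have tw := subr_nonreal t wr; have tz := subr_nonreal t zr.
  split; [|by field; rewrite tw tz|by field; rewrite tw tz].
  have -> : (t%:C - z) / (t%:C - w) = 1 + (w - z) * (t%:C - w)^-1 by field.
  apply: le_trans (le_normcD _ _) _; rewrite normc1 lerD2l normcM.
  by rewrite ler_wpM2l ?normc_ge0 // normc_resf.
split=> //.
- move=> x; rewrite /cayley (linear_opD _ _ lw) (linear_opZ _ _ lw).
  by rewrite (resolventC dot_norm saA).
- exists `|complex.Im w|^-1; apply: (circ_case zr) => [|t].
    by rewrite circ1 normc0 invr_ge0.
  by rewrite circ_cayf // normc_resf.
move=> e e0; pose K := D * (D * (normc c^-1 * 2)).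
exists K; split; first by rewrite !mulr_ge0 ?normc_ge0.
move=> N v x v1; apply: ler_wpDl; first by rewrite mulr_ge0 ?hnorm_ge0 // ltW.
set y := wave N v x; have [k [kD -> k1]] := key v v1.
set p := (v - 1) / c in k1 *.
pose a := resolvent A z y - p *: y.
have na : hnorm a <= normc c^-1 * 2 * hnorm x.
  have -> : a = c^-1 *: (U y - v *: y).
    rewrite /a /p /cayley -/c.
    apply: (dot_inj dot_norm) => u; rewrite !dotE; field.
    exact: z0.
  by rewrite hnormZ -mulrA ler_wpM2l ?normc_ge0 // cayley_wave.
have E : resolvent A w y - (k * p) *: y = k *: (a + (w - z) *: resolvent A w a).
  have := resolvent_identity dot_norm saA y wr zr.
  rewrite /a (linear_opB _ _ lw) (linear_opZ _ _ lw) => h.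
  apply: (dot_inj dot_norm) => u; move: (congr1 (dot^~ u) h); rewrite !dotE => hu.
  have hu' : (w - z) * dot (resolvent A w (resolvent A z y)) u =
    dot (resolvent A w y) u - dot (resolvent A z y) u by rewrite -hu.
  have -> : k * (dot (resolvent A z y) u + - (p * dot y u) + (w - z) *
    (dot (resolvent A w (resolvent A z y)) u + - (p * dot (resolvent A w y) u))) =
    k * (dot (resolvent A z y) u + - (p * dot y u) + (w - z) *
    dot (resolvent A w (resolvent A z y)) u - (w - z) * p * dot (resolvent A w y) u) by ring.
  rewrite hu'.
  transitivity (k * (1 - (w - z) * p) * dot (resolvent A w y) u - k * p * dot y u).
    by rewrite k1; ring.
  ring.
rewrite E hnormZ /K -!mulrA; apply: ler_pM; rewrite ?normc_ge0 ?hnorm_ge0 //.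
apply: le_trans (hnormD _ _) _; rewrite hnormZ /D mulrDl mul1r; apply: lerD.
  by rewrite mulrA.
rewrite -mulrA ler_wpM2l ?normc_ge0 //.
apply: le_trans (resolvent_bound dot_norm saA _ wr) _.
by rewrite ler_wpM2l ?invr_ge0 // mulrA.
Qed.

(** The adjoint is carried along with its conjugate symbol, so that it is available after uniform
    limits without a representation theorem. *)
Definition symbol2 phi T T' : Prop :=
  [/\ symbol phi T, symbol (fun v => conjc (phi v)) T'
    & forall x y, dot (T x) y = dot x (T' y)].

Lemma symbol2_lin a phi psi S S' T T' : symbol2 phi S S' -> symbol2 psi T T' ->
  symbol2 (fun v => a * phi v + psi v) (fun x => a *: S x + T x)
    (fun x => conjc a *: S' x + T' x).
Proof.
move=> [sS sS' aS] [sT sT' aT]; split; first exact: symbol_lin.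
  apply: symbol_ext (symbol_lin (conjc a) sS' sT') => v _.
  by rewrite conjcD conjcM.
by move=> x y; rewrite !dotE aS aT conjcK.
Qed.

Lemma symbol2_ext phi psi T T' : (forall v, normc v = 1 -> phi v = psi v) ->
  symbol2 phi T T' -> symbol2 psi T T'.
Proof.
move=> E [sT sT' aT]; split=> //; first exact: symbol_ext E sT.
by apply: symbol_ext sT' => v v1; rewrite (E v v1).
Qed.

Lemma symbol2_resolvent w : w \isn't Num.real ->
  symbol2 (circz (res w)) (resolvent A w) (resolvent A (conjc w)).
Proof.
move=> wr; split; first exact: symbol_resolvent.
  apply: symbol_ext (symbol_resolvent (nonreal_conj wr)) => v _.
  rewrite /circ; case: ifP => _; first by rewrite conjc0.
  by rewrite conjc_inv conjcB (conjc_real (invcay z v)).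
by move=> x y; rewrite (resolvent_adjoint dot_norm saA).
Qed.

(** [symbol_bound] applied to differences turns uniform convergence of symbols into a Cauchy
    estimate in operator norm. *)
Lemma symbol_complete phi (phi_ : nat -> R[i] -> R[i]) (T_ : nat -> H -> H) :
  (forall n, symbol (phi_ n) (T_ n)) ->
  (forall n v, normc v = 1 -> normc (phi v - phi_ n v) <= n.+1%:R^-1) ->
  exists T, symbol phi T /\ forall n, opbound (T \- T_ n) (2 * n.+1%:R^-1).
Proof.
move=> sT hphi.
have cau n m x : hnorm (T_ n x - T_ m x) <= (n.+1%:R^-1 + m.+1%:R^-1) * hnorm x.
  have s := symbol_lin (-1) (sT m) (sT n).
  suff hb : forall v, normc v = 1 ->
      normc (-1 * phi_ m v + phi_ n v) <= n.+1%:R^-1 + m.+1%:R^-1.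
    by have := symbol_bound s hb x; rewrite scaleN1r addrC.
  move=> v v1; have -> : -1 * phi_ m v + phi_ n v = (phi v - phi_ m v) - (phi v - phi_ n v) by ring.
  by apply: le_trans (le_normcB _ _) _; rewrite addrC lerD ?hphi.
have ex x : exists l, hlim (fun n => T_ n x) l.
  apply: hcomplete => e e0.
  have C0 : 0 <= 2 * hnorm x by rewrite mulr_ge0 ?hnorm_ge0.
  have [N [N0 hN]] := inv_nat_eps C0 e0; exists N => n m hn hm.
  apply: le_trans (cau n m x) _; apply: le_trans (hN N (leqnn N)).
  rewrite mulrAC ler_wpM2r ?hnorm_ge0 // mulr_natl mulr2n.
  by rewrite lerD // lef_pV2 ?posrE ?ltr0n // ler_nat ltnW.
have [T hT] := choice ex.
have bT n : opbound (T \- T_ n) (2 * n.+1%:R^-1).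
  move=> x /=; apply/ler_addgt0Pl => e e0.
  have [N hN] := hT x _ e0; pose m := maxn N n.
  apply: le_trans (hnorm_triangle (T_ m x) _ _) _; apply: lerD.
    by rewrite hnormB; apply: hN; exact: leq_maxl.
  apply: le_trans (cau _ _ _) _; rewrite ler_wpM2r ?hnorm_ge0 //.
  rewrite mulr_natl mulr2n lerD2r lef_pV2 ?posrE ?ltr0n // ler_nat ltnS.
  exact: leq_maxr.
exists T; split=> //; apply: symbol_lim.
- move=> a x y; apply: hlim_uniq (hT _) _ => e e0.
  pose C := normc a + 1.
  have C0 : 0 < C by rewrite ltr_wpDl // normc_ge0.
  have ec : 0 < e / C by rewrite divr_gt0.
  have [N1 h1] := hT x _ ec; have [N2 h2] := hT y _ ec.
  exists (maxn N1 N2) => n; rewrite geq_max => /andP[n1 n2].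
  have [lT _ _ _] := sT n; rewrite lT.
  have -> : a *: T_ n x + T_ n y - (a *: T x + T y) =
    a *: (T_ n x - T x) + (T_ n y - T y).
    by apply: (dot_inj dot_norm) => w; rewrite !dotE; ring.
  apply: le_trans (hnormD _ _) _; rewrite hnormZ.
  have := ler_wpM2l (normc_ge0 a) (h1 n n1); have := h2 n n2.
  have : normc a * (e / C) + e / C = e by rewrite /C; field; rewrite gt_eqF.
  lra.
move=> e e0; have [N [N0 /(_ N (leqnn N)) hN]] := inv_nat_eps (ler0n R 2) e0.
have N1 : N.-1.+1 = N by rewrite prednK.
exists (phi_ N.-1), (T_ N.-1); split=> //.
  move=> v /(hphi N.-1 v) /le_trans; apply; rewrite N1; apply: le_trans hN.
  by rewrite ler_peMl // ?invr_ge0 ?ler0n // ler1n.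
move=> x; apply: le_trans (bT N.-1 x) _; rewrite N1.
by rewrite ler_wpM2r ?hnorm_ge0.
Qed.

Lemma symbol2_exists f : vanishing_eps f -> exists T T', symbol2 (circz f) T T'.
Proof.
move=> vf; suff : vanishing_eps f /\ exists T T', symbol2 (circz f) T T' by case.
move: f vf; apply: (@vanishing_density R (fun f => vanishing_eps f /\
  exists T T', symbol2 (circz f) T T') _ _ 1%N) => //; last first.
- move=> w wr; under eq_fun do rewrite expr1.
  split; first exact: vanishing_resf.
  by exists (resolvent A w), (resolvent A (conjc w)); exact: symbol2_resolvent.
- move=> f vf h; split=> //.
  have ex n : exists gTT : (R -> R[i]) * (H -> H) * (H -> H),
     symbol2 (circz gTT.1.1) gTT.1.2 gTT.2 /\ forall t, normc (f t - gTT.1.1 t) <= n.+1%:R^-1.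
    have [|g [_ [T [T' hT]]] hg] := h n.+1%:R^-1; first by rewrite invr_gt0.
    by exists (g, T, T').
  have [g hg] := choice ex.
  have hc n v : normc v = 1 -> normc (circz f v - circz (g n).1.1 v) <= n.+1%:R^-1.
    move: v; apply: (circ_case zr) => [|t].
      by rewrite !circ1 subrr normc0 invr_ge0.
    by rewrite !circ_cayf //; case: (hg n).
  have hs n : symbol (circz (g n).1.1) (g n).1.2 by case: (hg n) => [[]].
  have hs' n : symbol (fun v => conjc (circz (g n).1.1 v)) (g n).2 by case: (hg n) => [[]].
  have [T [sT bT]] := symbol_complete hs hc.
  have hc' n v : normc v = 1 ->
      normc (conjc (circz f v) - conjc (circz (g n).1.1 v)) <= n.+1%:R^-1.
    by move=> v1; rewrite -conjcB normc_conj; exact: hc.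
  have [T' [sT' bT']] := symbol_complete (phi := fun v => conjc (circz f v)) hs' hc'.
  exists T, T'; split=> // x y; apply/eqP; rewrite -subr_eq0 -normc_eq0 eq_le normc_ge0 andbT.
  apply/ler_addgt0Pl => e e0; rewrite addr0.
  have C0 : 0 <= 4 * (hnorm x * hnorm y) by rewrite !mulr_ge0 ?hnorm_ge0.
  have [N [N0 /(_ N (leqnn N)) hN]] := inv_nat_eps C0 e0.
  have N1 : N.-1.+1 = N by rewrite prednK.
  have [[_ _ aT] _] := hg N.-1.
  have -> : dot (T x) y - dot x (T' y) =
     dot (T x - (g N.-1).1.2 x) y - dot x (T' y - (g N.-1).2 y).
    by rewrite dotBl dotBr aT; ring.
  apply: le_trans (le_normcB _ _) _; apply: le_trans hN.
  have h1 := cauchy_schwarz dot_norm (T x - (g N.-1).1.2 x) y.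
  have h2 := cauchy_schwarz dot_norm x (T' y - (g N.-1).2 y).
  have h3 := ler_wpM2r (hnorm_ge0 y) (bT N.-1 x).
  have h4 := ler_wpM2l (hnorm_ge0 x) (bT' N.-1 y).
  rewrite N1 /= in h3 h4; move: (N%:R^-1) h3 h4 => i h3 h4.
  have -> : 4 * (hnorm x * hnorm y) * i = 2 * i * hnorm x * hnorm y + hnorm x * (2 * i * hnorm y) by ring.
  by apply: lerD; [apply: le_trans h1 h3|apply: le_trans h2 h4].
- move=> a f g [vf [S [S' sS]]] [vg [T [T' sT]]]; split; first exact: vanishing_lin.
  exists (fun x => a *: S x + T x), (fun x => conjc a *: S' x + T' x).
  apply: symbol2_ext (symbol2_lin a sS sT) => v _; rewrite /circ.
  by case: ifP => _ //; rewrite mulr0 addr0.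
Qed.

(** [Phi f] is the operator with symbol [circz f]. It is unique by [symbol_uniq], so each clause is
    checked on symbols. Without this lemma [fcalc] might be its default, the zero map. *)
Lemma functional_calculus_exists : exists Phi, functional_calculus dot A Phi.
Proof.
pose Phi f := xget (fun=> 0) [set T | exists T', symbol2 (circz f) T T'].
have PhiP f : vanishing_continuous f -> exists T', symbol2 (circz f) (Phi f) T'.
  move=> /vanishingP /symbol2_exists [T [T' h]]; rewrite /Phi.
  by case: xgetP => [_ -> //|/(_ T)]; case; exists T'.
have uniq f T T' : vanishing_continuous f -> symbol2 (circz f) T T' -> Phi f = T.
  by move=> /PhiP [S' [sS _ _]] [sT _ _]; exact: symbol_uniq sS sT.
exists Phi; split.
- move=> f vf; have [T' [sT _ _]] := PhiP f vf.
  apply/bounded_operatorP; move: (sT) => [lT _ [B hB] _]; split=> //.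
  exists B; split; last exact: symbol_bound sT hB.
  exact: le_trans (normc_ge0 _) (hB 1 (normc1 _)).
- move=> a f g vf vg; have [S' sS] := PhiP f vf; have [T' sT] := PhiP g vg.
  apply: (uniq _ _ (fun x => conjc a *: S' x + T' x)).
    by apply/vanishingP; apply: vanishing_lin; exact/vanishingP.
  apply: symbol2_ext (symbol2_lin a sS sT) => v _; rewrite /circ.
  by case: ifP => _ //; rewrite mulr0 addr0.
- move=> f g vf vg; have [S' [sS sS' aS]] := PhiP f vf; have [T' [sT sT' aT]] := PhiP g vg.
  apply: (uniq _ _ (T' \o S')).
    by apply/vanishingP; apply: vanishing_prod; exact/vanishingP.
  apply: (@symbol2_ext (fun v => circz f v * circz g v)).
    by move=> v _; rewrite /circ; case: ifP => _ //; rewrite mulr0.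
  split; [exact: symbol_mul| |by move=> x y /=; rewrite aS aT].
  by apply: symbol_ext (symbol_mul sT' sS') => v _; rewrite conjcM mulrC.
- move=> f vf y x _ /=; have [T' [sT sT' aT]] := PhiP f vf; rewrite aT.
  congr (dot x (_ y)); apply: esym; apply: (uniq _ _ (Phi f)).
    by apply/vanishingP; apply: vanishing_conj; exact/vanishingP.
  apply: (@symbol2_ext (fun v => conjc (circz f v))).
    by move=> v _; rewrite /circ; case: ifP => _ //; rewrite conjc0.
  split=> //; first by apply: symbol_ext sT => v _; rewrite conjcK.
  by move=> u w; rewrite dot_conj -aT -dot_conj.
- move=> w wr; apply: (uniq _ _ (resolvent A (conjc w))).
    by apply/vanishingP; exact: vanishing_resf.
  exact: symbol2_resolvent.
Qed.

Lemma fcalcP : functional_calculus dot A (fcalc dot A).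
Proof.
rewrite /fcalc; have [Phi hPhi] := functional_calculus_exists.
by case: xgetP => [_ -> //|/(_ Phi)].
Qed.

End Symbol.

(** * Properties of the functional calculus *)

Section Calculus.
Variables (R : realType) (H : completeNormedModType R[i]).
Variable dot : {dot H for Num.conj}.
Hypothesis dot_norm : forall x : H, `|x| ^+ 2 = dot x x.
Implicit Types (x y : H) (f g : R -> R[i]).

Section OneOperator.
Variable A : operator H.
Hypothesis saA : self_adjoint dot A.
Variable z : R[i].
Hypothesis zr : z \isn't Num.real.

Local Notation Phi := (fcalc dot A).
Let hPhi : functional_calculus dot A Phi := fcalcP dot_norm saA zr.

Lemma fcalc_lin a f g : vanishing_eps f -> vanishing_eps g ->
  Phi (fun t => a * f t + g t) = (fun x => a *: Phi f x + Phi g x).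
Proof. by move=> /vanishingP vf /vanishingP vg; case: hPhi => _ h _ _ _; exact: h. Qed.

Lemma fcalc_mul f g : vanishing_eps f -> vanishing_eps g ->
  Phi (fun t => f t * g t) = Phi f \o Phi g.
Proof. by move=> /vanishingP vf /vanishingP vg; case: hPhi => _ _ h _ _; exact: h. Qed.

Lemma fcalc_adjoint f x y : vanishing_eps f ->
  dot (Phi f x) y = dot x (Phi (fun t => conjc (f t)) y).
Proof. by move=> /vanishingP vf; case: hPhi => _ _ _ h _; exact: (h f vf y x). Qed.

Lemma fcalc_resolvent w : w \isn't Num.real ->
  Phi (fun t => (t%:C - w)^-1) = resolvent A w.
Proof. by case: hPhi => _ _ _ _; apply. Qed.

Lemma fcalc_linear f : vanishing_eps f -> linear (Phi f).
Proof. by move=> /vanishingP vf; case: hPhi => h _ _ _ _; case: (h f vf). Qed.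

Lemma fcalc_resolvent_pow w m : w \isn't Num.real ->
  Phi (fun t => (t%:C - w)^-1 ^+ m.+1) = resolvent_pow A w m.+1.
Proof.
move=> wr; elim: m => [|m IH].
  by under eq_fun do rewrite expr1; rewrite fcalc_resolvent.
under eq_fun do rewrite exprS.
rewrite fcalc_mul; [|exact: vanishing_resf|exact: vanishing_resf_exp].
by rewrite IH fcalc_resolvent.
Qed.

(** The difference of the roots is at most their sum, the other factor of a - b. This gives
    continuity of the root also at 0. *)
Lemma norm_sqrtB (a b : R) : 0 <= a -> 0 <= b ->
  `|Num.sqrt a - Num.sqrt b| ^+ 2 <= `|a - b|.
Proof.
move=> a0 b0; rewrite -{2}(sqr_sqrtr a0) -{2}(sqr_sqrtr b0) subr_sqr normrM expr2.
apply: ler_wpM2l => //; rewrite (ger0_norm (addr_ge0 (sqrtr_ge0 _) (sqrtr_ge0 _))).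
apply: le_trans (ler_normB _ _) _.
by rewrite !ger0_norm ?sqrtr_ge0.
Qed.

(* With [h] a resolvent function and [k = h * sqrt (c^2 - |f|^2)] the identity
   [|f h|^2 + |k|^2 = c^2 |h|^2] bounds [Phi f] on the range of [Phi h]. *)
Lemma fcalc_bound f (c : R) : vanishing_eps f ->
  (forall t, normc (f t) <= c) -> opbound (Phi f) c.
Proof.
move=> vf hc; have c0 : 0 <= c by apply: le_trans (normc_ge0 _) (hc 0).
pose h t : R[i] := (t%:C - z)^-1.
have vh : vanishing_eps h by exact: vanishing_resf.
pose s t := Num.sqrt (c ^+ 2 - normc (f t) ^+ 2).
have s0 t : 0 <= c ^+ 2 - normc (f t) ^+ 2.
  by rewrite subr_ge0 ler_sqr ?nnegrE ?normc_ge0 // hc.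
pose k t := (s t)%:C * h t.
have vk : vanishing_eps k.
  apply: vanishing_mul => //.
    move=> t e e0; have [fc _] := vf.
    have d0 : 0 < e ^+ 2 / (2 * c + 1).
      by rewrite divr_gt0 ?exprn_gt0 // ltr_wpDl // mulr_ge0.
    have [d [dp hd]] := fc t _ d0; exists d; split=> // u hu.
    rewrite -rmorphB normcR -ler_sqr ?nnegrE ?(ltW e0) //.
    apply: le_trans (norm_sqrtB (s0 _) (s0 _)) _.
    have -> : c ^+ 2 - normc (f u) ^+ 2 - (c ^+ 2 - normc (f t) ^+ 2) =
      (normc (f t) - normc (f u)) * (normc (f t) + normc (f u)) by ring.
    rewrite normrM.
    have h1 : `|normc (f t) - normc (f u)| <= e ^+ 2 / (2 * c + 1).
      have := hd u hu; have := ler_normcB (f t) (f u); have := ler_normcB (f u) (f t).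
      rewrite (normcB (f t)) ler_norml; move: (normc _) (normc _) (normc _) => p q r.
      by move=> *; apply/andP; split; lra.
    have h2 : `|normc (f t) + normc (f u)| <= 2 * c + 1.
      rewrite ger0_norm ?addr_ge0 ?normc_ge0 //.
      have := hc t; have := hc u; lra.
    apply: le_trans (ler_pM _ _ h1 h2) _ => //.
    by rewrite divfK // gt_eqF // ltr_wpDl // mulr_ge0.
  exists c => t; rewrite normcR ger0_norm ?sqrtr_ge0 //.
  rewrite -[leRHS](ger0_norm c0) -sqrtr_sqr ler_wsqrtr // gerBl sqr_ge0.
  by [].
have vfh : vanishing_eps (fun t => f t * h t) by exact: vanishing_prod.
have nrm g x : vanishing_eps g ->
   (hnorm (Phi g x) ^+ 2)%:C = dot x (Phi (fun t => (normc (g t) ^+ 2)%:C) x).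
  move=> vg; rewrite -(dotxx dot_norm) fcalc_adjoint //.
  have -> : (fun t => (normc (g t) ^+ 2)%:C) = (fun t => conjc (g t) * g t).
    by apply/funext => t; rewrite sqr_normcE mulrC.
  by rewrite fcalc_mul //; exact: vanishing_conj.
have range x : hnorm (Phi f (resolvent A z x)) <= c * hnorm (resolvent A z x).
  apply: sqr_hnorm_le; first by rewrite mulr_ge0 // hnorm_ge0.
  rewrite exprMn -(fcalc_resolvent zr) -/h.
  have -> : Phi f (Phi h x) = Phi (fun t => f t * h t) x by rewrite fcalc_mul.
  have vq g : vanishing_eps g -> vanishing_eps (fun t => (normc (g t) ^+ 2)%:C).
    move=> vg; under eq_fun do rewrite sqr_normcE.
    by apply: vanishing_prod => //; exact: vanishing_conj.
  have E : (hnorm (Phi k x) ^+ 2)%:C + (hnorm (Phi (fun t => f t * h t) x) ^+ 2)%:C =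
     (c ^+ 2)%:C * (hnorm (Phi h x) ^+ 2)%:C.
    rewrite !nrm // -dotDr.
    transitivity (dot x (1 *: Phi (fun t => (normc (k t) ^+ 2)%:C) x +
       Phi (fun t => (normc (f t * h t) ^+ 2)%:C) x)); first by rewrite scale1r.
    have -> : (c ^+ 2)%:C * dot x (Phi (fun t => (normc (h t) ^+ 2)%:C) x) =
      dot x (((c ^+ 2 - 1)%:C *: Phi (fun t => (normc (h t) ^+ 2)%:C) x) +
        Phi (fun t => (normc (h t) ^+ 2)%:C) x).
      rewrite dotDr dotZr conjc_real.
      by rewrite rmorphB rmorph1; ring.
    have e1 := fcalc_lin 1 (vq _ vk) (vq _ vfh).
    have e2 := fcalc_lin (c ^+ 2 - 1)%:C (vq _ vh) (vq _ vh).
    move: (congr1 (@^~ x) e1) (congr1 (@^~ x) e2) => /= <- <-.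
    congr (dot x (Phi _ x)); apply/funext => t.
    rewrite /k !normcM normcR ger0_norm ?sqrtr_ge0 // !exprMn.
    rewrite sqr_sqrtr // !rmorphM !rmorphB !rmorph1; ring.
  have := congr1 (@complex.Re R) E; rewrite -rmorphM -rmorphD /= => <-.
  by rewrite lerDr sqr_ge0.
(* Some bound is part of the definition of a calculus. It extends the sharp bound from the domain of
   [A], which is the range of the resolvent, to its closure. *)
have [B [B0 hB]] : exists B : R, 0 <= B /\ opbound (Phi f) B.
  by case: hPhi => hb _ _ _ _; have /bounded_operatorP [] := hb f ((vanishingP f).2 vf).
move=> x; apply/ler_addgt0Pl => e e0.
have d0 : 0 < e / (B + c + 1) by rewrite divr_gt0 // ltr_wpDl // addr_ge0.
have [y [dy hy]] : exists y, op_dom A y /\ hnorm (x - y) <= e / (B + c + 1).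
  have [_ dA _] := saA.
  have [||y [hy dy]] := dA (ball x (e / (B + c + 1))%:C).
  - by exists x; apply: ballxx; rewrite ltcR.
  - by apply: ball_open; rewrite ltcR.
  exists y; split=> //; move: hy; rewrite -ball_normE /= hnormE ltcR.
  exact: ltW.
have hyc : hnorm (Phi f y) <= c * hnorm y.
  by have := range (op_fun A y - z *: y); rewrite (resolvent_uniq dot_norm saA).
have lP := fcalc_linear vf.
have -> : Phi f x = Phi f (x - y) + Phi f y by rewrite -linear_opD // subrK.
apply: le_trans (hnormD _ _) _.
have h1 := hB (x - y).
have h2 : hnorm y <= hnorm x + hnorm (x - y).
  by have := hnormD x (y - x); rewrite subrKC hnormB.
have h3 := ler_wpM2l c0 h2.
have h4 : (B + c) * hnorm (x - y) <= e.
  apply: le_trans (ler_wpM2l (addr_ge0 B0 c0) hy) _.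
  by rewrite mulrCA ger_pMr // ler_pdivrMr ?mul1r ?lerDl // ltr_wpDl ?addr_ge0.
lra.
Qed.

(** Whichever calculus was chosen, it has the expected symbols: true for resolvents, and preserved
    under uniform limits because [fcalc_bound] uses the axioms only. *)
Lemma fcalc_symbol f : vanishing_eps f -> symbol A z (circ z f) (Phi f).
Proof.
move=> vf; suff : vanishing_eps f /\ symbol A z (circ z f) (Phi f) by case.
move: f vf; apply: (@vanishing_density R (fun f => vanishing_eps f /\
  symbol A z (circ z f) (Phi f)) _ _ 1%N) => //; last first.
- move=> w wr; under eq_fun do rewrite expr1.
  split; first exact: vanishing_resf.
  by rewrite fcalc_resolvent //; exact: (symbol_resolvent dot_norm saA).
- move=> f vf h; split=> //; apply: (symbol_lim dot_norm saA zr (fcalc_linear vf)).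
  move=> e e0; have [g [vg sg] hg] := h e e0.
  exists (circ z g), (Phi g); split=> //.
    apply: (circ_case zr) => [|t]; first by rewrite !circ1 subrr normc0 ltW.
    by rewrite !circ_cayf.
  have : opbound (Phi (fun t => -1 * g t + f t)) e.
    apply: fcalc_bound => [|t]; first exact: vanishing_lin.
    by rewrite mulN1r addrC.
  by rewrite fcalc_lin // => h' x; have := h' x; rewrite scaleN1r addrC.
- move=> a f g [vf sf] [vg sg]; split; first exact: vanishing_lin.
  rewrite fcalc_lin //.
  apply: (symbol_ext _ (symbol_lin dot_norm saA zr a sf sg)) => v _.
  by rewrite /circ; case: ifP => _ //; rewrite mulr0 addr0.
Qed.

Lemma fcalcB f g x : vanishing_eps f -> vanishing_eps g ->
  Phi f x - Phi g x = Phi (fun t => -1 * g t + f t) x.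
Proof. by move=> vf vg; rewrite fcalc_lin // scaleN1r addrC. Qed.

Lemma fcalc_approx f g (e : R) : vanishing_eps f -> vanishing_eps g ->
  (forall t, normc (f t - g t) <= e) -> opbound (Phi f \- Phi g) e.
Proof.
move=> vf vg h x /=; rewrite fcalcB //; apply: fcalc_bound => [|t].
  exact: vanishing_lin.
by rewrite mulN1r addrC.
Qed.

Local Notation U := (cayley A z).
Local Notation V := (cayley A (conjc z)).

Definition fejer_op (G : R[i] -> R[i]) N M x : H :=
  N%:R^-1 *: \sum_(j < N) \sum_(l < N) fcoef G M j l *: iter j U (iter l V x).

Lemma symbol_sum (I : Type) (r : seq I) (phi : I -> R[i] -> R[i]) (T : I -> H -> H) :
  (forall i, symbol A z (phi i) (T i)) ->
  symbol A z (fun v => \sum_(i <- r) phi i v) (fun x => \sum_(i <- r) T i x).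
Proof.
move=> h; elim: r => [|i r IH].
  have s := symbol_lin dot_norm saA zr (-1) (symbol_id A z) (symbol_id A z).
  have -> : (fun x => \sum_(i <- [::]) T i x) = (fun x => -1 *: id x + id x).
    by apply/funext => x; rewrite big_nil scaleN1r addNr.
  by apply: symbol_ext s => v _; rewrite big_nil mulN1r addNr.
have s := symbol_lin dot_norm saA zr 1 (h i) IH.
have -> : (fun x => \sum_(j <- i :: r) T j x) = (fun x => 1 *: T i x + \sum_(j <- r) T j x).
  by apply/funext => x; rewrite big_cons scale1r.
by apply: symbol_ext s => v _; rewrite big_cons mul1r.
Qed.

Lemma symbol_scale a phi T : symbol A z phi T ->
  symbol A z (fun v => a * phi v) (fun x => a *: T x).
Proof.
move=> h; have s := symbol_lin dot_norm saA zr (a - 1) h h.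
have -> : (fun x => a *: T x) = (fun x => (a - 1) *: T x + T x).
  by apply/funext => x; rewrite scalerBl scale1r subrK.
by apply: symbol_ext s => v _; ring.
Qed.

Lemma symbol_iter phi T j : symbol A z phi T ->
  symbol A z (fun v => phi v ^+ j) (iter j T).
Proof.
move=> h; elim: j => [|j IH].
  by apply: symbol_ext (symbol_id A z) => v _; rewrite expr0.
have -> : iter j.+1 T = T \o iter j T by apply/funext.
apply: symbol_ext (symbol_mul dot_norm saA zr h IH) => v _.
by rewrite exprS.
Qed.

Lemma symbol_fejer G N M : symbol A z (fejer G N M) (fejer_op G N M).
Proof.
apply: symbol_scale; apply: symbol_sum => j; apply: symbol_sum => l.
apply: symbol_scale.
apply: (symbol_mul dot_norm saA zr (T := iter l V) (S := iter j U)).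
  exact: (symbol_iter j (symbol_U dot_norm saA zr)).
exact: (symbol_iter l (symbol_V dot_norm saA zr)).
Qed.

End OneOperator.

(** The error is bounded by the sup of the difference of symbols, so [N0] is the same for all
    self-adjoint [A]. This uniformity lets the degree be chosen independently of the sequence of
    operators. *)
Lemma fejer_op_cvg z f : z \isn't Num.real -> vanishing_eps f ->
  forall e : R, 0 < e -> exists N0 : nat, forall N M A, (N0 < N)%N -> (N <= M)%N ->
    self_adjoint dot A ->
    opbound (fcalc dot A f \- fejer_op A z (circ z f) N M) e.
Proof.
move=> zr vf e e0; have [N0 h] := fejer_circ zr vf e0.
exists N0 => N M A N0N NM saA x /=.
have s := symbol_lin dot_norm saA zr (-1) (symbol_fejer saA zr (circ z f) N M)
  (fcalc_symbol saA zr vf).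
have := symbol_bound dot_norm saA zr s (c := e).
move=> /(_ _ x); rewrite scaleN1r addrC; apply=> v v1.
by rewrite mulN1r addrC normcB; apply: h.
Qed.

Lemma fcalc_strong_cvg (A_ : nat -> operator H) A f :
  (forall n, self_adjoint dot (A_ n)) -> self_adjoint dot A ->
  strong_resolvent_cvg A_ A -> vanishing_eps f ->
  forall x, hlim (fun n => fcalc dot (A_ n) f x) (fcalc dot A f x).
Proof.
move=> saA_ saA cA vf.
pose z : R[i] := 'i%C.
have zr : z \isn't Num.real by rewrite nonrealE /= oner_eq0.
suff : vanishing_eps f /\
  forall x, hlim (fun n => fcalc dot (A_ n) f x) (fcalc dot A f x) by case.
move: f vf; apply: (@vanishing_density R (fun f => vanishing_eps f /\
  forall x, hlim (fun n => fcalc dot (A_ n) f x) (fcalc dot A f x)) _ _ 1%N) => //; last first.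
- move=> w wr; under eq_fun do rewrite expr1.
  split; first exact: vanishing_resf.
  move=> x; rewrite (fcalc_resolvent saA zr wr).
  under eq_fun do rewrite (fcalc_resolvent (saA_ _) zr wr).
  exact: cvg_hlim (cA w wr x).
- move=> f vf h; split=> // x e e0.
  have C0 : 0 < 2 * hnorm x + 1 by rewrite ltr_wpDl // mulr_ge0 ?hnorm_ge0.
  have d0 : 0 < e / 2 / (2 * hnorm x + 1) by rewrite !divr_gt0.
  have [g [vg hg] fg] := h _ d0.
  have [N hN] := hg x _ (divr_gt0 e0 (ltr0n _ 2)).
  exists N => n /hN hn.
  have h1 := fcalc_approx (saA_ n) zr vf vg fg x.
  have h2 := fcalc_approx saA zr vf vg fg x.
  move: h1 h2 => /=; rewrite (hnormB (fcalc dot A f x)) => h1 h2.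
  have h3 := hnorm_triangle (fcalc dot (A_ n) g x) (fcalc dot (A_ n) f x) (fcalc dot A f x).
  have h4 := hnorm_triangle (fcalc dot A g x) (fcalc dot (A_ n) g x) (fcalc dot A f x).
  have h5 : 2 * (e / 2 / (2 * hnorm x + 1) * hnorm x) <= e / 2.
    have -> : 2 * (e / 2 / (2 * hnorm x + 1) * hnorm x) =
      e / 2 * (2 * hnorm x / (2 * hnorm x + 1)) by field; rewrite gt_eqF.
    by rewrite ger_pMr ?divr_gt0 // ler_pdivrMr // mul1r lerDl.
  lra.
- move=> a f g [vf hf] [vg hg]; split; first exact: vanishing_lin.
  move=> x e e0; pose C := normc a + 1.
  have C0 : 0 < C by rewrite ltr_wpDl // normc_ge0.
  have ec : 0 < e / C by rewrite divr_gt0.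
  have [N1 h1] := hf x _ ec; have [N2 h2] := hg x _ ec.
  exists (maxn N1 N2) => n; rewrite geq_max => /andP[n1 n2].
  rewrite (fcalc_lin saA zr) // (fcalc_lin (saA_ n) zr) //.
  have -> : a *: fcalc dot (A_ n) f x + fcalc dot (A_ n) g x -
      (a *: fcalc dot A f x + fcalc dot A g x) =
    a *: (fcalc dot (A_ n) f x - fcalc dot A f x) +
      (fcalc dot (A_ n) g x - fcalc dot A g x).
    by apply: (dot_inj dot_norm) => w; rewrite !dotE; ring.
  apply: le_trans (hnormD _ _) _; rewrite hnormZ.
  have := ler_wpM2l (normc_ge0 a) (h1 n n1); have := h2 n n2.
  have : normc a * (e / C) + e / C = e by rewrite /C; field; rewrite gt_eqF.
  lra.
Qed.

Lemma fcalc_norm_cvg (A1_ A2_ : nat -> operator H) A1 A2 m f :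
  (forall n, self_adjoint dot (A1_ n)) -> (forall n, self_adjoint dot (A2_ n)) ->
  self_adjoint dot A1 -> self_adjoint dot A2 -> (0 < m)%N ->
  (forall z, z \isn't Num.real -> forall e : R, 0 < e -> exists N, forall n, (N <= n)%N ->
    opbound ((resolvent_pow (A2_ n) z m \- resolvent_pow (A1_ n) z m) \-
       (resolvent_pow A2 z m \- resolvent_pow A1 z m)) e) ->
  vanishing_eps f -> forall e : R, 0 < e -> exists N, forall n, (N <= n)%N ->
    opbound ((fcalc dot (A2_ n) f \- fcalc dot (A1_ n) f) \-
       (fcalc dot A2 f \- fcalc dot A1 f)) e.
Proof.
move=> sa1_ sa2_ sa1 sa2 m0 hm vf.
pose z : R[i] := 'i%C.
have zr : z \isn't Num.real by rewrite nonrealE /= oner_eq0.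
pose Q f := forall e : R, 0 < e -> exists N, forall n, (N <= n)%N ->
    opbound ((fcalc dot (A2_ n) f \- fcalc dot (A1_ n) f) \-
       (fcalc dot A2 f \- fcalc dot A1 f)) e.
suff : vanishing_eps f /\ Q f by case.
move: f vf; apply: (@vanishing_density R (fun f => vanishing_eps f /\ Q f) _ _ m) => //;
  last first.
- move=> w wr; case: m m0 hm => // m _ hm; split; first exact: vanishing_resf_exp.
  move=> e /(hm w wr) [N hN]; exists N => n /hN.
  by rewrite !(fcalc_resolvent_pow _ zr).
(* Four fifths pay for replacing [f] by [g] in the four operators, the last one for the convergence
   at [g]. *)
- move=> f vf h; split=> // e e0; have d0 : 0 < e / 5 by rewrite divr_gt0.
  have [g [vg hg] fg] := h _ d0; have [N hN] := hg _ d0.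
  exists N => n /hN hn x.
  have := fcalc_approx (sa1_ n) zr vf vg fg x.
  have := fcalc_approx (sa2_ n) zr vf vg fg x.
  have := fcalc_approx sa1 zr vf vg fg x.
  have := fcalc_approx sa2 zr vf vg fg x.
  have := hn x => /=.
  set a := fcalc _ (A2_ n) f x; set b := fcalc _ (A1_ n) f x; set c := fcalc _ A2 f x.
  set d := fcalc _ A1 f x; set a' := fcalc _ (A2_ n) g x; set b' := fcalc _ (A1_ n) g x.
  set c' := fcalc _ A2 g x; set d' := fcalc _ A1 g x.
  have -> : a - b - (c - d) = ((a - a') - (b - b')) - ((c - c') - (d - d'))
     + (a' - b' - (c' - d')).
    by apply: (dot_inj dot_norm) => w; rewrite !dotE; ring.
  have h1 := hnormD (a - a' - (b - b') - (c - c' - (d - d'))) (a' - b' - (c' - d')).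
  have h2 := hnormDB (a - a' - (b - b')) (c - c' - (d - d')).
  have h3 := hnormDB (a - a') (b - b'); have h4 := hnormDB (c - c') (d - d').
  lra.
- move=> a f g [vf hf] [vg hg]; split; first exact: vanishing_lin.
  move=> e e0; pose C := normc a + 1.
  have C0 : 0 < C by rewrite ltr_wpDl // normc_ge0.
  have ec : 0 < e / C by rewrite divr_gt0.
  have [N1 h1] := hf _ ec; have [N2 h2] := hg _ ec.
  exists (maxn N1 N2) => n; rewrite geq_max => /andP[n1 n2] x /=.
  rewrite (fcalc_lin sa1 zr) // (fcalc_lin (sa1_ n) zr) //.
  rewrite (fcalc_lin sa2 zr) // (fcalc_lin (sa2_ n) zr) //.
  have := ler_wpM2l (normc_ge0 a) (h1 n n1 x); have := h2 n n2 x => /=.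
  rewrite -hnormZ; set p := _ - _; set q := (X in hnorm (a *: X)).
  have -> : a *: fcalc dot (A2_ n) f x + fcalc dot (A2_ n) g x -
    (a *: fcalc dot (A1_ n) f x + fcalc dot (A1_ n) g x) -
    (a *: fcalc dot A2 f x + fcalc dot A2 g x -
      (a *: fcalc dot A1 f x + fcalc dot A1 g x)) = a *: q + p.
    by apply: (dot_inj dot_norm) => w; rewrite /p /q !dotE; ring.
  have h3 := hnormD (a *: q) p.
  have : normc a * (e / C * hnorm x) + e / C * hnorm x = e * hnorm x.
    by rewrite /C; field; rewrite gt_eqF.
  lra.
Qed.

End Calculus.

(** * Schatten bounds through Bessel families *)

Section FiniteLp.
Variables (R : realType) (p : R).
Hypothesis p1 : 1 <= p.
Implicit Types (a b s M : nat -> R) (c d : R).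

Let p0 : 0 < p. Proof. exact: lt_le_trans ltr01 p1. Qed.

Lemma powR_le x y : 0 <= x -> x <= y -> x `^ p <= y `^ p.
Proof.
move=> x0 xy; apply: ge0_ler_powR; rewrite ?nnegrE ?(ltW p0) //.
exact: le_trans xy.
Qed.

Lemma powR_le_inv x y : 0 <= x -> 0 <= y -> x `^ p <= y `^ p -> x <= y.
Proof.
move=> x0 y0; apply: contraTT; rewrite -!ltNge => yx.
by apply: gt0_ltr_powR; rewrite ?nnegrE.
Qed.

Lemma powRK x : 0 <= x -> (x `^ p) `^ p^-1 = x.
Proof. by move=> x0; rewrite -powRrM mulfV ?powRr1 // gt_eqF. Qed.

Lemma powRVK x : 0 <= x -> (x `^ p^-1) `^ p = x.
Proof. by move=> x0; rewrite -powRrM mulVf ?powRr1 // gt_eqF. Qed.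

Lemma powR_jensen (K : nat) M s : (forall k, 0 <= M k) -> (forall k, 0 <= s k) ->
  \sum_(k < K) M k <= 1 ->
  (\sum_(k < K) M k * s k) `^ p <= \sum_(k < K) M k * s k `^ p.
Proof.
move=> M0 s0 M1; set S := \sum_(k < K) _.
have S0 : 0 <= S by apply: sumr_ge0 => k _; rewrite mulr_ge0.
have [pe|pn] := eqVneq p 1.
  rewrite pe powRr1 // /S le_eqVlt; apply/orP; left; apply/eqP.
  by apply: eq_bigr => k _; rewrite powRr1.
have p1' : 0 < p - 1 by rewrite subr_gt0 lt_def p1 pn.
pose q := p / (p - 1).
have q0 : 0 < q by rewrite divr_gt0.
have pq : p^-1 + q^-1 = 1 by rewrite /q; field; rewrite !gt_eqF.
have young k : s k * S `^ (p - 1) <= s k `^ p / p + S `^ p / q.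
  have := conjugate_powR (s0 k) (powR_ge0 S (p - 1)) p0 q0 pq.
  rewrite -powRrM; suff -> : (p - 1) * q = p by [].
  by rewrite /q mulrCA mulfV ?mulr1 // gt_eqF.
have : S `^ p <= (\sum_(k < K) M k * s k `^ p) / p + S `^ p / q.
  rewrite -{1}(mulr_powRB1 S0 p0) {1}/S mulr_suml.
  apply: (@le_trans _ _ (\sum_(k < K) M k * (s k `^ p / p + S `^ p / q))).
    by apply: ler_sum => k _; rewrite -mulrA ler_wpM2l.
  under eq_bigr do rewrite mulrDr mulrA.
  rewrite big_split /= -!mulr_suml lerD2l.
  by rewrite ler_piMl // divr_ge0 ?powR_ge0 // ltW.
have -> : q^-1 = 1 - p^-1 by rewrite -pq addrAC subrr add0r.
rewrite mulrBr mulr1 addrCA lerDl subr_ge0 ler_pM2r ?invr_gt0 //.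
Qed.

Definition lp_le (n : nat) a c : Prop := \sum_(i < n) a i `^ p <= c `^ p.

Lemma lp_le_mono n a b c d : (forall i, 0 <= a i) -> (forall i, a i <= b i) ->
  0 <= c -> c <= d -> lp_le n b c -> lp_le n a d.
Proof.
move=> a0 ab c0 cd h; apply: (@le_trans _ _ (c `^ p)); last exact: powR_le.
by apply: le_trans h; apply: ler_sum => i _; exact: powR_le.
Qed.

Lemma lp_le0 n a i : (forall i, 0 <= a i) -> lp_le n a 0 -> (i < n)%N -> a i = 0.
Proof.
move=> a0; rewrite /lp_le powR0 ?gt_eqF // => h ilt.
have : a i `^ p <= 0.
  apply: le_trans h; rewrite (bigD1 (Ordinal ilt)) //= lerDl.
  by apply: sumr_ge0 => j _; exact: powR_ge0.
move=> ale; have /eqP : a i `^ p = 0 by apply/eqP; rewrite eq_le ale powR_ge0.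
by rewrite powR_eq0 => /andP[/eqP].
Qed.

Lemma lp_le_scale n a c t : 0 <= t -> 0 <= c -> (forall i, 0 <= a i) ->
  lp_le n a c -> lp_le n (fun i => t * a i) (t * c).
Proof.
move=> t0 c0 a0 h; rewrite /lp_le powRM //.
under eq_bigr do rewrite powRM //.
by rewrite -mulr_sumr ler_wpM2l ?powR_ge0.
Qed.

(** Minkowski's inequality: convexity of the p-th power at the normalized points [a i / c] and
    [b i / d], with weights proportional to [c] and [d]. Zero bounds force zero sequences. *)
Lemma lp_le_add n a b c d : (forall i, 0 <= a i) -> (forall i, 0 <= b i) ->
  0 <= c -> 0 <= d -> lp_le n a c -> lp_le n b d ->
  lp_le n (fun i => a i + b i) (c + d).
Proof.
move=> a0 b0 c0 d0 ha hb.
have [cz|cp] := eqVneq c 0.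
  rewrite cz add0r in ha *; apply: le_trans hb; apply: ler_sum => i _.
  by rewrite (lp_le0 a0 ha) // add0r.
have [dz|dp] := eqVneq d 0.
  rewrite dz addr0 in hb *; apply: le_trans ha; apply: ler_sum => i _.
  by rewrite (lp_le0 b0 hb) // addr0.
have c1 : 0 < c by rewrite lt_def cp.
have d1 : 0 < d by rewrite lt_def dp.
have cd : 0 < c + d by rewrite addr_gt0.
pose M := fun k : nat => if k == 0%N then c / (c + d) else d / (c + d).
have step i : (a i + b i) `^ p <= (c + d) `^ p *
    (c / (c + d) * (a i / c) `^ p + d / (c + d) * (b i / d) `^ p).
  have := @powR_jensen 2 M (fun k => if k == 0%N then a i / c else b i / d).
  rewrite !big_ord_recr !big_ord0 /= !add0r /M /= => J.
  have -> : a i + b i = (c + d) * (c / (c + d) * (a i / c) + d / (c + d) * (b i / d)).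
    by field; rewrite !gt_eqF.
  rewrite powRM ?(ltW cd) //; last first.
    by rewrite addr_ge0 // mulr_ge0 // divr_ge0 // ltW.
  rewrite ler_wpM2l ?powR_ge0 //; apply: J => [k|k|].
  - by case: ifP => _; rewrite divr_ge0 // ltW.
  - by case: ifP => _; rewrite divr_ge0.
  - by rewrite -mulrDl mulfV // gt_eqF.
rewrite /lp_le; apply: le_trans; first by apply: ler_sum => i _; exact: step.
rewrite -mulr_sumr -[leRHS]mulr1 ler_wpM2l ?powR_ge0 //.
rewrite big_split /= -!mulr_sumr.
have nrm e u : 0 < e -> (forall i, 0 <= u i) -> lp_le n u e ->
    \sum_(i < n) (u i / e) `^ p <= 1.
  move=> e0 u0 hu; rewrite -(ler_pM2r (powR_gt0 p e0)) mul1r mulr_suml.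
  apply: le_trans hu; apply: ler_sum => i _.
  by rewrite -powRM ?(ltW e0) ?divr_ge0 ?(ltW e0) // divfK // gt_eqF.
apply: (@le_trans _ _ (c / (c + d) * 1 + d / (c + d) * 1)).
  by apply: lerD; rewrite ler_wpM2l ?divr_ge0 ?(ltW cd) // nrm.
by rewrite !mulr1 -mulrDl mulfV // gt_eqF.
Qed.

Lemma lp_le_const n (e : R) : 0 <= e -> lp_le n (fun=> e) (n%:R `^ p^-1 * e).
Proof.
move=> e0; rewrite /lp_le sumr_const card_ord powRM ?powR_ge0 //.
by rewrite powRVK ?ler0n // mulr_natl.
Qed.

(** For fixed [n] a uniform error [e] costs at most n^{1/p} e, by Minkowski. *)
Lemma lp_le_approx n a c : (forall i, 0 <= a i) -> 0 <= c ->
  (forall e : R, 0 < e -> exists b, [/\ forall i, 0 <= b i, lp_le n b c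
     & forall i, (i < n)%N -> a i <= b i + e]) -> lp_le n a c.
Proof.
move=> a0 c0 h; rewrite /lp_le.
set X := \sum_(i < n) _; have X0 : 0 <= X by apply: sumr_ge0 => i _; exact: powR_ge0.
rewrite -(powRVK X0); apply: powR_le; first exact: powR_ge0.
apply/ler_addgt0Pl => e e0.
pose k := n%:R `^ p^-1.
have k0 : 0 <= k by exact: powR_ge0.
have d0 : 0 < e / (k + 1) by rewrite divr_gt0 // ltr_wpDl.
have [b [b0 hb ab]] := h _ d0.
have := lp_le_add b0 (fun=> ltW d0) c0 (mulr_ge0 k0 (ltW d0)) hb (lp_le_const n (ltW d0)).
rewrite /lp_le => h1.
apply: powR_le_inv; rewrite ?powR_ge0 ?addr_ge0 ?(ltW e0) // powRVK //.
apply: (@le_trans _ _ (\sum_(i < n) (b i + e / (k + 1)) `^ p)).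
  by apply: ler_sum => i _; apply: powR_le => //; exact: ab.
apply: le_trans h1 _; apply: powR_le.
  by rewrite addr_ge0 // mulr_ge0 // ltW.
rewrite addrC lerD2r mulrCA ger_pMr // ler_pdivrMr ?mul1r ?lerDl //.
by rewrite ltr_wpDl.
Qed.

End FiniteLp.

(** * Schatten bounds tested on Bessel families *)

Section SchattenBound.
Variables (R : realType) (H : completeNormedModType R[i]).
Variable dot : {dot H for Num.conj}.
Hypothesis dot_norm : forall x : H, `|x| ^+ 2 = dot x x.
Variable p : R.
Hypothesis p1 : 1 <= p.
Implicit Types (x y u w : H) (S T A B : H -> H) (e f : nat -> H) (c : R).

(** Unlike orthonormality, the Bessel inequality survives contractions that have an adjoint. That is
    what makes the ideal property [schb_comp] immediate. *)
Definition bessel n e : Prop :=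
  forall x, \sum_(i < n) normc (dot x (e i)) ^+ 2 <= hnorm x ^+ 2.

Lemma normc_dotC x y : normc (dot x y) = normc (dot y x).
Proof. by rewrite (dot_conj dot) normc_conj. Qed.

Lemma bessel_le1 n e i : bessel n e -> (i < n)%N -> hnorm (e i) <= 1.
Proof.
move=> be ilt; have [->|e0] := eqVneq (e i) 0; first by rewrite hnorm0.
have := be (e i); rewrite (bigD1 (Ordinal ilt)) //= => h.
have : normc (dot (e i) (e i)) ^+ 2 <= hnorm (e i) ^+ 2.
  by apply: le_trans h; rewrite lerDl; apply: sumr_ge0 => j _; exact: sqr_ge0.
rewrite (dotxx dot_norm) normcR ger0_norm ?sqr_ge0 //.
have ep : 0 < hnorm (e i) by rewrite lt_def hnorm_ge0 hnorm_eq0 e0.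
rewrite ler_sqr ?nnegrE ?sqr_ge0 ?hnorm_ge0 // expr2 -{3}[hnorm _]mul1r.
by rewrite ler_pM2r.
Qed.

Definition adjoint_of T T' : Prop := forall x y, dot (T x) y = dot x (T' y).

Lemma bessel_adjoint n e T T' a : 0 < a -> adjoint_of T T' -> opbound T' a ->
  bessel n e -> bessel n (fun i => (a^-1)%:C *: T (e i)).
Proof.
move=> a0 adj bT be x.
have := be ((a^-1)%:C *: T' x).
rewrite hnormZ normcR ger0_norm ?invr_ge0 ?(ltW a0) //.
have E i : normc (dot ((a^-1)%:C *: T' x) (e i)) = normc (dot x ((a^-1)%:C *: T (e i))).
  rewrite dotZl dotZr (conjc_real a^-1) !normcM; congr (_ * _).
  by rewrite normc_dotC -adj normc_dotC.
under eq_bigr do rewrite E; move=> /le_trans; apply.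
rewrite ler_sqr ?nnegrE ?mulr_ge0 ?hnorm_ge0 ?invr_ge0 ?(ltW a0) //.
by rewrite mulrC ler_pdivrMr // mulrC.
Qed.

(* [schb T c] says that the Schatten [p]-norm of [T] is at most [c]; the
   supremum over Bessel families needs no singular value decomposition, and it
   is subadditive and lower semicontinuous by construction. *)
Definition schb T c : Prop := 0 <= c /\ forall n e f, bessel n e -> bessel n f ->
  lp_le p n (fun i => normc (dot (T (e i)) (f i))) c.

Lemma schb_ext S T c : (forall x, S x = T x) -> schb S c -> schb T c.
Proof. by move=> /funext <-. Qed.

Lemma schb_le T c d : c <= d -> schb T c -> schb T d.
Proof.
move=> cd [c0 h]; split; first exact: le_trans cd.
move=> n e f be bf; apply: (lp_le_mono p1) (h n e f be bf) => //.
by move=> i; exact: normc_ge0.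
Qed.

Lemma schb_add S T c d : schb S c -> schb T d -> schb (fun x => S x + T x) (c + d).
Proof.
move=> [c0 hS] [d0 hT]; split; first exact: addr_ge0.
move=> n e f be bf.
apply: (lp_le_mono p1) (lp_le_add p1 _ _ c0 d0 (hS n e f be bf) (hT n e f be bf));
  rewrite ?addr_ge0 // => i; rewrite ?normc_ge0 //.
by rewrite dotDl le_normcD.
Qed.

Lemma schb_scale a T c : schb T c -> schb (fun x => a *: T x) (normc a * c).
Proof.
move=> [c0 hT]; split; first by rewrite mulr_ge0 ?normc_ge0.
move=> n e f be bf.
apply: (lp_le_mono p1) (lp_le_scale (normc_ge0 a) c0 _ (hT n e f be bf)) => //;
  rewrite ?mulr_ge0 ?normc_ge0 // => i; rewrite ?normc_ge0 //.
by rewrite dotZl normcM.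
Qed.

Lemma schb0 : schb (fun=> 0) 0.
Proof.
split=> // n e f _ _; rewrite /lp_le big1 ?powR_ge0 // => i _.
by rewrite dot0l normc0 powR0 // gt_eqF // (lt_le_trans ltr01 p1).
Qed.

Lemma schb_sub S T c d : schb S c -> schb T d -> schb (S \- T) (c + d).
Proof.
move=> hS hT; have h := schb_add hS (schb_scale (-1) hT).
rewrite normcN normc1 mul1r in h; apply: schb_ext h => x /=.
by rewrite scaleN1r.
Qed.

Lemma schb_sum (I : Type) (r : seq I) (T : I -> H -> H) (c : I -> R) :
  (forall i, schb (T i) (c i)) ->
  schb (fun x => \sum_(i <- r) T i x) (\sum_(i <- r) c i).
Proof.
move=> h; elim: r => [|i r IH].
  by rewrite big_nil; apply: schb_ext schb0 => x; rewrite big_nil.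
by rewrite big_cons; apply: schb_ext (schb_add (h i) IH) => x; rewrite big_cons.
Qed.

(** [B] acts on the first family, the adjoint of [A] on the second; divided by [b] and [a], both
    remain Bessel. *)
Lemma schb_comp A A' B B' T a b c : 0 < a -> 0 < b -> linear T -> linear A ->
  adjoint_of A A' -> adjoint_of B B' -> opbound A a -> opbound B' b ->
  schb T c -> schb (fun x => A (T (B x))) (a * b * c).
Proof.
move=> a0 b0 lT lA aA aB bA bB [c0 h]; split; first by rewrite !mulr_ge0 // ltW.
have adj' : adjoint_of A' A.
  by move=> x y; rewrite (dot_conj dot) -aA -(dot_conj dot).
move=> n e f be bf.
have h1 := h n _ _ (bessel_adjoint b0 aB bB be) (bessel_adjoint a0 adj' bA bf).
have := lp_le_scale (ltW (mulr_gt0 a0 b0)) c0 _ h1.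
move=> /(_ (fun i => normc_ge0 _)); apply: (lp_le_mono p1) => //.
- by move=> i; exact: normc_ge0.
- move=> i; rewrite linear_opZ // dotZl dotZr (conjc_real a^-1) -aA !normcM !normcR.
  rewrite !ger0_norm ?invr_ge0 ?(ltW a0) ?(ltW b0) //.
  rewrite le_eqVlt; apply/orP; left; apply/eqP; field.
  by rewrite !gt_eqF.
- by rewrite !mulr_ge0 // ltW.
Qed.

(** Lower semicontinuity under operator norm limits: each test involves finitely many entries, and
    Bessel vectors have norm at most 1. *)
Lemma schb_lim T c : 0 <= c -> (forall e : R, 0 < e -> exists S,
  schb S c /\ opbound (T \- S) e) -> schb T c.
Proof.
move=> c0 h; split=> // n e f be bf; apply: (lp_le_approx p1) => // [i|d d0].
  exact: normc_ge0.
have [S [[_ hS] bS]] := h d d0.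
exists (fun i => normc (dot (S (e i)) (f i))); split=> [i||i ilt].
- exact: normc_ge0.
- exact: hS.
have -> : dot (T (e i)) (f i) = dot (S (e i)) (f i) + dot (T (e i) - S (e i)) (f i).
  by rewrite dotBl addrC subrK.
apply: le_trans (le_normcD _ _) _; rewrite lerD2l.
apply: le_trans (cauchy_schwarz dot_norm _ _) _.
rewrite -[d]mulr1; apply: ler_pM; rewrite ?hnorm_ge0 //.
  apply: le_trans (bS (e i)) _.
  by rewrite -[leRHS]mulr1 ler_wpM2l ?(ltW d0) // (bessel_le1 be ilt).
exact: bessel_le1 bf ilt.
Qed.

(** After normalization the entries are products [a i * b i] with square sums at most 1. Each lies
    in [0, 1], so for p >= 1 its p-th power does not exceed it, and the arithmetic-geometric mean
    inequality bounds the sum by 1. *)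
Lemma schb_rank1 u w : schb (fun x => dot x u *: w) (hnorm u * hnorm w).
Proof.
have [u0|u0] := eqVneq u 0.
  rewrite u0 hnorm0 mul0r; apply: schb_ext schb0 => x; by rewrite dot0r scale0r.
have [w0|w0] := eqVneq w 0.
  rewrite w0 hnorm0 mulr0; apply: schb_ext schb0 => x; by rewrite scaler0.
have up : 0 < hnorm u by rewrite lt_def hnorm_ge0 hnorm_eq0 u0.
have wp : 0 < hnorm w by rewrite lt_def hnorm_ge0 hnorm_eq0 w0.
split; first by rewrite mulr_ge0 // ltW.
move=> n e f be bf; rewrite /lp_le.
pose a i := normc (dot u (e i)) / hnorm u; pose b i := normc (dot w (f i)) / hnorm w.
have a0 i : 0 <= a i by rewrite divr_ge0 ?normc_ge0 // ltW.
have b0 i : 0 <= b i by rewrite divr_ge0 ?normc_ge0 // ltW.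
have le1 (g : nat -> H) x : 0 < hnorm x -> bessel n g ->
    \sum_(i < n) (normc (dot x (g i)) / hnorm x) ^+ 2 <= 1.
  move=> xp bg; under eq_bigr do rewrite exprMn.
  by rewrite -mulr_suml exprVn ler_pdivrMr ?exprn_gt0 // mul1r bg.
have ha := le1 e u up be; have hb := le1 f w wp bf.
have ab1 (i : 'I_n) : a i * b i <= 1.
  have : a i ^+ 2 <= 1.
    apply: le_trans ha; rewrite (bigD1 i) //= lerDl.
    by apply: sumr_ge0 => j _; exact: sqr_ge0.
  have : b i ^+ 2 <= 1.
    apply: le_trans hb; rewrite (bigD1 i) //= lerDl.
    by apply: sumr_ge0 => j _; exact: sqr_ge0.
  have := sqr_ge0 (a i - b i); rewrite sqrrB => h1 h2 h3.
  by move: h1; rewrite mulr2n; lra.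
apply: (@le_trans _ _ ((hnorm u * hnorm w) `^ p * \sum_(i < n) a i * b i)).
  rewrite mulr_sumr; apply: ler_sum => i _.
  have -> : normc (dot (dot (e i) u *: w) (f i)) = (hnorm u * hnorm w) * (a i * b i).
    rewrite dotZl normcM (normc_dotC (e i)) /a /b; field.
    by rewrite !gt_eqF.
  rewrite (powRM _ (mulr_ge0 (hnorm_ge0 u) (hnorm_ge0 w)) (mulr_ge0 (a0 i) (b0 i))).
  apply: ler_wpM2l; first exact: powR_ge0.
  have [z|nz] := eqVneq (a i * b i) 0.
    by rewrite z powR0 // gt_eqF // (lt_le_trans ltr01 p1).
  by apply: ge1r_powR => //; rewrite ab1 andbT lt_def nz (mulr_ge0 (a0 i) (b0 i)).
rewrite -[leRHS]mulr1 ler_wpM2l ?powR_ge0 //.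
apply: (@le_trans _ _ (\sum_(i < n) (a i ^+ 2 + b i ^+ 2) / 2)).
  apply: ler_sum => i _; have := sqr_ge0 (a i - b i).
  by rewrite sqrrB mulr2n; lra.
rewrite -mulr_suml big_split /=.
by move: ha hb; rewrite /a /b; lra.
Qed.

End SchattenBound.

(** * Compact operators and singular values *)

Section CompactOperators.
Variables (R : realType) (H : completeNormedModType R[i]).
Variable dot : {dot H for Num.conj}.
Hypothesis dot_norm : forall x : H, `|x| ^+ 2 = dot x x.
Implicit Types (x y : H) (S T A B : H -> H) (e c : R).

(** Finite nets for the image of the unit ball. Under completeness and linearity this is
    compactness, in a form that passes easily to sums, products and norm limits. *)
Definition totally_bounded_op T : Prop := forall e, 0 < e ->
  exists (n : nat) (ys : nat -> H), forall x, hnorm x <= 1 ->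
    exists i, (i < n)%N /\ hnorm (T x - ys i) <= e.

Lemma hball_open x e : 0 < e -> open [set y : H | hnorm (x - y) < e].
Proof.
move=> e0; have -> : [set y : H | hnorm (x - y) < e] = ball x e%:C.
  by rewrite -ball_normE; apply/seteqP; split=> y /=; rewrite hnormE ltcR.
by apply: ball_open; rewrite ltcR.
Qed.

Lemma unit_ballE : [set x : H | `|x| <= 1] = [set x : H | hnorm x <= 1].
Proof.
by apply/seteqP; split=> x /=; rewrite hnormE -(rmorph1 (real_complex R)) lecR.
Qed.

Lemma compact_totally_bounded T : compact_operator T -> totally_bounded_op T.
Proof.
move=> [lT]; rewrite precompactE unit_ballE => cK e e0.
move: cK; rewrite compact_cover.
move=> /(_ H setT (fun x => [set y : H | hnorm (x - y) < e])) [x _||D _ hD].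
- exact: hball_open.
- by move=> y _; exists y => //=; rewrite subrr hnorm0.
exists (size (finmap.enum_fset D)), (nth 0 (finmap.enum_fset D)) => x x1.
have [|y yD hy] := hD (T x); first by apply: subset_closure; exists x.
exists (index y (finmap.enum_fset D)); rewrite index_mem nth_index //; split=> //.
by rewrite hnormB; exact: ltW.
Qed.

(** An ultrafilter on the closed image contains a ball of every radius: otherwise it would contain
    the complements of finitely many balls covering the image. So it is Cauchy, and completeness
    gives the limit. *)
Lemma totally_bounded_compact T : linear T -> totally_bounded_op T ->
  compact_operator T.
Proof.
move=> lT hT; split=> //; rewrite precompactE unit_ballE compact_ultra.
set K := _ @` _ => F UF FK.
have small e : 0 < e -> exists y, F [set x | hnorm (y - x) < e].
  move=> e0; have e3 : 0 < e / 3 by rewrite divr_gt0.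
  have [n [ys hys]] := hT _ e3; apply: contrapT => hF.
  have compl i : F (~` [set x | hnorm (ys i - x) < e]).
    have [h|//] := in_ultra_setVsetC [set x | hnorm (ys i - x) < e] UF.
    by exfalso; apply: hF; exists (ys i).
  have all_compl : F [set x | forall i, (i < n)%N -> e <= hnorm (ys i - x)].
    elim: n {hys} => [|n IH]; first by apply: filterS filterT => x _ i.
    apply: filterS2 IH (compl n) => x h1 /= h2 i.
    rewrite ltnS leq_eqVlt => /orP[/eqP ->|]; last exact: h1.
    by rewrite leNgt; apply/negP.
  have [x [h1 h2]] := filter_ex (filterI all_compl FK).
  have nx : nbhs x [set y | hnorm (x - y) < e / 3].
    by apply: open_nbhs_nbhs; split; [exact: hball_open|rewrite /= subrr hnorm0].
  have [y [[u u1 <-] /= hy]] := h2 _ nx.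
  have [i [ilt hi]] := hys u u1.
  have := h1 i ilt; apply/negP; rewrite -ltNge.
  apply: le_lt_trans (hnorm_triangle (T u) _ _) _.
  rewrite hnormB in hi; rewrite hnormB in hy.
  by apply: le_lt_trans (lerD hi (ltW hy)) _; lra.
have : cvg F.
  apply/cauchy_cvgP; apply/cauchyP => e /posC [e' e0 ->].
  have [y hy] := small _ e0; exists y; apply: filterS hy => x /=.
  by rewrite -ball_normE /= hnormE ltcR.
move=> /cvg_ex [l Fl]; exists l; split=> //.
suff : closure (closure K) l by rewrite -(closure_id (closure K)).1 //; exact: closed_closure.
move=> B nB; have FB : F B by exact: Fl.
exact: filter_ex (filterI FK FB).
Qed.

Lemma totally_bounded_bounded T : linear T -> totally_bounded_op T ->
  exists c, 0 <= c /\ opbound T c.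
Proof.
move=> lT /(_ 1 ltr01) [n [ys h]].
pose c := \sum_(i < n) hnorm (ys i) + 1.
have c0 : 0 <= c by rewrite addr_ge0 // sumr_ge0 // => i _; exact: hnorm_ge0.
exists c; split=> //; apply: opbound_operator_norm => //.
apply: ge_ereal_sup => _ [x /= x1 <-]; rewrite lee_fin.
have [|i [ilt hi]] := h x.
  by move: x1; rewrite hnormE -(rmorph1 (real_complex R)) lecR.
change (hnorm (T x) <= c).
rewrite -(subrK (ys i) (T x)); apply: le_trans (hnormD _ _) _.
rewrite addrC /c lerD // (bigD1 (Ordinal ilt)) //= lerDl.
by apply: sumr_ge0 => j _; exact: hnorm_ge0.
Qed.

Lemma totally_bounded_lim T : (forall e, 0 < e -> exists S,
  totally_bounded_op S /\ opbound (T \- S) e) -> totally_bounded_op T.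
Proof.
move=> h e e0; have e2 : 0 < e / 2 by rewrite divr_gt0.
have [S [tS bS]] := h _ e2; have [n [ys hys]] := tS _ e2.
exists n, ys => x x1; have [i [ilt hi]] := hys x x1; exists i; split=> //.
apply: le_trans (hnorm_triangle (S x) _ _) _; rewrite [e]splitr lerD //.
by apply: le_trans (bS x) _; rewrite -[leRHS]mulr1 ler_wpM2l // ltW.
Qed.

Lemma totally_bounded_add S T : totally_bounded_op S -> totally_bounded_op T ->
  totally_bounded_op (fun x => S x + T x).
Proof.
move=> hS hT e e0; have e2 : 0 < e / 2 by rewrite divr_gt0.
have [n [ys h1]] := hS _ e2; have [m [zs h2]] := hT _ e2.
(* The pair of net points (i, j) is numbered [i * m + j]. *)
exists (n * m)%N, (fun k => ys (k %/ m)%N + zs (k %% m)%N) => x x1.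
have [i [ilt hi]] := h1 x x1; have [j [jlt hj]] := h2 x x1.
exists (i * m + j)%N; split.
  apply: (@leq_trans (i.+1 * m)); first by rewrite mulSn addnC ltn_add2r.
  by rewrite leq_mul2r ilt orbT.
have m0 : (0 < m)%N by exact: leq_trans jlt.
rewrite divnMDl // divn_small // addn0 modnMDl modn_small //.
by rewrite opprD addrACA [e]splitr; apply: le_trans (hnormD _ _) _; exact: lerD.
Qed.

Lemma totally_bounded_0 : totally_bounded_op (fun=> 0).
Proof.
by move=> e e0; exists 1%N, (fun=> 0) => x _; exists 0%N; rewrite subrr hnorm0 ltW.
Qed.

Lemma totally_bounded_compl A T a : linear A -> opbound A a ->
  totally_bounded_op T -> totally_bounded_op (fun x => A (T x)).
Proof.
move=> lA bA hT e e0; have a0 : 0 < `|a| + 1 by rewrite ltr_wpDl.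
have [n [ys h]] := hT _ (divr_gt0 e0 a0).
exists n, (fun i => A (ys i)) => x x1; have [i [ilt hi]] := h x x1.
exists i; split=> //; rewrite -linear_opB //; apply: le_trans (bA _) _.
apply: (@le_trans _ _ ((`|a| + 1) * hnorm (T x - ys i))).
  by rewrite ler_wpM2r ?hnorm_ge0 // (le_trans (ler_norm a)) // lerDl.
by rewrite mulrC -ler_pdivlMr.
Qed.

Lemma totally_bounded_scale a T : totally_bounded_op T ->
  totally_bounded_op (fun x => a *: T x).
Proof.
move=> hT; apply: (@totally_bounded_compl (fun x => a *: x) T (normc a)) => //.
  by move=> b x y; rewrite scalerDr !scalerA mulrC.
by move=> x; rewrite hnormZ.
Qed.

Lemma totally_bounded_compr B T b : linear T -> opbound B b ->
  totally_bounded_op T -> totally_bounded_op (fun x => T (B x)).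
Proof.
move=> lT bB hT e e0; pose c := `|b| + 1; have c0 : 0 < c by rewrite ltr_wpDl.
have [n [ys h]] := hT _ (divr_gt0 e0 c0).
exists n, (fun i => c%:C *: ys i) => x x1.
have [|i [ilt hi]] := h ((c^-1)%:C *: B x).
  rewrite hnormZ normcR ger0_norm ?invr_ge0 ?(ltW c0) //.
  rewrite mulrC ler_pdivrMr // mul1r; apply: le_trans (bB x) _.
  apply: (@le_trans _ _ (c * hnorm x)).
    by rewrite ler_wpM2r ?hnorm_ge0 // (le_trans (ler_norm b)) // lerDl.
  by rewrite -[leRHS]mulr1 ler_wpM2l // ltW.
exists i; split=> //.
have -> : T (B x) = c%:C *: T ((c^-1)%:C *: B x).
  by rewrite (linear_opZ _ _ lT) scalerA -rmorphM mulfV ?gt_eqF // scale1r.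
rewrite -scalerBr hnormZ normcR ger0_norm ?(ltW c0) //.
by rewrite mulrC -ler_pdivlMr.
Qed.

Lemma totally_bounded_sum (I : Type) (r : seq I) (T : I -> H -> H) :
  (forall i, totally_bounded_op (T i)) ->
  totally_bounded_op (fun x => \sum_(i <- r) T i x).
Proof.
move=> h; elim: r => [|i r IH].
  have -> : (fun x => \sum_(i <- [::]) T i x) = (fun=> 0).
    by apply/funext => x; rewrite big_nil.
  exact: totally_bounded_0.
have -> : (fun x => \sum_(j <- i :: r) T j x) = (fun x => T i x + \sum_(j <- r) T j x).
  by apply/funext => x; rewrite big_cons.
exact: totally_bounded_add.
Qed.

Lemma totally_bounded_sub S T : totally_bounded_op S -> totally_bounded_op T ->
  totally_bounded_op (S \- T).
Proof.
move=> hS hT; have := totally_bounded_add hS (totally_bounded_scale (-1) hT).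
by under eq_fun do rewrite scaleN1r.
Qed.

Lemma totally_bounded_subseq T (x : nat -> H) : linear T -> totally_bounded_op T ->
  (forall n, hnorm (x n) <= 1) -> exists y (g : nat -> nat),
  forall n, (n <= g n)%N /\ hnorm (T (x (g n)) - y) <= n.+1%:R^-1.
Proof.
move=> lT tT x1.
have [_] := totally_bounded_compact lT tT; rewrite precompactE unit_ballE => cK.
have [|y [_ hy]] := cK (T (x n) @[n --> \oo]) _.
  by exists 0%N => // n _; apply: subset_closure; exists (x n) => //=; exact: x1.
have ex n : exists k, (n <= k)%N /\ hnorm (T (x k) - y) <= n.+1%:R^-1.
  have n0 : 0 < n.+1%:R^-1 :> R by rewrite invr_gt0.
  have nF : (T (x k) @[k --> \oo]) [set T (x k) | k in [set k | (n <= k)%N]].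
    by exists n => // k /= nk; exists k.
  have nB : nbhs y [set u | hnorm (y - u) < n.+1%:R^-1].
    by apply: open_nbhs_nbhs; split; [exact: hball_open|rewrite /= subrr hnorm0].
  have [_ [[k nk <-] hk]] := hy _ _ nF nB.
  by exists k; split=> //; rewrite hnormB ltW.
have [g hg] := choice ex; by exists y, g.
Qed.

Lemma hlim_dot (u : nat -> H) l y : hlim u l -> (forall n, dot (u n) y = 0) -> dot l y = 0.
Proof.
move=> hu h; apply/eqP; rewrite -normc_eq0 eq_le normc_ge0 andbT.
apply/ler_addgt0Pl => e e0; rewrite addr0.
have y1 : 0 < hnorm y + 1 by rewrite ltr_wpDl // hnorm_ge0.
have [N /(_ N (leqnn N)) hN] := hu _ (divr_gt0 e0 y1).
have -> : dot l y = - dot (u N - l) y by rewrite dotBl h sub0r opprK.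
rewrite normcN; apply: le_trans (cauchy_schwarz dot_norm _ _) _.
apply: le_trans (ler_wpM2r (hnorm_ge0 y) hN) _.
by rewrite -mulrA ger_pMr // mulrC ler_pdivrMr // mul1r lerDl.
Qed.

(* Maximizing vectors of [hnorm (T x)] exist on the unit ball: by the
   parallelogram identity a maximizing sequence along which [T x_n] converges is
   itself Cauchy. *)
Lemma norm_attained T (l : seq H) : linear T -> totally_bounded_op T ->
  exists sv : R * H, [/\ 0 <= sv.1,
    forall x, (forall u, u \in l -> dot x u = 0) -> hnorm (T x) <= sv.1 * hnorm x,
    forall u, u \in l -> dot sv.2 u = 0,
    0 < sv.1 -> hnorm sv.2 = 1 /\ hnorm (T sv.2) = sv.1 & sv.1 = 0 -> sv.2 = 0].
Proof.
move=> lT tT; have [B [B0 bT]] := totally_bounded_bounded lT tT.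
pose M x := forall u, u \in l -> dot x u = 0.
have M0 : M 0 by move=> u _; rewrite dot0l.
have ML a x y : M x -> M y -> M (a *: x + y).
  by move=> hx hy u ul; rewrite dotDl dotZl hx // hy // mulr0 addr0.
have MZ a x : M x -> M (a *: x) by move=> h; rewrite -[_ *: _]addr0; exact: ML.
have MD x y : M x -> M y -> M (x + y) by rewrite -{2}(scale1r x); exact: ML.
pose E := [set hnorm (T x) | x in [set x | M x /\ hnorm x <= 1]].
have Esup : has_sup E.
  split; first by exists (hnorm (T 0)), 0 => //; split=> //; rewrite hnorm0.
  exists B => _ [x [_ x1] <-]; apply: le_trans (bT x) _.
  by rewrite -[leRHS]mulr1 ler_wpM2l.
pose s := sup E.
have sle x : M x -> hnorm x <= 1 -> hnorm (T x) <= s.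
  by move=> hx x1; apply: ub_le_sup; [case: Esup|exists x].
have s0 : 0 <= s.
  by apply: le_trans (sle 0 M0 _); rewrite ?hnorm_ge0 // hnorm0.
have sbound x : M x -> hnorm (T x) <= s * hnorm x.
  move=> hx; have [->|x0] := eqVneq x 0.
    by rewrite linear_op0 // hnorm0 mulr0.
  have xp : 0 < hnorm x by rewrite lt_def hnorm_ge0 hnorm_eq0 x0.
  have nn : normc ((hnorm x)^-1)%:C = (hnorm x)^-1.
    by rewrite normcR ger0_norm // invr_ge0 hnorm_ge0.
  have := sle (((hnorm x)^-1)%:C *: x) (MZ _ _ hx).
  rewrite (linear_opZ _ _ lT) !hnormZ nn mulVf ?gt_eqF // => /(_ (lexx _)).
  by rewrite mulrC ler_pdivrMr.
have [sz|sn] := eqVneq s 0.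
  exists (0, 0) => /=; split=> //; last by rewrite ltxx.
  by move=> x hx; rewrite -sz; exact: sbound.
have sp : 0 < s by rewrite lt_def sn.
have ex n : exists x, [/\ M x, hnorm x <= 1 & s - n.+1%:R^-1 <= hnorm (T x)].
  have n0 : 0 < n.+1%:R^-1 :> R by rewrite invr_gt0.
  have [_ [x [hx x1] <-] hs] := sup_adherent n0 Esup.
  by exists x; split=> //; exact: ltW.
have [x hx] := choice ex.
have x1 n : hnorm (x n) <= 1 by case: (hx n).
have [y [g hg]] := totally_bounded_subseq lT tT x1.
pose u n := x (g n).
have uM n : M (u n) by case: (hx (g n)).
have Tu n : s - n.+1%:R^-1 <= hnorm (T (u n)).
  have [_ _] := hx (g n); apply: le_trans; rewrite lerD2l lerN2 lef_pV2 ?posrE ?ltr0n //.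
  by rewrite ler_nat ltnS; case: (hg n).
have ucau (N a b : nat) : (N <= a)%N -> (N <= b)%N ->
    hnorm (u a - u b) ^+ 2 <= 16 / s * N.+1%:R^-1.
  move=> Na Nb; set d := N.+1%:R^-1.
  have d0 : 0 < d by rewrite invr_gt0.
  have le_d k : (N <= k)%N -> k.+1%:R^-1 <= d.
    by move=> Nk; rewrite lef_pV2 ?posrE ?ltr0n // ler_nat.
  have ha := le_d a Na; have hb := le_d b Nb.
  have Tua : s - d <= hnorm (T (u a)) by apply: le_trans (Tu a); rewrite lerD2l lerN2.
  clearbody d.
  have Tab : hnorm (T (u a) - T (u b)) <= 2 * d.
    apply: le_trans (hnorm_triangle y _ _) _.
    have h1 : hnorm (T (u a) - y) <= a.+1%:R^-1 := (hg a).2.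
    have h2 : hnorm (T (u b) - y) <= b.+1%:R^-1 := (hg b).2.
    rewrite (hnormB y) mulr_natl mulr2n; apply: lerD; [exact: le_trans h1 ha|exact: le_trans h2 hb].
  have h1 : 2 * s - 4 * d <= s * hnorm (u a + u b).
    apply: le_trans (sbound _ (MD _ _ (uM a) (uM b))).
    rewrite linear_opD //.
    have -> : T (u a) + T (u b) = 2 *: T (u a) - (T (u a) - T (u b)).
      by apply: (dot_inj dot_norm) => w; rewrite !dotE; ring.
    have := hnormD (2 *: T (u a) - (T (u a) - T (u b))) (T (u a) - T (u b)).
    rewrite subrK hnormZ normc_nat; lra.
  have := parallelogram dot_norm (u a) (u b).
  have na : hnorm (u a) ^+ 2 <= 1 by rewrite exprn_ile1 ?hnorm_ge0 //; exact: x1.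
  have nb : hnorm (u b) ^+ 2 <= 1 by rewrite exprn_ile1 ?hnorm_ge0 //; exact: x1.
  have h2 : 2 - 4 * d / s <= hnorm (u a + u b).
    rewrite -(ler_pM2l sp) mulrBr (mulrC s (4 * d / s)) divfK ?gt_eqF //; lra.
  have q0 : 0 <= d / s by rewrite divr_ge0 // ltW.
  (* The square of 2 - 4d/s. When that number is negative its square says nothing, but then the left
     side is negative too. *)
  have h3 : 4 - 16 * (d / s) <= hnorm (u a + u b) ^+ 2.
    have [neg|pos] := ltP (2 - 4 * d / s) 0.
      by apply: le_trans (sqr_ge0 _); move: neg; rewrite -mulrA; lra.
    have : (2 - 4 * d / s) ^+ 2 <= hnorm (u a + u b) ^+ 2.
      by rewrite ler_sqr ?nnegrE ?hnorm_ge0.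
    apply: le_trans; rewrite sqrrB -mulrA exprMn mulr2n.
    by have := sqr_ge0 (d / s); lra.
  have -> : 16 / s * d = 16 * (d / s) by rewrite -mulrA (mulrC s^-1).
  by lra.
have [v uv] : exists v, hlim u v.
  apply: hcomplete => e e0.
  have C0 : 0 <= 16 / s by rewrite divr_ge0 // ltW.
  have [N [_ /(_ N.+1 (leqnSn N)) hN]] := inv_nat_eps C0 (exprn_gt0 2 e0).
  exists N => a b Na Nb; apply: sqr_hnorm_le; first exact: ltW.
  exact: le_trans (ucau N a b Na Nb) hN.
have vM : M v by move=> w wl; apply: hlim_dot uv _ => n; exact: uM.
have v1 : hnorm v <= 1 by apply: hlim_le uv _ => n; exact: x1.
have Tv : s <= hnorm (T v).
  apply/ler_addgt0Pl => e e0; have e2 : 0 < e / 2 by rewrite divr_gt0.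
  have B1 : 0 < B + 1 by rewrite ltr_wpDl.
  have [N1 h1] := uv _ (divr_gt0 e2 B1).
  have [N2 [_ h2]] := inv_nat_eps ler01 e2.
  pose n := maxn N1 N2.
  have h3 : hnorm (T (u n) - T v) <= e / 2.
    rewrite -linear_opB //; apply: le_trans (bT _) _.
    have := ler_wpM2l B0 (h1 n (leq_maxl _ _)) => /le_trans; apply.
    by rewrite mulrCA ger_pMr // ler_pdivrMr // mul1r lerDl.
  have h4 : n.+1%:R^-1 <= e / 2.
    by have := h2 n.+1 (leq_trans (leq_maxr _ _) (leqnSn _)); rewrite mul1r.
  have h5 : s - e / 2 <= hnorm (T (u n)) by apply: le_trans (Tu n); rewrite lerD2l lerN2.
  have := hnormD (T (u n) - T v) (T v); rewrite subrK; lra.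
exists (s, v) => /=; split=> //; last by move/eqP; rewrite (negbTE sn).
move=> _; have Tv' : hnorm (T v) = s by apply/eqP; rewrite eq_le Tv sle.
split=> //; apply/eqP; rewrite eq_le v1 -(ler_pM2l sp) mulr1 -{1}Tv'.
exact: sbound.
Qed.

(** Along [a = t G] the left side is linear and the right side quadratic in t; [t = (K + 1)^-1] is
    small enough to force G = 0. *)
Lemma first_variation (G : R[i]) (K : R) : 0 <= K ->
  (forall a : R[i], 2 * complex.Re (conjc a * G) <= normc a ^+ 2 * K) -> G = 0.
Proof.
move=> K0 h; apply/eqP; rewrite -normc_eq0; apply: contraT => nG.
have p0 : 0 < normc G ^+ 2 by rewrite exprn_even_gt0.
have K1 : 0 < K + 1 by rewrite ltr_wpDl.
pose t := (K + 1)^-1; have t0 : 0 < t by rewrite invr_gt0.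
have := h (t%:C * G); rewrite conjcZ -mulrA (mulrC (conjc _)) -sqr_normcE -rmorphM /=.
rewrite normcM normcR (ger0_norm (ltW t0)) exprMn.
have -> : t ^+ 2 * normc G ^+ 2 * K = (t * K) * (t * normc G ^+ 2) by ring.
have tp : 0 < t * normc G ^+ 2 by rewrite mulr_gt0.
have tK : t * K <= 1 by rewrite mulrC ler_pdivrMr // mul1r lerDl.
have := ler_wpM2r (ltW tp) tK; move: (t * normc G ^+ 2) tp => w; lra.
Qed.

(** Greedy construction: [v k] maximizes the norm of [T x] over unit vectors orthogonal to the
    earlier ones, and [s k] is the maximum, with [v k = 0] once it is 0. [L n] lists the first [n]
    vectors. A vector orthogonal to all of them is annihilated by [T] because [s] takes arbitrarily
    small values. *)
Lemma singular_values_exist T : compact_operator T ->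
  exists s, singular_values dot T s.
Proof.
move=> cT; have [lT _] := cT; have tT := compact_totally_bounded cT.
have [step hstep] := choice (fun l => norm_attained l lT tT).
pose L := fix L n := if n is k.+1 then rcons (L k) (step (L k)).2 else [::].
pose s n := (step (L n)).1; pose v n := (step (L n)).2.
have Lmem j k : (j < k)%N -> v j \in L k.
  elim: k => // k IH; rewrite ltnS leq_eqVlt => /orP[/eqP ->|/IH h] /=.
    by rewrite mem_rcons inE eqxx.
  by rewrite mem_rcons inE h orbT.
have Lex k u : u \in L k -> exists2 j, (j < k)%N & u = v j.
  elim: k => [|k IH] //=; rewrite mem_rcons inE => /orP[/eqP ->|/IH [j jk ->]].
    by exists k.
  by exists j => //; exact: ltnW.
have s0 k : 0 <= s k by case: (hstep (L k)).
have sb k x : (forall j, (j < k)%N -> dot x (v j) = 0) -> hnorm (T x) <= s k * hnorm x.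
  by move=> h; case: (hstep (L k)) => _ + _ _ _; apply=> u /Lex [j jk ->]; exact: h.
have vo j k : (j < k)%N -> dot (v k) (v j) = 0.
  by move=> jk; case: (hstep (L k)) => _ _ + _ _; apply; exact: Lmem.
have v1 k : 0 < s k -> hnorm (v k) = 1 /\ hnorm (T (v k)) = s k.
  by case: (hstep (L k)).
have v0 k : s k = 0 -> v k = 0 by case: (hstep (L k)).
have vov j k : j != k -> dot (v j) (v k) = 0.
  rewrite neq_ltn => /orP[/vo h|/vo //].
  by rewrite (dot_conj dot) h conjc0.
have vv k : 0 < s k -> dot (v k) (v k) = 1.
  by move=> /v1 [h _]; rewrite (dotxx dot_norm) h expr1n.
have Tv k : hnorm (T (v k)) = s k.
  have [z|n] := eqVneq (s k) 0; first by rewrite z v0 // linear_op0 // hnorm0.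
  by case: (v1 k); rewrite ?lt_def ?n ?s0.
have snd k : s k.+1 <= s k.
  have [z|n] := eqVneq (s k.+1) 0; first by rewrite z s0.
  have sp : 0 < s k.+1 by rewrite lt_def n s0.
  have [n1 <-] := v1 _ sp; rewrite -[leRHS]mulr1 -n1; apply: sb => j jk.
  by apply: vo; exact: ltnW.
(* The eigenvalue equation for the adjoint of [T] times [T], so far only against vectors of the
   current complement: the first variation at the maximizer [v k]. *)
have adjM k x : 0 < s k -> (forall j, (j < k)%N -> dot x (v j) = 0) ->
    dot (T (v k)) (T x) = (s k ^+ 2)%:C * dot (v k) x.
  move=> sp hx; apply/eqP; rewrite -subr_eq0; apply/eqP.
  apply: (first_variation (K := s k ^+ 2 * hnorm x ^+ 2)).
    by rewrite mulr_ge0 ?sqr_ge0.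
  move=> a; have : hnorm (T (v k + a *: x)) <= s k * hnorm (v k + a *: x).
    apply: sb => j jk; rewrite dotDl dotZl hx // vo // mulr0 addr0; reflexivity.
  rewrite linear_opD // linear_opZ // -ler_sqr ?nnegrE ?hnorm_ge0 ?mulr_ge0 ?hnorm_ge0 //.
  rewrite exprMn !(sqr_hnormD dot_norm) !hnormZ !dotZr Tv (v1 k sp).1 expr1n.
  rewrite mulrBr ReD ReN mulrCA ReM_real !exprMn.
  have := sqr_ge0 (normc a * hnorm (T x)); rewrite exprMn.
  move: (complex.Re _) (complex.Re _) (normc a ^+ 2 * hnorm (T x) ^+ 2) => P Q N.
  have -> : normc a ^+ 2 * (s k ^+ 2 * hnorm x ^+ 2) = s k ^+ 2 * (normc a ^+ 2 * hnorm x ^+ 2).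
    by ring.
  rewrite !mulrDr mulr1 mulrCA; lra.
have Tvov j k : (j < k)%N -> dot (T (v j)) (T (v k)) = 0.
  move=> jk; have [z|n] := eqVneq (s j) 0; first by rewrite v0 // linear_op0 // dot0l.
  rewrite adjM ?lt_def ?n ?s0 // => [|i ij]; first by rewrite vov ?mulr0 ?neq_ltn ?jk.
  by apply: vo; exact: ltn_trans jk.
have svT k x : 0 < s k -> dot (T x) (T (v k)) = dot x ((s k ^+ 2)%:C *: v k).
  move=> sp; rewrite dotZr (conjc_real (s k ^+ 2)).
  (* Removing the component of [x] along the earlier vectors reaches the complement; by [Tvov] that
     component contributes nothing. *)
  pose q := \sum_(j < k) dot x (v j) *: v j.
  have qv j : (j < k)%N -> 0 < s j -> dot q (v j) = dot x (v j).
    move=> jk sj; rewrite /q dot_suml (bigD1 (Ordinal jk)) //= big1 ?addr0.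
      by rewrite dotZl vv // mulr1.
    move=> i ij; rewrite dotZl vov ?mulr0 //.
  have qx j : (j < k)%N -> dot (x - q) (v j) = 0.
    move=> jk; have [z|n] := eqVneq (s j) 0; first by rewrite v0 // dot0r.
    by rewrite dotBl qv ?subrr // lt_def n s0.
  have -> : T x = T (x - q) + T q by rewrite -linear_opD // subrK.
  have -> : dot x (v k) = dot (x - q) (v k) + dot q (v k).
    by rewrite -dotDl subrK.
  have -> : dot q (v k) = 0.
    rewrite /q dot_suml big1 // => j _; rewrite dotZl vov ?mulr0 //.
    by rewrite neq_ltn ltn_ord.
  have -> : dot (T (x - q) + T q) (T (v k)) = dot (T (x - q)) (T (v k)).
    rewrite dotDl /q (linear_op_sum _ _ _ lT) dot_suml [X in _ + X]big1 ?addr0 // => j _.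
    by rewrite linear_opZ // dotZl Tvov ?mulr0.
  rewrite addr0 (dot_conj dot) adjM // conjcZ; congr (_ * _).
  by rewrite -(dot_conj dot).
exists s; split=> //; split.
  move=> k l kl; rewrite -(subnKC kl); elim: (l - k)%N => [|d IH]; first by rewrite addn0.
  by rewrite addnS; exact: le_trans (snd _) IH.
exists v; split.
- move=> k l sk sl; case: eqVneq => [->|kl]; first by rewrite vv.
  by rewrite vov.
- by move=> k sk x _ /=; exact: svT.
move=> x hx; apply: hnorm_le0; apply/ler_addgt0Pl => e e0; rewrite addr0.
have hxv j : dot x (v j) = 0.
  have [z|n] := eqVneq (s j) 0; first by rewrite v0 // dot0r.
  by apply: hx; rewrite lt_def n s0.
have x1 : 0 < hnorm x + 1 by rewrite ltr_wpDl // hnorm_ge0.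
pose d := e / (hnorm x + 1); have d0 : 0 < d by rewrite divr_gt0.
suff [k sk] : exists k, s k <= d.
  apply: le_trans (sb k x (fun j _ => hxv j)) _.
  apply: le_trans (ler_wpM2r (hnorm_ge0 x) sk) _.
  by rewrite /d -mulrA ger_pMr // mulrC ler_pdivrMr // mul1r lerDl.
(* otherwise the vectors [T (v k)] are uniformly separated *)
apply: contrapT => hd.
have sd k : d < s k by rewrite ltNge; apply/negP => h; apply: hd; exists k.
have d2 : 0 < d / 2 by rewrite divr_gt0.
have [n [ys hys]] := tT _ d2.
have ex k : exists i : 'I_n, hnorm (T (v k) - ys i) <= d / 2.
  have [|i [ilt hi]] := hys (v k); last by exists (Ordinal ilt).
  by rewrite (v1 k (lt_trans d0 (sd k))).1.
have [c hc] := choice ex.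
(* Pigeonhole: [n.+1] separated vectors would have to be assigned distinct points of a net of size
   [n]. *)
pose c' (i : 'I_n.+1) := c i.
have : injective c'.
  move=> i j cij; apply: val_inj => /=; apply/eqP; apply: contraT => ij.
  have : hnorm (T (v i) - T (v j)) <= d.
    apply: le_trans (hnorm_triangle (ys (c i)) _ _) _; rewrite [d]splitr lerD //.
    by rewrite hnormB; move: cij; rewrite /c' => ->.
  rewrite -ler_sqr ?nnegrE ?hnorm_ge0 ?(ltW d0) // (sqr_hnormB dot_norm) !Tv.
  have -> : dot (T (v i)) (T (v j)) = 0.
    move: ij; rewrite neq_ltn => /orP[/Tvov //|/Tvov h].
    by rewrite (dot_conj dot) h conjc0.
  rewrite /= mulr0 subr0.
  have : d ^+ 2 < s i ^+ 2 by rewrite ltr_sqr ?nnegrE ?(ltW d0).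
  by have := sqr_ge0 (s j); lra.
by move=> /leq_card; rewrite !card_ord ltnn.
Qed.

End CompactOperators.

(** * Schatten norms and Schatten bounds *)

Section OrthonormalFamilies.
Variables (R : realType) (H : completeNormedModType R[i]).
Variable dot : {dot H for Num.conj}.
Hypothesis dot_norm : forall x : H, `|x| ^+ 2 = dot x x.
(* orthogonal vectors of norm 1 or 0, as [b k] is true or false *)
Variables (g : nat -> H) (b : nat -> bool).
Hypothesis g_orth : forall k l, dot (g k) (g l) = ((k == l) && b k)%:R.
Implicit Types (x : H).

Lemma orth_norm_sum (c : nat -> R[i]) n m : (n <= m)%N ->
  hnorm (\sum_(n <= k < m) c k *: g k) ^+ 2 = \sum_(n <= k < m) normc (c k) ^+ 2 * (b k)%:R.
Proof.
move=> nm; rewrite -(subnKC nm); elim: (m - n)%N => [|d IH].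
  by rewrite addn0 !big_geq // hnorm0 expr0n.
rewrite addnS !big_nat_recr ?leq_addr //= (sqr_hnormD dot_norm) IH.
rewrite hnormZ exprMn.
have -> : dot (\sum_(n <= k < n + d) c k *: g k) (c (n + d)%N *: g (n + d)%N) = 0.
  rewrite dot_suml big_nat_cond big1 // => k /andP[/andP[_ kd] _].
  by rewrite dotZl dotZr g_orth ltn_eqF // andFb !mulr0.
have -> : hnorm (g (n + d)%N) ^+ 2 = (b (n + d)%N)%:R.
  by apply: (@complexI R); rewrite -(dotxx dot_norm) g_orth eqxx /= rmorph_nat.
by rewrite /= mulr0 addr0.
Qed.

Lemma orth_zero k : ~~ b k -> g k = 0.
Proof.
by move=> /negbTE bk; apply: (dotxx_eq0 dot_norm); rewrite g_orth bk andbF.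
Qed.

Lemma orth_dot_sum (c : nat -> R[i]) n m l :
  dot (\sum_(n <= k < m) c k *: g k) (g l) = if (n <= l < m)%N then c l * (b l)%:R else 0.
Proof.
rewrite dot_suml; case: ifPn => [nlm|nlm].
  rewrite (bigD1_seq l) ?mem_index_iota ?iota_uniq //= big1 ?addr0.
    by rewrite dotZl g_orth eqxx.
  by move=> k kl; rewrite dotZl g_orth (negbTE kl) mulr0.
rewrite big_nat_cond big1 // => k /andP[kin _]; rewrite dotZl g_orth.
case: eqVneq => [kl|_]; last by rewrite mulr0.
by move: nlm; rewrite -kl kin.
Qed.

Lemma orth_bessel_nat n m x :
  \sum_(n <= k < m) normc (dot x (g k)) ^+ 2 <= hnorm x ^+ 2.
Proof.
case: (leqP n m) => nm; last first.
  by rewrite big_geq ?sqr_ge0 // ltnW.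
pose q := \sum_(n <= k < m) dot x (g k) *: g k.
have bE k : normc (dot x (g k)) ^+ 2 * (b k)%:R = normc (dot x (g k)) ^+ 2.
  case: (boolP (b k)) => [_|/orth_zero ->]; first by rewrite mulr1.
  by rewrite dot0r normc0 expr0n mulr0.
have qq : hnorm q ^+ 2 = \sum_(n <= k < m) normc (dot x (g k)) ^+ 2.
  by rewrite orth_norm_sum //; apply: eq_bigr => k _; rewrite bE.
have xq : complex.Re (dot x q) = \sum_(n <= k < m) normc (dot x (g k)) ^+ 2.
  rewrite /q dot_sumr.
  have -> : \sum_(n <= k < m) dot x (dot x (g k) *: g k) =
     (\sum_(n <= k < m) normc (dot x (g k)) ^+ 2)%:C.
    rewrite rmorph_sum; apply: eq_bigr => k _ /=.
    by rewrite dotZr sqr_normcE mulrC.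
  by [].
have := sqr_ge0 (hnorm (x - q)); rewrite (sqr_hnormB dot_norm) qq xq; lra.
Qed.

Lemma orth_bessel n : bessel dot n g.
Proof. by move=> x; rewrite -(big_mkord xpredT (fun k => normc (dot x (g k)) ^+ 2)); exact: orth_bessel_nat. Qed.

(** The squared coefficients have bounded increasing partial sums by Bessel, so the Fourier sums are
    Cauchy; [y] is the projection of [x] on the closed span. *)
Lemma orth_sum_cvg x : exists y, hlim (fun K => \sum_(0 <= k < K) dot x (g k) *: g k) y /\
  forall k, dot (x - y) (g k) = 0.
Proof.
pose P K := \sum_(0 <= k < K) dot x (g k) *: g k.
pose a K := \sum_(0 <= k < K) normc (dot x (g k)) ^+ 2.
have a_nd : forall n m, (n <= m)%N -> a n <= a m.
  move=> n m nm; rewrite /a (big_cat_nat (n := n) (p := m)) //= lerDl.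
  by apply: sumr_ge0 => k _; exact: sqr_ge0.
have Pa n m : (n <= m)%N -> hnorm (P m - P n) ^+ 2 <= a m - a n.
  move=> nm; have -> : P m - P n = \sum_(n <= k < m) dot x (g k) *: g k.
    by rewrite /P (big_cat_nat (n := n) (p := m)) //= addrAC subrr add0r.
  have -> : a m - a n = \sum_(n <= k < m) normc (dot x (g k)) ^+ 2.
    by rewrite /a (big_cat_nat (n := n) (p := m)) //= addrAC subrr add0r.
  rewrite orth_norm_sum //.
  apply: ler_sum => k _; case: (b k); rewrite ?mulr1 // mulr0; exact: sqr_ge0.
pose E := range a.
have Esup : has_sup E.
  split; first by exists (a 0%N), 0%N.
  by exists (hnorm x ^+ 2) => _ [K _ <-]; exact: orth_bessel_nat.
have [y hy] : exists y, hlim P y.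
  apply: hcomplete => e e0.
  have [_ [N _ <-] hN] := sup_adherent (exprn_gt0 2 e0) Esup.
  have aS K : a K <= sup E by apply: ub_le_sup; [case: Esup|exists K].
  exists N => n m Nn Nm; apply: sqr_hnorm_le; first exact: ltW.
  wlog nm : n m Nn Nm / (n <= m)%N.
    move=> wl; case: (leqP n m) => [|/ltnW] h; first exact: wl.
    by rewrite hnormB; exact: wl.
  rewrite hnormB; apply: le_trans (Pa n m nm) _.
  have := a_nd _ _ Nn; have := aS m; move: hN; lra.
exists y; split=> // k; apply/eqP; rewrite -normc_eq0 eq_le normc_ge0 andbT.
apply/ler_addgt0Pl => e e0; rewrite addr0.
have g1 : 0 < hnorm (g k) + 1 by rewrite ltr_wpDl // hnorm_ge0.
have [N hN] := hy _ (divr_gt0 e0 g1); pose K := maxn N k.+1.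
have -> : dot (x - y) (g k) = dot (P K - y) (g k).
  rewrite !dotBl /P orth_dot_sum /= (leq_maxr N k.+1 : (k < K)%N); congr (_ - _).
  case: (boolP (b k)) => [_|/orth_zero ->]; first by rewrite mulr1.
  by rewrite dot0r mul0r.
apply: le_trans (cauchy_schwarz dot_norm _ _) _.
apply: le_trans (ler_wpM2r (hnorm_ge0 _) (hN K (leq_maxl _ _))) _.
by rewrite -mulrA ger_pMr // mulrC ler_pdivrMr // mul1r lerDl.
Qed.

End OrthonormalFamilies.

(** * Equivalence of Schatten norms and Bessel bounds *)

Section SingularValues.
Variables (R : realType) (H : completeNormedModType R[i]).
Variable dot : {dot H for Num.conj}.
Hypothesis dot_norm : forall x : H, `|x| ^+ 2 = dot x x.
Variable p : R.
Hypothesis p1 : 1 <= p.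

Let p0 : 0 < p. Proof. exact: lt_le_trans ltr01 p1. Qed.

Definition singular_system (T : H -> H) (s : nat -> R) (e : nat -> H) : Prop :=
  [/\ forall k, 0 <= s k,
      forall k l, 0 < s k -> 0 < s l -> dot (e k) (e l) = (k == l)%:R,
      forall k, 0 < s k -> forall x, dot (T x) (T (e k)) = dot x ((s k ^+ 2)%:C *: e k)
    & forall x, (forall k, 0 < s k -> dot x (e k) = 0) -> T x = 0].

Lemma singular_valuesP T s : singular_values dot T s ->
  exists e, singular_system T s e.
Proof.
move=> [s0 [_ [e [he hadj hker]]]]; exists e; split=> // k sk x.
exact: hadj.
Qed.

Section System.
Variables (T : H -> H) (s : nat -> R) (e : nat -> H).
Hypothesis lT : linear T.
Hypothesis sys : singular_system T s e.

(** Where [s k] is 0 the vector [e k] is arbitrary. Setting it to 0 makes both [rsv] and [lsv]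
    families of orthogonal vectors of norm 1 or 0. *)
Definition rsv k := if 0 < s k then e k else 0.
Definition lsv k := ((s k)^-1)%:C *: T (rsv k).

Lemma rsv_orth k l : dot (rsv k) (rsv l) = ((k == l) && (0 < s k))%:R.
Proof.
case: sys => s0 he _ _; rewrite /rsv.
case: ifP => sk; last by rewrite dot0l andbF.
rewrite andbT; case: ifP => sl; first exact: he.
by rewrite dot0r; case: eqVneq => // kl; move: sl; rewrite -kl sk.
Qed.

Lemma dotT_rsv x k : dot (T x) (T (rsv k)) = (s k ^+ 2)%:C * dot x (rsv k).
Proof.
case: sys => s0 _ hadj _; rewrite /rsv; case: ifP => sk.
  by rewrite hadj // dotZr (conjc_real (s k ^+ 2)).
by rewrite (linear_op0 lT) !dot0r mulr0.
Qed.

Lemma lsv_orth k l : dot (lsv k) (lsv l) = ((k == l) && (0 < s k))%:R.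
Proof.
rewrite /lsv dotZl dotZr dotT_rsv rsv_orth (conjc_real (s l)^-1).
case: eqVneq => [->|_] /=; last by rewrite !mulr0.
case: (boolP (0 < s l)) => sl; last by rewrite !mulr0.
rewrite mulr1 -!rmorphM /=; have -> : (s l)^-1 * ((s l)^-1 * s l ^+ 2) = 1.
  by field; rewrite gt_eqF.
by [].
Qed.

Definition sv_part K x := \sum_(0 <= k < K) dot x (rsv k) *: T (rsv k).

(** [x] minus its projection on the span of the [rsv k] is orthogonal to all of them, so [T]
    annihilates it and only the Fourier sums of [x] matter. *)
Lemma sv_part_cvg (B : R) x : 0 <= B -> opbound T B ->
  hlim (fun K => sv_part K x) (T x).
Proof.
move=> B0 bT; have [y [hy yo]] := orth_sum_cvg dot_norm rsv_orth x.
have Ty : T x = T y.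
  apply/eqP; rewrite -subr_eq0 -linear_opB //; apply/eqP.
  case: sys => _ _ _; apply=> k sk; have := yo k; by rewrite /rsv sk.
move=> d d0; have B1 : 0 < B + 1 by rewrite ltr_wpDl.
have [N hN] := hy _ (divr_gt0 d0 B1); exists N => K /hN hK.
have -> : sv_part K x = T (\sum_(0 <= k < K) dot x (rsv k) *: rsv k).
  by rewrite linear_op_sum //; apply: eq_bigr => k _; rewrite linear_opZ.
rewrite Ty -linear_opB //; apply: le_trans (bT _) _.
apply: le_trans (ler_wpM2l B0 hK) _.
by rewrite mulrCA ger_pMr // ler_pdivrMr // mul1r lerDl.
Qed.

(** The entry at [i] is at most the sum over k of [M i k * s k]. Rows and columns of [M] sum to at
    most 1, by Bessel for the singular vectors and for the test families; Jensen uses the rows, the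
    exchanged sum the columns. *)
Lemma sv_part_lp n (u f : nat -> H) K : bessel dot n u -> bessel dot n f ->
  \sum_(i < n) normc (dot (sv_part K (u i)) (f i)) `^ p <= \sum_(k < K) s k `^ p.
Proof.
move=> bu bf; case: (sys) => s0 _ _ _.
pose M i k := normc (dot (u i) (rsv k)) * normc (dot (lsv k) (f i)).
have M0 i k : 0 <= M i k by rewrite mulr_ge0 ?normc_ge0.
have amgm a b : a * b <= (a ^+ 2 + b ^+ 2) / 2 :> R.
  by have := sqr_ge0 (a - b); rewrite sqrrB mulr2n; lra.
have Trsv k : T (rsv k) = (s k)%:C *: lsv k.
  rewrite /lsv scalerA -rmorphM; have [sk|sk] := eqVneq (s k) 0.
    by rewrite /rsv sk ltxx (linear_op0 lT) scaler0.
  by rewrite mulfV // scale1r.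
have row i : (i < n)%N -> \sum_(k < K) M i k <= 1.
  move=> ilt; apply: le_trans (ler_sum _ (fun k _ => amgm _ _)) _.
  rewrite -mulr_suml big_split /=.
  have h1 := orth_bessel dot_norm rsv_orth K (u i).
  have h2 := orth_bessel dot_norm lsv_orth K (f i).
  have h3 : hnorm (u i) ^+ 2 <= 1.
    by rewrite exprn_ile1 ?hnorm_ge0 //; exact: (bessel_le1 dot_norm bu).
  have h4 : hnorm (f i) ^+ 2 <= 1.
    by rewrite exprn_ile1 ?hnorm_ge0 //; exact: (bessel_le1 dot_norm bf).
  under [X in _ + X]eq_bigr do rewrite (normc_dotC _ (lsv _)).
  by lra.
have col k : \sum_(i < n) M i k <= 1.
  apply: le_trans (ler_sum _ (fun i _ => amgm _ _)) _.
  rewrite -mulr_suml big_split /=.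
  have nr : hnorm (rsv k) ^+ 2 <= 1.
    by rewrite -lecR -(dotxx dot_norm) rsv_orth eqxx; case: (0 < s k); [exact: lexx|exact: ler01].
  have nl : hnorm (lsv k) ^+ 2 <= 1.
    by rewrite -lecR -(dotxx dot_norm) lsv_orth eqxx; case: (0 < s k); [exact: lexx|exact: ler01].
  have h1 := bu (rsv k); have h2 := bf (lsv k).
  under eq_bigr do rewrite (normc_dotC _ (u _)).
  by lra.
apply: (@le_trans _ _ (\sum_(i < n) \sum_(k < K) M i k * s k `^ p)).
  apply: ler_sum => i _.
  apply: le_trans (powR_jensen p1 (M0 i) s0 (row i (ltn_ord i))).
  apply: (powR_le p1); first exact: normc_ge0.
  rewrite /sv_part big_mkord dot_suml; apply: le_trans (normc_sum _ _ _) _.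
  apply: ler_sum => k _; rewrite Trsv dotZl normcM dotZl normcM normcR ger0_norm //.
  by rewrite /M le_eqVlt; apply/orP; left; apply/eqP; ring.
rewrite exchange_big /=; apply: ler_sum => k _; rewrite -mulr_suml.
by rewrite ler_piMl ?powR_ge0.
Qed.

Lemma singular_schb (B c : R) : 0 <= B -> opbound T B -> 0 <= c ->
  (forall K, \sum_(k < K) s k `^ p <= c `^ p) -> schb dot p T c.
Proof.
move=> B0 bT c0 hc; split=> // n u f bu bf.
apply: (lp_le_approx p1) => // [i|d d0]; first exact: normc_ge0.
have [N hN] := choice (fun i => sv_part_cvg (u i) B0 bT d0).
pose K := \max_(i < n) N i.
exists (fun i => normc (dot (sv_part K (u i)) (f i))); split=> [i||i ilt].
- exact: normc_ge0.
- by apply: le_trans (sv_part_lp K bu bf) _.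
have hK : hnorm (sv_part K (u i) - T (u i)) <= d.
  by apply: hN; exact: (@leq_bigmax _ (fun j : 'I_n => N j) (Ordinal ilt)).
have -> : dot (T (u i)) (f i) = dot (sv_part K (u i)) (f i) -
    dot (sv_part K (u i) - T (u i)) (f i) by rewrite dotBl opprB addrC subrK.
apply: le_trans (le_normcB _ _) _; rewrite lerD2l.
apply: le_trans (cauchy_schwarz dot_norm _ _) _.
by rewrite -[d]mulr1; apply: ler_pM; rewrite ?hnorm_ge0 // (bessel_le1 dot_norm bf).
Qed.

(** The singular vectors are themselves admissible test families, and their entries are the singular
    values. *)
Lemma schb_singular c : schb dot p T c -> forall K, \sum_(k < K) s k `^ p <= c `^ p.
Proof.
move=> [c0 h] K; case: (sys) => s0 _ _ _.
have := h K rsv lsv (orth_bessel dot_norm rsv_orth K) (orth_bessel dot_norm lsv_orth K).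
apply: le_trans; apply: ler_sum => k _.
suff -> : dot (T (rsv k)) (lsv k) = (s k)%:C by rewrite normcR ger0_norm.
rewrite /lsv dotZr dotT_rsv rsv_orth eqxx (conjc_real (s k)^-1) /=.
case: (boolP (0 < s k)) => sk.
  by rewrite mulr1 -rmorphM; congr (_%:C); field; rewrite gt_eqF.
by rewrite !mulr0; congr (_%:C); apply/eqP; rewrite eq_le s0 leNgt sk.
Qed.

Lemma singular_tail K : singular_system (T \- sv_part K)
  (fun k => s (k + K)%N) (fun k => e (k + K)%N).
Proof.
case: (sys) => s0 he hadj hker.
have rv k : 0 < s k -> rsv k = e k by rewrite /rsv => ->.
have zero k : 0 < s (k + K)%N -> sv_part K (e (k + K)%N) = 0.
  move=> sk; rewrite /sv_part big_nat_cond big1 // => l /andP[/andP[_ lK] _].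
  rewrite -(rv _ sk) rsv_orth; case: eqVneq => [E|_]; last by rewrite scale0r.
  by move: lK; rewrite -E ltnNge leq_addl.
split=> //.
- by move=> k l sk sl; rewrite he // eqn_add2r.
- move=> k sk x /=; rewrite zero // subr0 dotBl hadj //.
  rewrite [X in _ - X](_ : _ = 0) ?subr0 // /sv_part dot_suml.
  rewrite big_nat_cond big1 // => l /andP[/andP[_ lK] _].
  rewrite dotZl -(rv _ sk) dotT_rsv rsv_orth.
  case: eqVneq => [E|_]; last by rewrite !mulr0.
  by move: lK; rewrite E ltnNge leq_addl.
move=> x hx /=.
have -> : sv_part K x = T (\sum_(0 <= k < K) dot x (rsv k) *: rsv k).
  by rewrite linear_op_sum //; apply: eq_bigr => k _; rewrite linear_opZ.
rewrite -linear_opB //; apply: hker => k sk.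
rewrite dotBl -(rv _ sk) (orth_dot_sum rsv_orth) sk mulr1 /=.
case: ltnP => [_|Kk]; first by rewrite subrr.
by rewrite subr0 rv // -(subnK Kk) hx // subnK.
Qed.

Lemma sv_part_linear K : linear (sv_part K).
Proof.
move=> a x y; rewrite /sv_part scaler_sumr -big_split; apply: eq_bigr => k _ /=.
by rewrite dotDl dotZl scalerDl scalerA.
Qed.

Lemma sv_part_bounded K : exists B : R, 0 <= B /\ opbound (sv_part K) B.
Proof.
exists (\sum_(0 <= k < K) hnorm (rsv k) * hnorm (T (rsv k))); split.
  by apply: sumr_ge0 => k _; rewrite mulr_ge0 ?hnorm_ge0.
move=> x; rewrite /sv_part mulr_suml; apply: le_trans (hnorm_sum _ _ _) _.
apply: ler_sum => k _; rewrite hnormZ mulrAC ler_wpM2r ?hnorm_ge0 //.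
by rewrite mulrC cauchy_schwarz.
Qed.

End System.

Lemma sum_tail_small (a : nat -> R) (C : R) : (forall k, 0 <= a k) ->
  (forall K, \sum_(k < K) a k <= C) -> forall d, 0 < d -> exists K,
  forall n, \sum_(k < n) a (k + K)%N <= d.
Proof.
move=> a0 hC d d0; pose E := range (fun K => \sum_(k < K) a k).
have Esup : has_sup E.
  by split; [exists (\sum_(k < 0) a k), 0%N|exists C => _ [K _ <-]].
have [_ [K _ <-] hK] := sup_adherent d0 Esup; exists K => n.
have : \sum_(k < K + n) a k <= sup E by apply: ub_le_sup; [case: Esup|exists (K + n)%N].
rewrite big_split_ord /=; under [X in _ + X]eq_bigr do rewrite addnC.
by move: hK; lra.
Qed.

(** After removing [sv_part K], the shifted system is a singular system of the remainder, whose
    singular values form the tail of a p-summable sequence. *)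
Lemma schb_truncation T c : compact_operator T -> schb dot p T c ->
  forall d : R, 0 < d -> exists (K : nat) (v w : nat -> H),
    schb dot p (fun x => T x - \sum_(k < K) dot x (v k) *: w k) d.
Proof.
move=> cT hT d d0; have [lT _] := cT.
have [s hs] := singular_values_exist dot_norm cT.
have [e sys] := singular_valuesP hs.
have [B [B0 bT]] := totally_bounded_bounded lT (compact_totally_bounded cT).
have [K hK] := sum_tail_small (fun k => powR_ge0 (s k) p) (schb_singular lT sys hT)
  (powR_gt0 p d0).
exists K, (rsv s e), (fun k => T (rsv s e k)).
have [B' [B0' bP]] := sv_part_bounded T s e K.
have bd : opbound (T \- sv_part T s e K) (B + B').
  by move=> x /=; apply: le_trans (hnormDB _ _) _; rewrite mulrDl lerD.
apply: (@schb_ext _ _ dot p (T \- sv_part T s e K)).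
  by move=> x; rewrite /sv_part /= big_mkord.
apply: (singular_schb _ (singular_tail lT sys K) (addr_ge0 B0 B0') bd (ltW d0)) => //.
exact: (linear_op_sub dot_norm lT (sv_part_linear T s e K)).
Qed.

Lemma schatten_norm_leP (s : nat -> R) (c : R) : (forall k, 0 <= s k) -> 0 <= c ->
  ((\sum_(0 <= k <oo) (s k `^ p)%:E) `^ p^-1 <= c%:E)%E <->
  (forall K, \sum_(k < K) s k `^ p <= c `^ p).
Proof.
move=> s0 c0; have t0 k : (0 <= (s k `^ p)%:E)%E by rewrite lee_fin powR_ge0.
have part K : (\sum_(0 <= k < K) (s k `^ p)%:E)%E = (\sum_(k < K) s k `^ p)%:E.
  by rewrite sumEFin big_mkord.
have L0 : (0 <= \sum_(0 <= k <oo) (s k `^ p)%:E)%E by exact: nneseries_ge0.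
split=> h.
  move=> K; have := nneseries_lim_ge (m := 0) K (fun k _ _ => t0 k : is_true _) (P := xpredT).
  rewrite part; move: L0 h; case: (X in (_ <= X)%E -> _) => [l||] //.
  - rewrite lee_fin => l0; rewrite poweR_EFin lee_fin => hl.
    rewrite lee_fin => /le_trans; apply.
    rewrite -(powRVK p1 l0); apply: (powR_le p1) => //; exact: powR_ge0.
  - by move=> _; rewrite poweRyr ?leye_eq // invr_eq0 gt_eqF.
have -> : c%:E = ((c `^ p)%:E `^ p^-1)%E by rewrite poweR_EFin (powRK p1).
apply: gt0_ler_poweR; rewrite ?invr_ge0 ?(ltW p0) ?in_itv //= ?leey ?andbT //.
  by rewrite lee_fin powR_ge0.
apply: lime_le; first exact: is_cvg_nneseries.
by apply: nearW => K; rewrite part lee_fin.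
Qed.

Lemma schatten_norm_ge0 T : (0 <= schatten_norm dot p T)%E.
Proof. exact: poweR_ge0. Qed.

Lemma schatten_norm_schb T c : compact_operator T -> 0 <= c ->
  (schatten_norm dot p T <= c%:E)%E -> schb dot p T c.
Proof.
move=> cT c0; have [lT _] := cT; have [s hs] := singular_values_exist dot_norm cT.
have hsv : singular_values dot T (singular_value dot T).
  by rewrite /singular_value; case: xgetP => [_ -> //|/(_ s)].
have [e sys] := singular_valuesP hsv.
have [B [B0 bT]] := totally_bounded_bounded lT (compact_totally_bounded cT).
rewrite /schatten_norm schatten_norm_leP //; last by case: sys.
exact: (singular_schb lT sys B0 bT c0).
Qed.

Lemma schb_schatten_norm T c : linear T -> schb dot p T c ->
  (schatten_norm dot p T <= c%:E)%E.
Proof.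
move=> lT hT; have c0 : 0 <= c by case: hT.
rewrite /schatten_norm /singular_value; case: xgetP => [s _ hs|_].
  have [e sys] := singular_valuesP hs.
  have s0 : forall k, 0 <= s k by case: sys.
  by apply/(schatten_norm_leP s0 c0) => K; have := schb_singular lT sys hT K.
(* No sequence of singular values exists here, so [singular_value] is the default zero sequence. *)
apply/(schatten_norm_leP (fun=> lexx 0) c0) => K.
rewrite big1 ?powR_ge0 // => k _; by rewrite powR0 // gt_eqF.
Qed.

Lemma schattenP T : schatten dot p T <-> compact_operator T /\ exists c, schb dot p T c.
Proof.
split=> [[cT hT]|[cT [c hc]]].
  have fn : schatten_norm dot p T \is a fin_num.
    by rewrite ge0_fin_numE // schatten_norm_ge0.
  split=> //; exists (fine (schatten_norm dot p T)); apply: schatten_norm_schb => //.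
    by apply: fine_ge0; exact: schatten_norm_ge0.
  by rewrite fineK.
split=> //; apply: le_lt_trans (schb_schatten_norm _ hc) _; last exact: ltry.
by case: cT.
Qed.

End SingularValues.

(** * Strong convergence against Schatten class factors *)

Section StrongConvergence.
Variables (R : realType) (H : completeNormedModType R[i]).
Variable dot : {dot H for Num.conj}.
Hypothesis dot_norm : forall x : H, `|x| ^+ 2 = dot x x.
Variable p : R.
Hypothesis p1 : 1 <= p.
Implicit Types (A B T : H -> H).

Definition tends0 (u : nat -> R) : Prop :=
  forall e : R, 0 < e -> exists N, forall n, (N <= n)%N -> u n <= e.

Lemma tends0_sum K (u : nat -> nat -> R) : (forall k, tends0 (u k)) ->
  tends0 (fun n => \sum_(k < K) u k n).
Proof.
move=> h; elim: K => [|K IH] e e0.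
  by exists 0%N => n _; rewrite big_ord0 ltW.
have e2 : 0 < e / 2 by rewrite divr_gt0.
have [N1 h1] := IH _ e2; have [N2 h2] := h K _ e2.
exists (maxn N1 N2) => n; rewrite geq_max => /andP[n1 n2].
by rewrite big_ord_recr /= [e]splitr lerD ?h1 ?h2.
Qed.

Lemma tends0_scale (c : R) (u : nat -> R) : 0 <= c -> tends0 u ->
  tends0 (fun n => c * u n).
Proof.
move=> c0 h e e0; have c1 : 0 < c + 1 by rewrite ltr_wpDl.
have [N hN] := h _ (divr_gt0 e0 c1); exists N => n /hN hn.
apply: le_trans (ler_wpM2l c0 hn) _.
by rewrite mulrCA ger_pMr // ler_pdivrMr // mul1r lerDl.
Qed.

Record bounded_adjoint A A' (a : R) : Prop := BoundedAdjoint {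
  ba_lin : linear A;
  ba_lin' : linear A';
  ba_adj : adjoint_of dot A A';
  ba_bnd : opbound A a;
  ba_bnd' : opbound A' a }.

Lemma ba_sub A A' a B B' b : bounded_adjoint A A' a -> bounded_adjoint B B' b ->
  bounded_adjoint (A \- B) (A' \- B') (a + b).
Proof.
move=> [lA lA' aA bA bA'] [lB lB' aB bB bB']; split.
- exact: (linear_op_sub dot_norm).
- exact: (linear_op_sub dot_norm).
- by move=> x y /=; rewrite dotBl dotBr aA aB.
- by move=> x /=; apply: le_trans (hnormDB _ _) _; rewrite mulrDl lerD.
- by move=> x /=; apply: le_trans (hnormDB _ _) _; rewrite mulrDl lerD.
Qed.

Lemma ba_id : bounded_adjoint id id 1.
Proof. by split=> // x; rewrite mul1r. Qed.

Lemma ba_comp A A' B B' : bounded_adjoint A A' 1 -> bounded_adjoint B B' 1 ->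
  bounded_adjoint (A \o B) (B' \o A') 1.
Proof.
move=> [lA lA' aA bA bA'] [lB lB' aB bB bB']; split.
- exact: linear_op_comp.
- exact: linear_op_comp.
- by move=> x y /=; rewrite aA aB.
- by move=> x /=; apply: le_trans (bA _) _; rewrite mul1r.
- by move=> x /=; apply: le_trans (bB' _) _; rewrite mul1r.
Qed.

(* Gruemm's theorem: strong convergence is upgraded to Schatten norm convergence
   by a Schatten class factor, which is finite rank up to a small error. *)
Lemma schb_strong_cvg (T_ A_ A'_ B_ B'_ : nat -> H -> H) T A A' B B' (a b c : R) :
  compact_operator T -> schb dot p T c -> (forall n, linear (T_ n)) ->
  (forall d : R, 0 < d -> exists N, forall n, (N <= n)%N -> schb dot p (T_ n \- T) d) ->
  0 < a -> 0 < b ->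
  (forall n, bounded_adjoint (A_ n) (A'_ n) a) -> bounded_adjoint A A' a ->
  (forall n, bounded_adjoint (B_ n) (B'_ n) b) -> bounded_adjoint B B' b ->
  (forall x, hlim (fun n => A_ n x) (A x)) ->
  (forall x, hlim (fun n => B'_ n x) (B' x)) ->
  forall d : R, 0 < d -> exists N, forall n, (N <= n)%N ->
    schb dot p (fun x => A_ n (T_ n (B_ n x)) - A (T (B x))) d.
Proof.
move=> cT hT lT_ cvT a0 b0 hA_ hA hB_ hB cvA cvB d d0.
have [lT _] := cT.
have ab0 : 0 < a * b by rewrite mulr_gt0.
(* The bounds [s1], [s2] and [s3] amount to 1, 2 and 2 times [a * b * d1], together 5d/8; the finite
   rank part [u n] adds at most d/4. *)
pose d1 := d / (8 * (a * b)).
have d10 : 0 < d1 by rewrite divr_gt0 // mulr_gt0.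
have [K [v [w hK]]] := schb_truncation dot_norm p1 cT hT d10.
pose T0 x := T x - \sum_(k < K) dot x (v k) *: w k.
have lF : linear (fun x => \sum_(k < K) dot x (v k) *: w k).
  move=> s x y; rewrite scaler_sumr -big_split; apply: eq_bigr => k _ /=.
  by rewrite dotDl dotZl scalerDl scalerA.
have lT0 : linear T0 by exact: (linear_op_sub dot_norm lT lF).
pose u n := \sum_(k < K) (b * hnorm (v k)) * hnorm (A_ n (w k) - A (w k)) +
  \sum_(k < K) (a * hnorm (w k)) * hnorm (B'_ n (v k) - B' (v k)).
have [N1 hN1] : exists N, forall n, (N <= n)%N -> u n <= d / 4.
  have d8 : 0 < d / 8 by rewrite divr_gt0.
  have [|N hN] := @tends0_sum K (fun k n => (b * hnorm (v k)) * hnorm (A_ n (w k) - A (w k))) _ _ d8.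
    by move=> k; apply: tends0_scale; [rewrite mulr_ge0 ?hnorm_ge0 // ltW|exact: cvA].
  have [|N' hN'] := @tends0_sum K (fun k n => (a * hnorm (w k)) * hnorm (B'_ n (v k) - B' (v k))) _ _ d8.
    by move=> k; apply: tends0_scale; [rewrite mulr_ge0 ?hnorm_ge0 // ltW|exact: cvB].
  exists (maxn N N') => n; rewrite geq_max => /andP[/hN h1 /hN' h2].
  by move: h1 h2; rewrite /u; lra.
have [N2 hN2] := cvT _ d10.
exists (maxn N1 N2) => n; rewrite geq_max => /andP[/hN1 hu /hN2 ht].
have hAn := hA_ n; have hBn := hB_ n.
have sA := ba_sub hAn hA; have sB := ba_sub hBn hB.
have a2 : 0 < a + a by rewrite addr_gt0.
have b2 : 0 < b + b by rewrite addr_gt0.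
have lD : linear (T_ n \- T) by exact: (linear_op_sub dot_norm).
(* Split into A_n (T_n - T) B_n, the two differences in A and in B around the small remainder T0,
   and the same two differences around the finite rank part, which are sums of rank one
   operators. *)
have s1 := schb_comp p1 a0 b0 lD (ba_lin hAn) (ba_adj hAn) (ba_adj hBn) (ba_bnd hAn) (ba_bnd' hBn) ht.
have s2 := schb_comp p1 a2 b0 lT0 (ba_lin sA) (ba_adj sA) (ba_adj hBn) (ba_bnd sA) (ba_bnd' hBn) hK.
have s3 := schb_comp p1 a0 b2 lT0 (ba_lin hA) (ba_adj hA) (ba_adj sB) (ba_bnd hA) (ba_bnd' sB) hK.
have s4 := schb_sum p1 (index_enum 'I_K)
  (fun k : 'I_K => schb_rank1 dot p1 (B'_ n (v k)) (A_ n (w k) - A (w k))).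
have s5 := schb_sum p1 (index_enum 'I_K)
  (fun k : 'I_K => schb_rank1 dot p1 (B'_ n (v k) - B' (v k)) (A (w k))).
have s := schb_add p1 (schb_add p1 s1 (schb_add p1 s2 s3)) (schb_add p1 s4 s5).
apply: (schb_le p1 _ (schb_ext _ s)).
  have e1 : \sum_(k < K) hnorm (B'_ n (v k)) * hnorm (A_ n (w k) - A (w k)) <=
    \sum_(k < K) (b * hnorm (v k)) * hnorm (A_ n (w k) - A (w k)).
    by apply: ler_sum => k _; rewrite ler_wpM2r ?hnorm_ge0 //; exact: (ba_bnd' hBn).
  have e2 : \sum_(k < K) hnorm (B'_ n (v k) - B' (v k)) * hnorm (A (w k)) <=
    \sum_(k < K) (a * hnorm (w k)) * hnorm (B'_ n (v k) - B' (v k)).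
    apply: ler_sum => k _; rewrite mulrC ler_wpM2r ?hnorm_ge0 //; exact: (ba_bnd hA).
  have e3 : a * b * d1 + ((a + a) * b * d1 + a * (b + b) * d1) = 5 * (d / 8).
    by rewrite /d1; field; rewrite !gt_eqF.
  rewrite e3; move: hu e1 e2; rewrite /u; lra.
move=> x /=; rewrite /T0.
have AS : A_ n (\sum_(k < K) dot (B_ n x) (v k) *: w k) =
   \sum_(k < K) dot x (B'_ n (v k)) *: A_ n (w k).
  rewrite (linear_op_sum _ _ _ (ba_lin hAn)); apply: eq_bigr => k _.
  by rewrite (linear_opZ _ _ (ba_lin hAn)) (ba_adj hBn).
have AS' y : A (\sum_(k < K) dot y (v k) *: w k) = \sum_(k < K) dot y (v k) *: A (w k).
  rewrite (linear_op_sum _ _ _ (ba_lin hA)); apply: eq_bigr => k _.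
  by rewrite (linear_opZ _ _ (ba_lin hA)).
rewrite !(linear_opB _ _ (ba_lin hAn)) !(linear_opB _ _ (ba_lin hA)).
rewrite !(linear_opB _ _ lT) AS !AS'.
have -> : \sum_(k < K) dot x (B'_ n (v k)) *: (A_ n (w k) - A (w k)) =
  \sum_(k < K) dot x (B'_ n (v k)) *: A_ n (w k) - \sum_(k < K) dot x (B'_ n (v k)) *: A (w k).
  by rewrite -sumrB; apply: eq_bigr => k _; rewrite scalerBr.
have -> : \sum_(k < K) dot x (B'_ n (v k) - B' (v k)) *: A (w k) =
  \sum_(k < K) dot x (B'_ n (v k)) *: A (w k) - \sum_(k < K) dot (B x) (v k) *: A (w k).
  by rewrite -sumrB; apply: eq_bigr => k _; rewrite dotBr scalerBl (ba_adj hB).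
have -> : \sum_(k < K) dot (B_ n x - B x) (v k) *: A (w k) =
  \sum_(k < K) dot x (B'_ n (v k)) *: A (w k) - \sum_(k < K) dot (B x) (v k) *: A (w k).
  by rewrite -sumrB; apply: eq_bigr => k _; rewrite dotBl scalerBl (ba_adj hBn).
have -> : \sum_(k < K) dot (B_ n x) (v k) *: A (w k) =
  \sum_(k < K) dot x (B'_ n (v k)) *: A (w k).
  by apply: eq_bigr => k _; rewrite (ba_adj hBn).
rewrite (linear_opB _ _ (ba_lin hA)).
by apply: (dot_inj dot_norm) => y; rewrite !dotE; ring.
Qed.

End StrongConvergence.

(** * Decay of Fourier coefficients *)

Section SmoothFunctions.
Variable R : realType.
Implicit Types (f g : R -> R) (t : R).

(** Finite order gives the product rule an induction: differentiating once lowers the order by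
    one. *)
Definition smooth_upto n g : Prop :=
  forall k, (k <= n)%N -> forall t, derivable (derive1n k g) t 1.

Lemma smooth_uptoS n g : smooth_upto n.+1 g <->
  (forall t, derivable g t 1) /\ smooth_upto n (derive1 g).
Proof.
split=> [h|[h0 h]].
  split=> [|k kn t]; first exact: (h 0%N).
  by rewrite -derive1Sn; exact: h.
by move=> [|k] kn t //; rewrite derive1Sn; exact: h.
Qed.

Lemma smooth_upto_le n g : smooth_upto n.+1 g -> smooth_upto n g.
Proof. by move=> h k kn; apply: h; exact: leqW. Qed.

Lemma derive1D f g : (forall t, derivable f t 1) -> (forall t, derivable g t 1) ->
  derive1 (fun t => f t + g t) = (fun t => derive1 f t + derive1 g t).
Proof. by move=> hf hg; apply/funext => t; rewrite !derive1E deriveD. Qed.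

Lemma derive1M f g : (forall t, derivable f t 1) -> (forall t, derivable g t 1) ->
  derive1 (fun t => f t * g t) = (fun t => f t * derive1 g t + g t * derive1 f t).
Proof. by move=> hf hg; apply/funext => t; rewrite !derive1E deriveM. Qed.

Lemma smooth_upto_add n f g : smooth_upto n f -> smooth_upto n g ->
  smooth_upto n (fun t => f t + g t).
Proof.
elim: n f g => [|n IH] f g hf hg.
  move=> k; rewrite leqn0 => /eqP -> t; apply: derivableD; [exact: hf 0%N _ _|exact: hg 0%N _ _].
have [f0 f1] := (smooth_uptoS n f).1 hf; have [g0 g1] := (smooth_uptoS n g).1 hg.
apply/smooth_uptoS; split=> [t|]; first exact: derivableD.
by rewrite (derive1D f0 g0); exact: IH.
Qed.

Lemma smooth_upto_mul n f g : smooth_upto n f -> smooth_upto n g ->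
  smooth_upto n (fun t => f t * g t).
Proof.
elim: n f g => [|n IH] f g hf hg.
  move=> k; rewrite leqn0 => /eqP -> t; apply: derivableM; [exact: hf 0%N _ _|exact: hg 0%N _ _].
have [f0 f1] := (smooth_uptoS n f).1 hf; have [g0 g1] := (smooth_uptoS n g).1 hg.
apply/smooth_uptoS; split=> [t|]; first exact: derivableM.
rewrite (derive1M f0 g0); apply: smooth_upto_add; apply: IH.
- exact: smooth_upto_le.
- exact: g1.
- exact: smooth_upto_le.
- exact: f1.
Qed.

Lemma smoothP g : smooth g <-> forall n, smooth_upto n g.
Proof. by split=> [h n k _|h k t]; [exact: h|exact: (h k k)]. Qed.

Lemma smooth_mul f g : smooth f -> smooth g -> smooth (fun t => f t * g t).
Proof. by move=> /smoothP hf /smoothP hg; apply/smoothP => n; exact: smooth_upto_mul. Qed.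

Lemma smooth_add f g : smooth f -> smooth g -> smooth (fun t => f t + g t).
Proof. by move=> /smoothP hf /smoothP hg; apply/smoothP => n; exact: smooth_upto_add. Qed.

Lemma smooth_cst (c : R) : smooth (fun=> c).
Proof.
have cst : forall (k : nat) c, exists d, derive1n k (fun=> c : R) = (fun=> d) :> (R -> R).
  elim=> [|k IH] d; first by exists d.
  rewrite derive1Sn.
  have -> : derive1 (fun=> d : R) = (fun=> 0) :> (R -> R) by apply/funext => t; rewrite derive1_cst.
  exact: IH.
by move=> k t; have [d ->] := cst k c; exact: derivable_cst.
Qed.

Lemma smooth_id : smooth (fun t : R => t).
Proof.
apply/smoothP => n; case: n => [k|n].
  by rewrite leqn0 => /eqP -> t; exact: derivable_id.
apply/smooth_uptoS; split=> [t|]; first exact: derivable_id.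
have -> : derive1 (fun t : R => t) = (fun=> 1).
  by apply/funext => t; rewrite derive1_id.
exact: ((smoothP _).1 (@smooth_cst 1) n).
Qed.

Lemma smooth_derive g : smooth g -> smooth (derive1 g).
Proof. by move=> h k t; rewrite -derive1Sn; exact: h. Qed.

Definition test_function g : Prop :=
  smooth g /\ exists L : R, forall t, L <= `|t| -> g t = 0.

Lemma test_mul f g : smooth f -> test_function g -> test_function (fun t => f t * g t).
Proof.
move=> sf [sg [L hL]]; split; first exact: smooth_mul.
by exists L => t /hL ->; rewrite mulr0.
Qed.

Lemma test_add f g : test_function f -> test_function g ->
  test_function (fun t => f t + g t).
Proof.
move=> [sf [L hL]] [sg [L' hL']]; split; first exact: smooth_add.
exists (Num.max L L') => t; rewrite ge_max => /andP[/hL -> /hL' ->].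
by rewrite addr0.
Qed.

Lemma test_derive g : test_function g -> test_function (derive1 g).
Proof.
move=> [sg [L hL]]; split; first exact: smooth_derive.
exists (L + 1) => t ht; rewrite derive1E.
rewrite (@near_eq_derive _ _ _ g (fun=> 0)) ?derive_cst //.
apply/nbhs_ballP; exists 1 => //= s hs; apply: hL.
have : `|t| <= `|s| + `|t - s| by rewrite -{1}(subrKC s t) ler_normD.
by move: hs; rewrite /ball /=; lra.
Qed.

Lemma test_vanishing g : test_function g -> vanishing_eps (fun t => (g t)%:C).
Proof.
move=> [sg [L hL]]; split=> [t e e0|e e0].
  have cg : {for t, continuous g}.
    by apply: differentiable_continuous; apply/derivable1_diffP; exact: (sg 0%N t).
  have /cvgrPdist_le /(_ _ e0) := cg; case/nbhs_ballP => d d0 hd; rewrite /= in d0.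
  exists (d / 2); split=> [|s hs]; first exact: divr_gt0.
  rewrite -(rmorphB (real_complex R)) normcR distrC; apply: hd; rewrite /ball /= distrC.
  by apply: le_lt_trans hs _; rewrite ltr_pdivrMr // mulr_natr mulr2n ltrDl.
by exists L => t /hL ->; rewrite normc0 ltW.
Qed.

Lemma test_bounded g : test_function g -> exists C : R, forall t, `|g t| <= C.
Proof.
by move=> /test_vanishing /vanishing_bounded [B hB]; exists B => t; rewrite -normcR.
Qed.

(* [hat g] is [g] transported to the unit circle by
   [exp (2 i theta) = cayf z (x0 + y0 cot theta)], [z = x0 + i y0]. *)
Variables (x0 y0 : R).
Hypothesis y0n : y0 != 0.

Definition hat g (a : R) : R :=
  if sin a == 0 then 0 else g (x0 + y0 * (cos a / sin a)).

(** Differentiation in the angle, expressed in the coordinate t = x0 + y0 cot(theta). It preserves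
    test functions, so it can be iterated. *)
Definition angular g t : R := - y0^-1 * ((t - x0) ^+ 2 + y0 ^+ 2) * derive1 g t.

Lemma test_angular g : test_function g -> test_function (angular g).
Proof.
move=> tg; apply: test_mul; last exact: test_derive.
apply: smooth_mul; first exact: smooth_cst.
apply: smooth_add; last exact: smooth_cst.
have -> : (fun t => (t - x0) ^+ 2) = (fun t => (t + - x0) * (t + - x0)).
  by apply/funext => t; rewrite expr2.
by apply: smooth_mul; apply: smooth_add; [exact: smooth_id|exact: smooth_cst|exact: smooth_id|exact: smooth_cst].
Qed.

(** Where the sine vanishes, the cotangent is so large nearby that its argument leaves the support,
    and [hat g] is locally zero. Elsewhere this is the chain rule. *)
Lemma hat_derive g (a : R) : test_function g ->
  is_derive a (1 : R) (hat g) (hat (angular g) a).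
Proof.
move=> tg; have [sg [L hL]] := tg.
have csin : {for a, continuous (@sin R)} by exact: continuous_sin.
have [sa|sa] := eqVneq (sin a) 0.
  have -> : hat (angular g) a = 0 by rewrite /hat sa eqxx.
  have d0 : is_derive a (1 : R) (cst (0 : R)) (0 : R) := is_derive_cst _ _ _.
  apply: near_eq_is_derive d0.
  pose M := `|L| + `|x0| + 1.
  have M0 : 0 < M by rewrite ltr_wpDl // addr_ge0.
  have ay : 0 < `|y0| by rewrite normr_gt0.
  have eta0 : 0 < `|y0| / (2 * M) by rewrite divr_gt0 // mulr_gt0.
  have /cvgrPdist_lt /(_ _ eta0) h1 := csin.
  have ca : `|cos a| = 1.
    have := cos2Dsin2 a; rewrite sa expr0n addr0 => c2.
    by apply/eqP; rewrite -(@eqrXn2 _ 2) // real_normK ?num_real // c2 expr1n.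
  have half : 0 < 2^-1 :> R by rewrite invr_gt0.
  have ccos : {for a, continuous (@cos R)} by exact: continuous_cos.
  have /cvgrPdist_lt /(_ _ half) h2 := ccos.
  near=> b; rewrite /hat; case: eqP => // /eqP sb; apply/esym/hL.
  have b1 : `|sin b| < `|y0| / (2 * M).
    by have : `|sin a - sin b| < `|y0| / (2 * M); [near: b|rewrite sa sub0r normrN].
  have b2 : 2^-1 <= `|cos b|.
    have : `|cos a - cos b| < 2^-1 by near: b.
    have := ler_normD (cos a - cos b) (cos b); rewrite subrK ca; lra.
  have sbp : 0 < `|sin b| by rewrite normr_gt0.
  have big : M <= `|y0 * (cos b / sin b)|.
    rewrite !normrM normfV mulrA ler_pdivlMr //.
    apply: (@le_trans _ _ (`|y0| * 2^-1)); last by rewrite ler_pM2l.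
    move: b1; rewrite ltr_pdivlMr ?mulr_gt0 // => /ltW; rewrite ler_pdivlMr //; lra.
  have := ler_normD (x0 + y0 * (cos b / sin b)) (- x0).
  rewrite addrAC subrr add0r normrN; have := ler_norm L; move: big; rewrite /M; lra.
have -> : hat (angular g) a = derive1 g (x0 + y0 * (cos a / sin a)) * (- y0 * (sin a) ^- 2).
  rewrite /hat (negbTE sa) /angular addrAC subrr add0r mulrC; congr (_ * _).
  have := cos2Dsin2 a => c2.
  have -> : (y0 * (cos a / sin a)) ^+ 2 + y0 ^+ 2 =
    y0 ^+ 2 * (cos a ^+ 2 + sin a ^+ 2) * (sin a) ^- 2 by field.
  by rewrite c2; field; rewrite sa y0n.
apply: (@near_eq_is_derive _ _ _ (g \o (fun b => x0 + y0 * (cos b / sin b)))).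
  have s0 : 0 < `|sin a| by rewrite normr_gt0.
  have /cvgrPdist_lt /(_ _ s0) h1 := csin.
  near=> b; rewrite /hat /= ifN //.
  have : `|sin a - sin b| < `|sin a| by near: b.
  by apply: contraTneq => ->; rewrite subr0 ltxx.
apply: is_derive1_comp.
  by rewrite derive1E; apply: DeriveDef => //; exact: (sg 0%N).
have dV : is_derive a (1 : R) (fun b => (sin b)^-1) (- (sin a) ^- 2 *: cos a).
  exact: is_deriveV.
have dM := is_deriveM (is_derive_cos a) dV.
have dc : is_derive a (1 : R) (fun b => x0 + y0 * (cos b / sin b))
   (0 + (y0 *: (cos a *: (- (sin a) ^- 2 *: cos a) + (sin a)^-1 *: - sin a))).
  by apply: is_deriveD; apply: is_deriveZ.
apply: is_derive_eq dc _.
rewrite add0r /GRing.scale /=.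
have -> : - y0 * (sin a) ^- 2 = - y0 * (sin a) ^- 2 * (cos a ^+ 2 + sin a ^+ 2).
  by rewrite cos2Dsin2 mulr1.
by field.
Unshelve. all: by end_near.
Qed.

Definition fdiff (h : R) g (a : R) : R := g (a + h) - g a.

Lemma fdiff_derive h g g' (a : R) : (forall a : R, is_derive a (1 : R) g (g' a)) ->
  is_derive a (1 : R) (fdiff h g) (fdiff h g' a).
Proof.
move=> dg; apply: is_deriveB => //.
have -> : g' (a + h) = g' (a + h) * 1 by rewrite mulr1.
apply: (@is_derive1_comp _ g (fun b => b + h)) => //.
rewrite -[1 in X in is_derive _ _ _ X]addr0.
by apply: is_deriveD.
Qed.

Lemma fdiff_le h g g' (C a : R) : 0 <= h -> (forall a : R, is_derive a (1 : R) g (g' a)) ->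
  (forall a, `|g' a| <= C) -> `|fdiff h g a| <= C * h.
Proof.
move=> h0 dg hC; rewrite /fdiff.
have ah : a <= a + h by rewrite lerDl.
have [|b _ ->] := MVT_segment ah (fun x _ => dg x).
  apply: continuous_subspaceT => x; apply: differentiable_continuous.
  by apply/derivable1_diffP; case: (dg x).
by rewrite addrAC subrr add0r normrM (ger0_norm h0) ler_wpM2r.
Qed.

Lemma iter_fdiff_derive j h g (a : R) : test_function g ->
  is_derive a (1 : R) (iter j (fdiff h) (hat g)) (iter j (fdiff h) (hat (angular g)) a).
Proof.
move=> tg; elim: j a => [|j IH] a; first exact: hat_derive.
exact: fdiff_derive.
Qed.

(** By the mean value theorem each difference is exchanged for a factor [h] and one application of
    [angular]; [C] serves every step size. *)
Lemma iter_fdiff_le j g : test_function g -> exists C : R, forall h a, 0 <= h ->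
  `|iter j (fdiff h) (hat g) a| <= C * h ^+ j.
Proof.
elim: j g => [|j IH] g tg.
  have [C hC] := test_bounded tg; exists C => h a _; rewrite expr0 mulr1 /= /hat.
  by case: ifP => _; rewrite ?normr0 //; apply: le_trans (hC 0).
have [C hC] := IH _ (test_angular tg); exists C => h a h0.
rewrite exprSr mulrA.
exact: (fdiff_le a h0 (fun b => iter_fdiff_derive j h b tg) (fun b => hC h b h0)).
Qed.

Lemma hat_pi g a : hat g (a + pi) = hat g a.
Proof. by rewrite /hat sinDpi cosDpi oppr_eq0 invrN mulrNN. Qed.

End SmoothFunctions.

(** * Discrete Fourier coefficients of transported test functions *)

Section FourierDecay.
Variable R : realType.
Variable z : R[i].
Hypothesis zr : z \isn't Num.real.
Variable f : R -> R[i].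
Hypothesis tf_re : test_function (fun t => complex.Re (f t)).
Hypothesis tf_im : test_function (fun t => complex.Im (f t)).

Local Notation x0 := (complex.Re z).
Local Notation y0 := (complex.Im z).

Let y0n : y0 != 0. Proof. by rewrite -nonrealE. Qed.

Definition chat (a : R) : R[i] :=
  hat x0 y0 (fun t => complex.Re (f t)) a +i* hat x0 y0 (fun t => complex.Im (f t)) a.

(** The factorization exp(2ia) - 1 = 2 i sin(a) exp(ia) turns [invcay] into x0 + y0 cot(a), and
    locates the point 1 at the zeros of the sine. *)
Lemma circ_expi (a : R) : circ z f (expi (2 * a)) = chat a.
Proof.
have E : expi (2 * a) - 1 = (2 * sin a)%:C * ((- sin a) +i* cos a).
  rewrite /expi mulr_natl cos_mulr2n cos2sin2 sin_mulr2n !mulr2n.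
  by apply/eqP; rewrite eq_complex /=; apply/andP; split; apply/eqP; ring.
have nz : (- sin a) +i* cos a != 0.
  apply/eqP => -[/eqP]; rewrite oppr_eq0 => /eqP s c.
  by have := cos2Dsin2 a; rewrite s c expr0n addr0 => /eqP; rewrite eq_sym oner_eq0.
rewrite /circ -subr_eq0 E mulf_eq0 (negbTE nz) orbF (fmorph_eq0 (real_complex R)).
rewrite mulf_eq0 pnatr_eq0 /= /chat /hat.
case: eqVneq => [_|sa]; first by [].
suff -> : invcay z (expi (2 * a)) = x0 + y0 * (cos a / sin a) by case: (f _).
rewrite /invcay E.
have -> : (z - conjc z) / ((2 * sin a)%:C * ((- sin a) +i* cos a)) =
  (y0 / sin a)%:C * (cos a -i* sin a).
  have h1 : (2 * sin a)%:C != 0.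
    by rewrite (fmorph_eq0 (real_complex R)) mulf_neq0 ?pnatr_eq0.
  apply: (mulIf (mulf_neq0 h1 nz)); rewrite divfK ?mulf_neq0 //.
  case: (z) => p q /=; rewrite /real_complex_def; 
  have c2 := cos2Dsin2 a; apply/eqP; rewrite eq_complex /=; apply/andP; split; apply/eqP.
    by field.
  transitivity (2 * q * (cos a ^+ 2 + sin a ^+ 2)); first by rewrite c2; ring.
  by field.
by rewrite ReD ReM_real /= mulrA mulrAC.
Qed.

Definition cdiff (h : R) (F : R -> R[i]) a := F (a + h) - F a.

Lemma iter_cdiff_le j : exists C : R, 0 <= C /\ forall h a, 0 <= h ->
  normc (iter j (cdiff h) chat a) <= C * h ^+ j.
Proof.
have [C1 h1] := iter_fdiff_le x0 y0n j tf_re.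
have [C2 h2] := iter_fdiff_le x0 y0n j tf_im.
have C10 : 0 <= C1 by have := h1 1 0 ler01; rewrite expr1n mulr1; exact: le_trans.
have C20 : 0 <= C2 by have := h2 1 0 ler01; rewrite expr1n mulr1; exact: le_trans.
exists (C1 + C2); split=> [|h a h0]; first exact: addr_ge0.
have -> : iter j (cdiff h) chat a =
  iter j (fdiff h) (hat x0 y0 (fun t => complex.Re (f t))) a +i*
  iter j (fdiff h) (hat x0 y0 (fun t => complex.Im (f t))) a.
  elim: j a {h1 h2} => [//|j IH] a.
  by rewrite !iterS /cdiff !IH /fdiff; simpc.
by apply: le_trans (normc_le_ReIm _) _; rewrite mulrDl lerD ?h1 ?h2.
Qed.

Lemma iter_cdiff_pi j h a : iter j (cdiff h) chat (a + pi) = iter j (cdiff h) chat a.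
Proof.
elim: j a => [|j IH] a; first by rewrite /= /chat !hat_pi.
by rewrite !iterS /cdiff addrAC !IH.
Qed.

Lemma sum_periodic M (F : nat -> R[i]) : F M = F 0%N ->
  \sum_(q < M) F q.+1 = \sum_(q < M) F q.
Proof.
move=> FM; have : \sum_(q < M.+1) F q = \sum_(q < M.+1) F q by [].
rewrite {1}big_ord_recl big_ord_recr /= FM [RHS]addrC; exact: addrI.
Qed.

(** Summation by parts on a periodic grid: there are no boundary terms, and one difference
    multiplies the transform by [conjc w - 1]. *)
Lemma sum_cdiff M (F : R -> R[i]) w : (0 < M)%N -> (forall a, F (a + pi) = F a) ->
  w ^+ M = 1 -> normc w = 1 ->
  \sum_(q < M) cdiff (pi / M%:R) F (pi / M%:R * q%:R) * w ^+ q =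
   (conjc w - 1) * \sum_(q < M) F (pi / M%:R * q%:R) * w ^+ q.
Proof.
move=> M0 Fpi wM w1; set h := pi / M%:R.
pose G q := F (h * q%:R) * w ^+ q.
have GM : G M = G 0%N.
  rewrite /G wM expr0 /h divfK ?pnatr_eq0 -?lt0n // mulr0.
  by rewrite -{1}[pi]add0r Fpi.
rewrite mulrBl mul1r -{1}(sum_periodic GM) mulr_sumr -sumrB.
apply: eq_bigr => q _; rewrite /cdiff /G mulrBl; congr (_ - _).
rewrite -natr1 mulrDr mulr1 exprS mulrCA (mulrA (conjc w)) (mulrC (conjc w)).
by rewrite mulrJ_circle // mul1r.
Qed.

Lemma sin_ge_half (x : R) : 0 <= x -> x <= pi / 4 -> x <= 2 * sin x.
Proof.
move=> x0' x1.
have [|c hc] := @MVT_segment R (@sin R) (@cos R) 0 x x0' (fun y _ => is_derive_sin y).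
  by apply: continuous_subspaceT => y; exact: continuous_sin.
rewrite sin0 !subr0 => ->; rewrite mulrA -{1}[x]mul1r ler_wpM2r //.
move: hc; rewrite in_itv /= => /andP[c0 cx].
have pi0 := pi_gt0 R.
have cc : 0 <= cos c by apply: cos_ge0_pihalf; lra.
have : 0 <= cos (c *+ 2) by apply: cos_ge0_pihalf; rewrite (mulr2n c); lra.
rewrite cos_mulr2n mulr2n => h2.
rewrite leNgt; apply/negP => lt1.
have : (2 * cos c) ^+ 2 < 1.
  by rewrite expr2 mulr_ilte1 // ?mulr_ge0.
rewrite exprMn; lra.
Qed.

(** The chord is 2 sin(x) with x = pi k / M. The condition [4 * k <= M] keeps x below pi/4, where 2
    sin(x) >= x; this is the origin of the factor 4 between the number of nodes and the degree. *)
Lemma root_unity_dist M k : (0 < M)%N -> (4 * k <= M)%N ->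
  pi / M%:R * k%:R <= normc (root_unity R M ^+ k - 1).
Proof.
move=> M0 kM; have pi0 := pi_gt0 R; set x := pi / M%:R * k%:R.
have Mp : 0 < M%:R :> R by rewrite ltr0n.
have x0' : 0 <= x by rewrite mulr_ge0 ?divr_ge0 // ltW.
have x1 : x <= pi / 4.
  have : (4 * k)%:R <= M%:R :> R by rewrite ler_nat.
  rewrite /x mulrAC ler_pdivrMr // natrM => h.
  rewrite mulrAC -mulrA ler_pM2l //; lra.
have s0 := sin_ge_half x0' x1.
apply: le_trans s0 _.
have sp : 0 <= sin x by have := sin_ge_half x0' x1; lra.
have -> : root_unity R M ^+ k = expi (2 * x).
  by rewrite expiX; congr expi; rewrite /x; field; rewrite gt_eqF.
clearbody x.
rewrite -ler_sqr ?nnegrE ?normc_ge0 ?mulr_ge0 // sqr_normc_ReIm /expi /=.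
have -> : cos (2 * x) = 1 - 2 * sin x ^+ 2.
  by rewrite (mulr_natl x 2) cos_mulr2n cos2sin2 (mulr2n (1 - _)); ring.
have -> : sin (2 * x) = 2 * (cos x * sin x).
  by rewrite (mulr_natl x 2) sin_mulr2n (mulr2n (_ * _)); ring.
have c2 := cos2Dsin2 x.
have -> : (1 - 2 * sin x ^+ 2 - 1) ^+ 2 + (2 * (cos x * sin x) - 0) ^+ 2 =
  4 * sin x ^+ 2 * (cos x ^+ 2 + sin x ^+ 2) by ring.
by rewrite c2 mulr1 exprMn; lra.
Qed.

Lemma circ_root M q : circ z f (root_unity R M ^+ q) = chat (pi / M%:R * q%:R).
Proof.
rewrite expiX -circ_expi; congr (circ z f (expi _)).
by rewrite mulrC -!mulrA.
Qed.

(** Three summations by parts: the third difference is at most C h^3 at each node, while the factor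
    [(conjc w - 1) ^+ 3] is at least (h k)^3 in modulus. The mesh h cancels, so the constant does
    not depend on [M]. *)
Lemma sum_chat_decay : exists C : R, 0 <= C /\ forall M k w, (0 < M)%N ->
  (0 < k)%N -> (4 * k <= M)%N -> w = root_unity R M ^+ k \/ w = conjc (root_unity R M ^+ k) ->
  normc (\sum_(q < M) chat (pi / M%:R * q%:R) * w ^+ q) * k%:R ^+ 3 <= C * M%:R.
Proof.
have [C [C0 hC]] := iter_cdiff_le 3; exists C; split=> // M k w M0 k0 kM hw.
have Mp : 0 < M%:R :> R by rewrite ltr0n.
have w1 : normc w = 1 by case: hw => ->; rewrite ?normc_conj normc_root.
have wM : w ^+ M = 1.
  have h : (root_unity R M ^+ k) ^+ M = 1 by rewrite exprAC root_unity_exp // expr1n.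
  by case: hw => -> //; rewrite -conjcX h conjc1.
have wd : pi / M%:R * k%:R <= normc (conjc w - 1).
  have E : normc (conjc w - 1) = normc (root_unity R M ^+ k - 1).
    case: hw => ->; last by rewrite conjcK.
    by rewrite -normc_conj conjcB conjcK conjc1.
  by rewrite E; exact: root_unity_dist.
set h := pi / M%:R; have h0 : 0 < h by rewrite divr_gt0 // pi_gt0.
set S := \sum_(q < M) _.
have E : \sum_(q < M) iter 3 (cdiff h) chat (h * q%:R) * w ^+ q = (conjc w - 1) ^+ 3 * S.
  rewrite iterS sum_cdiff //; last by move=> a; exact: iter_cdiff_pi.
  rewrite iterS sum_cdiff //; last by move=> a; exact: iter_cdiff_pi.
  rewrite iterS sum_cdiff //; last by move=> a; exact: (iter_cdiff_pi 0).
  by rewrite /S /=; ring.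
have ub : normc ((conjc w - 1) ^+ 3 * S) <= C * h ^+ 3 * M%:R.
  rewrite -E; apply: le_trans (normc_sum _ _ _) _.
  rewrite mulr_natr -[in leRHS](card_ord M) -sumr_const; apply: ler_sum => q _.
  by rewrite normcM normcX w1 expr1n mulr1 hC // ltW.
have lb : (h * k%:R) ^+ 3 * normc S <= normc ((conjc w - 1) ^+ 3 * S).
  rewrite normcM normcX; apply: ler_wpM2r; first exact: normc_ge0.
  by rewrite lerXn2r // nnegrE ?normc_ge0 // mulr_ge0 // ltW.
have := le_trans lb ub.
have -> : (h * k%:R) ^+ 3 * normc S = h ^+ 3 * (normc S * k%:R ^+ 3) by ring.
have -> : C * h ^+ 3 * M%:R = h ^+ 3 * (C * M%:R) by ring.
by rewrite ler_pM2l // exprn_gt0.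
Qed.

Lemma fcoef_decay : exists C : R, 0 <= C /\ forall M j l, (0 < M)%N ->
  (4 * j <= M)%N -> (4 * l <= M)%N -> j != l ->
  normc (fcoef (circ z f) M j l) * ((j - l) + (l - j))%N%:R ^+ 3 <= C.
Proof.
have [C [C0 hC]] := sum_chat_decay; exists C; split=> // M j l M0 jM lM jl.
have Mp : 0 < M%:R :> R by rewrite ltr0n.
set w := root_unity R M.
have cw (q : nat) : conjc (w ^+ q) * w ^+ q = 1 by rewrite mulrC mulrJ_circle // normc_root.
rewrite /fcoef normcM normcV normc_nat -mulrA mulrC ler_pdivrMr //.
move: jl; rewrite neq_ltn => /orP[lt|lt].
  have -> : (j - l + (l - j) = l - j)%N by move/ltnW: lt; rewrite -subn_eq0 => /eqP ->.
  have := hC M (l - j)%N (w ^+ (l - j)) M0; rewrite subn_gt0 lt.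
  have lM' : (4 * (l - j) <= M)%N by apply: leq_trans lM; rewrite leq_mul2l leq_subr orbT.
  move=> /(_ isT lM' (or_introl erefl)); apply: le_trans.
  rewrite le_eqVlt; apply/orP; left; apply/eqP; congr (normc _ * _).
  apply: eq_bigr => q _; rewrite circ_root; congr (_ * _).
  rewrite -{1}(subnKC (ltnW lt)) exprD mulrA -exprMn cw expr1n mul1r.
  by rewrite -!exprM mulnC.
have -> : (j - l + (l - j) = j - l)%N.
  by move/ltnW: lt; rewrite -(subn_eq0 l) => /eqP ->; rewrite addn0.
have := hC M (j - l)%N (conjc (w ^+ (j - l))) M0; rewrite subn_gt0 lt.
have jM' : (4 * (j - l) <= M)%N by apply: leq_trans jM; rewrite leq_mul2l leq_subr orbT.
move=> /(_ isT jM' (or_intror erefl)); apply: le_trans.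
rewrite le_eqVlt; apply/orP; left; apply/eqP; congr (normc _ * _).
apply: eq_bigr => q _; rewrite circ_root; congr (_ * _).
rewrite -{1}(subnK (ltnW lt)) exprD -mulrA -exprMn cw expr1n mulr1.
by rewrite -!conjcX -!exprM mulnC.
Qed.

End FourierDecay.

(** * Telescoping powers of Cayley transforms *)

Section PowerDifferences.
Variables (R : realType) (H : completeNormedModType R[i]).
Variable dot : {dot H for Num.conj}.
Hypothesis dot_norm : forall x : H, `|x| ^+ 2 = dot x x.
Variables (z : R[i]) (m : nat).
Hypothesis zr : z \isn't Num.real.
Implicit Types (A : operator H) (w : R[i]) (T : H -> H).

Let zr' : conjc z \isn't Num.real. Proof. by rewrite nonreal_conj. Qed.

Lemma resolvent_pow_linear A w j : self_adjoint dot A -> w \isn't Num.real ->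
  linear (resolvent_pow A w j).
Proof. by move=> saA wr; apply: iter_linear; exact: (resolvent_linear dot_norm saA wr). Qed.

Lemma resolvent_pow_bound A w j : self_adjoint dot A -> w \isn't Num.real ->
  opbound (resolvent_pow A w j) (`|complex.Im w|^-1 ^+ j).
Proof.
move=> saA wr x; elim: j => [|j IH]; first by rewrite expr0 mul1r.
rewrite /resolvent_pow iterS; apply: le_trans (resolvent_bound dot_norm saA _ wr) _.
by rewrite exprS -mulrA ler_wpM2l ?invr_ge0.
Qed.

Lemma resolvent_pow_cayley A w j x : self_adjoint dot A -> w \isn't Num.real ->
  resolvent_pow A z j (cayley A w x) = cayley A w (resolvent_pow A z j x).
Proof.
move=> saA wr; have lR := resolvent_linear dot_norm saA zr.
elim: j => [//|j IH]; rewrite /resolvent_pow iterS -/(resolvent_pow A z j) IH.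
by rewrite /cayley (linear_opD _ _ lR) (linear_opZ _ _ lR) (resolventC dot_norm saA _ zr wr).
Qed.

Definition rdiff A1 A2 : H -> H :=
  resolvent_pow A1 z m \o (resolvent A2 z \- resolvent A1 z).

Definition wdiff w A1 A2 k (x : H) : H :=
  resolvent_pow A1 z m (iter k (cayley A2 w) x - iter k (cayley A1 w) x).

(** U_2^{k+1} - U_1^{k+1} = U_1 (U_2^k - U_1^k) + (U_2 - U_1) U_2^k, and R_1^m commutes with U_1. *)
Lemma wdiffS A1 A2 k x : self_adjoint dot A1 -> self_adjoint dot A2 ->
  wdiff z A1 A2 k.+1 x = cayley A1 z (wdiff z A1 A2 k x) +
    (z - conjc z) *: rdiff A1 A2 (iter k (cayley A2 z) x).
Proof.
move=> sa1 sa2; have l1 := resolvent_linear dot_norm sa1 zr.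
have lm := resolvent_pow_linear m sa1 zr.
rewrite /wdiff -resolvent_pow_cayley // /rdiff /= -(linear_opZ _ _ lm) -(linear_opD _ _ lm).
congr resolvent_pow; rewrite /cayley (linear_opB _ _ l1).
by apply: (dot_inj dot_norm) => v; rewrite !dotE; ring.
Qed.

(** For the inverses V_j, writing V_2 - V_1 = - V_1 (U_2 - U_1) V_2 brings back the resolvents at
    [z], where [rdiff] is controlled. Hence the extra factor V_1 in front and the power [k.+1]
    inside. *)
Lemma wdiffS_conj A1 A2 k x : self_adjoint dot A1 -> self_adjoint dot A2 ->
  wdiff (conjc z) A1 A2 k.+1 x = cayley A1 (conjc z) (wdiff (conjc z) A1 A2 k x -
    (z - conjc z) *: rdiff A1 A2 (iter k.+1 (cayley A2 (conjc z)) x)).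
Proof.
move=> sa1 sa2; have l1 := cayley_linear dot_norm sa1 zr'.
have lm := resolvent_pow_linear m sa1 zr.
rewrite /wdiff /rdiff [(_ \o _) _]/= -(linear_opZ _ _ lm) -(linear_opB _ _ lm).
rewrite -resolvent_pow_cayley //; congr resolvent_pow.
rewrite 2![iter k.+1 _ _]iterS.
set y := iter k _ x; set y' := iter k _ x.
have -> : y - y' - (z - conjc z) *: (resolvent A2 z (cayley A2 (conjc z) y) -
    resolvent A1 z (cayley A2 (conjc z) y)) = cayley A1 z (cayley A2 (conjc z) y) - y'.
  rewrite -{1}(cayleyUV dot_norm sa2 zr y) /(cayley _ z).
  by apply: (dot_inj dot_norm) => v; rewrite !dotE; ring.
by rewrite (linear_opB _ _ l1) (cayleyVU dot_norm sa1 zr).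
Qed.

Lemma rdiff_linear A1 A2 : self_adjoint dot A1 -> self_adjoint dot A2 ->
  linear (rdiff A1 A2).
Proof.
move=> sa1 sa2; apply: linear_op_comp; first exact: resolvent_pow_linear.
by apply: (linear_op_sub dot_norm); exact: (resolvent_linear dot_norm _ zr).
Qed.

Lemma wdiff_linear w A1 A2 k : w \isn't Num.real -> self_adjoint dot A1 ->
  self_adjoint dot A2 -> linear (wdiff w A1 A2 k).
Proof.
move=> wr sa1 sa2; apply: (@linear_op_comp _ _ _ (_ \- _)); first exact: resolvent_pow_linear.
by apply: (linear_op_sub dot_norm); apply: iter_linear; exact: (cayley_linear dot_norm _ wr).
Qed.

Lemma ba_cayley A w : self_adjoint dot A -> w \isn't Num.real ->
  bounded_adjoint dot (cayley A w) (cayley A (conjc w)) 1.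
Proof.
move=> saA wr; have wr' : conjc w \isn't Num.real by rewrite nonreal_conj.
split.
- exact: (cayley_linear dot_norm saA wr).
- exact: (cayley_linear dot_norm saA wr').
- by move=> x y; exact: (cayley_adjoint dot_norm saA _ _ wr).
- by move=> x; rewrite mul1r (hnorm_cayley dot_norm saA _ wr).
- by move=> x; rewrite mul1r (hnorm_cayley dot_norm saA _ wr').
Qed.

Lemma ba_iter T T' k : bounded_adjoint dot T T' 1 ->
  bounded_adjoint dot (iter k T) (iter k T') 1.
Proof.
move=> hT; elim: k => [|k IH]; first exact: ba_id.
have -> : iter k.+1 T' = iter k T' \o T' by apply/funext => x; rewrite iterSr.
exact: (ba_comp hT IH).
Qed.

Lemma totally_bounded_wdiff A1 A2 k : self_adjoint dot A1 -> self_adjoint dot A2 ->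
  totally_bounded_op (rdiff A1 A2) ->
  totally_bounded_op (wdiff z A1 A2 k) /\ totally_bounded_op (wdiff (conjc z) A1 A2 k).
Proof.
move=> sa1 sa2 tb.
have lZ := rdiff_linear sa1 sa2; have lm := resolvent_pow_linear m sa1 zr.
have ba w j : w \isn't Num.real -> 
    bounded_adjoint dot (iter j (cayley A2 w)) (iter j (cayley A2 (conjc w))) 1.
  by move=> wr; exact: (ba_iter j (ba_cayley sa2 wr)).
elim: k => [|k [IH IH']].
  have E w : wdiff w A1 A2 0 = fun=> 0.
    by apply/funext => x; rewrite /wdiff /= subrr (linear_op0 lm).
  by rewrite !E; split; exact: totally_bounded_0.
split.
  rewrite (funext (fun x : H => wdiffS k x sa1 sa2)).
  apply: totally_bounded_add.
    by apply: (totally_bounded_compl _ (ba_bnd (ba_cayley sa1 zr)) IH); exact: ba_lin (ba_cayley sa1 zr).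
  by apply: totally_bounded_scale; exact: totally_bounded_compr lZ (ba_bnd (ba z k zr)) tb.
rewrite (funext (fun x : H => wdiffS_conj k x sa1 sa2)).
apply: (totally_bounded_compl _ (ba_bnd (ba_cayley sa1 zr'))).
  exact: ba_lin (ba_cayley sa1 zr').
apply: totally_bounded_sub => //; apply: totally_bounded_scale.
exact: totally_bounded_compr lZ (ba_bnd (ba _ k.+1 zr')) tb.
Qed.

Section SchattenBounds.
Variable p : R.
Hypothesis p1 : 1 <= p.

Lemma schb_ba (A A' B B' T : H -> H) (c : R) : linear T -> bounded_adjoint dot A A' 1 ->
  bounded_adjoint dot B B' 1 -> schb dot p T c -> schb dot p (fun x => A (T (B x))) c.
Proof.
move=> lT hA hB hT.
have := schb_comp p1 ltr01 ltr01 lT (ba_lin hA) (ba_adj hA) (ba_adj hB)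
  (ba_bnd hA) (ba_bnd' hB) hT.
by rewrite !mul1r.
Qed.

Lemma schb_wdiff A1 A2 k C : self_adjoint dot A1 -> self_adjoint dot A2 ->
  schb dot p (rdiff A1 A2) C ->
  schb dot p (wdiff z A1 A2 k) (normc (z - conjc z) * C * k%:R) /\
  schb dot p (wdiff (conjc z) A1 A2 k) (normc (z - conjc z) * C * k%:R).
Proof.
move=> sa1 sa2 hZ.
have lZ := rdiff_linear sa1 sa2; have lm := resolvent_pow_linear m sa1 zr.
have ba w j : w \isn't Num.real -> 
    bounded_adjoint dot (iter j (cayley A2 w)) (iter j (cayley A2 (conjc w))) 1.
  by move=> wr; exact: (ba_iter j (ba_cayley sa2 wr)).
elim: k => [|k [IH IH']].
  have E w : wdiff w A1 A2 0 = fun=> 0.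
    by apply/funext => x; rewrite /wdiff /= subrr (linear_op0 lm).
  by rewrite !E mulr0; split; exact: schb0.
have kE : normc (z - conjc z) * C * k.+1%:R =
  normc (z - conjc z) * C * k%:R + normc (z - conjc z) * C by rewrite -natr1 mulrDr mulr1.
rewrite kE; split.
  rewrite (funext (fun x : H => wdiffS k x sa1 sa2)).
  apply: schb_add => //.
    exact: (schb_ba (wdiff_linear k zr sa1 sa2) (ba_cayley sa1 zr) (ba_id dot) IH).
  by apply: schb_scale => //; exact: (schb_ba lZ (ba_id dot) (ba z k zr) hZ).
rewrite (funext (fun x : H => wdiffS_conj k x sa1 sa2)).
pose S x := wdiff (conjc z) A1 A2 k x - (z - conjc z) *:
  rdiff A1 A2 (iter k.+1 (cayley A2 (conjc z)) x).
apply: (@schb_ba _ _ id id S _ _ (ba_cayley sa1 zr') (ba_id dot)).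
  have -> : S = (fun x => (- (z - conjc z)) *: (rdiff A1 A2 \o iter k.+1 (cayley A2 (conjc z))) x +
      wdiff (conjc z) A1 A2 k x).
    by apply/funext => x; rewrite /S scaleNr addrC.
  apply: (linear_op_lin dot_norm); last exact: wdiff_linear.
  by apply: linear_op_comp => //; exact: ba_lin (ba _ k.+1 zr').
apply: schb_sub => //; apply: schb_scale => //.
exact: (schb_ba lZ (ba_id dot) (ba _ k.+1 zr') hZ).
Qed.

End SchattenBounds.

Definition pdiff A1 A2 j l (x : H) : H := resolvent_pow A1 z m
  (iter j (cayley A2 z) (iter l (cayley A2 (conjc z)) x) -
   iter j (cayley A1 z) (iter l (cayley A1 (conjc z)) x)).

Lemma iter_cayley A j l x : self_adjoint dot A ->
  iter j (cayley A z) (iter l (cayley A (conjc z)) x) =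
  if (l <= j)%N then iter (j - l) (cayley A z) x else iter (l - j) (cayley A (conjc z)) x.
Proof.
move=> saA; have K k y : iter k (cayley A z) (iter k (cayley A (conjc z)) y) = y.
  by elim: k y => [//|k IH] y; rewrite iterSr iterS (cayleyUV dot_norm saA zr) IH.
case: leqP => [lj|/ltnW jl].
  by rewrite -{1}(subnK lj) iterD K.
by rewrite -{1}(subnKC jl) iterD K.
Qed.

Lemma pdiffE A1 A2 j l : self_adjoint dot A1 -> self_adjoint dot A2 ->
  pdiff A1 A2 j l = if (l <= j)%N then wdiff z A1 A2 (j - l)
    else wdiff (conjc z) A1 A2 (l - j).
Proof.
move=> sa1 sa2; apply/funext => x; rewrite /pdiff !iter_cayley //.
by case: ifP.
Qed.

Definition natdist j l : nat := (j - l + (l - j))%N.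

Lemma totally_bounded_pdiff A1 A2 j l : self_adjoint dot A1 -> self_adjoint dot A2 ->
  totally_bounded_op (rdiff A1 A2) -> totally_bounded_op (pdiff A1 A2 j l).
Proof.
move=> sa1 sa2 tb; rewrite pdiffE //.
have [h _] := totally_bounded_wdiff (j - l) sa1 sa2 tb.
by have [_ h'] := totally_bounded_wdiff (l - j) sa1 sa2 tb; case: ifP.
Qed.

Lemma schb_pdiff p A1 A2 j l C : 1 <= p -> self_adjoint dot A1 -> self_adjoint dot A2 ->
  schb dot p (rdiff A1 A2) C ->
  schb dot p (pdiff A1 A2 j l) (normc (z - conjc z) * C * (natdist j l)%:R).
Proof.
move=> p1 sa1 sa2 hZ; rewrite pdiffE // /natdist.
have [h _] := schb_wdiff p1 (j - l) sa1 sa2 hZ.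
have [_ h'] := schb_wdiff p1 (l - j) sa1 sa2 hZ.
case: leqP => [lj|/ltnW jl]; [have e := lj|have e := jl]; move: e; rewrite -subn_eq0 => /eqP ->.
  by rewrite addn0.
by rewrite add0n.
Qed.

Definition fejer_diff G N M A1 A2 (x : H) : H :=
  N%:R^-1 *: \sum_(j < N) \sum_(l < N) fcoef G M j l *: pdiff A1 A2 j l x.

Lemma fejer_diffE G N M A1 A2 x : self_adjoint dot A1 ->
  fejer_diff G N M A1 A2 x =
  resolvent_pow A1 z m (fejer_op A2 z G N M x - fejer_op A1 z G N M x).
Proof.
move=> sa1; have lm := resolvent_pow_linear m sa1 zr.
rewrite /fejer_op -scalerBr (linear_opZ _ _ lm); congr (_ *: _).
rewrite -sumrB (linear_op_sum _ _ _ lm); apply: eq_bigr => j _.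
rewrite -sumrB (linear_op_sum _ _ _ lm); apply: eq_bigr => l _.
by rewrite -scalerBr (linear_opZ _ _ lm).
Qed.

Definition fcdiff g A1 A2 (x : H) : H :=
  resolvent_pow A1 z m (fcalc dot A2 g x - fcalc dot A1 g x).

(** Approximation in operator norm only, which is all that [schb_lim] and [totally_bounded_lim]
    require; [N0] is independent of the operators. *)
Lemma fejer_diff_approx g (e : R) : vanishing_eps g -> 0 < e -> exists N0,
  forall N M A1 A2, (N0 < N)%N -> (N <= M)%N -> self_adjoint dot A1 -> self_adjoint dot A2 ->
  opbound (fcdiff g A1 A2 \- fejer_diff (circ z g) N M A1 A2) e.
Proof.
move=> vg e0; set b : R := `|complex.Im z|^-1 ^+ m.
have b0 : 0 < b by rewrite exprn_gt0 // invr_gt0 normr_gt0 -nonrealE.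
have e1 : 0 < e / (2 * b) by rewrite divr_gt0 // mulr_gt0.
have [N0 hN] := fejer_op_cvg dot_norm zr vg e1.
exists N0 => N M A1 A2 hN0 NM sa1 sa2 x.
have lm := resolvent_pow_linear m sa1 zr.
rewrite [(_ \- _) x]/= /fcdiff fejer_diffE // -(linear_opB _ _ lm).
apply: le_trans (resolvent_pow_bound m sa1 zr _) _; rewrite -/b.
set a2 := fcalc dot A2 g x; set a1 := fcalc dot A1 g x.
set f2 := fejer_op A2 _ _ _ _ _; set f1 := fejer_op A1 _ _ _ _ _.
have -> : a2 - a1 - (f2 - f1) = (a2 - f2) - (a1 - f1).
  by apply: (dot_inj dot_norm) => v; rewrite !dotE; ring.
have h2 : hnorm (a2 - f2) <= e / (2 * b) * hnorm x := hN N M A2 hN0 NM sa2 x.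
have h1 : hnorm (a1 - f1) <= e / (2 * b) * hnorm x := hN N M A1 hN0 NM sa1 x.
have : hnorm (a2 - f2 - (a1 - f1)) <= e / b * hnorm x.
  apply: le_trans (hnormDB _ _) _; apply: le_trans (lerD h2 h1) _.
  by rewrite -mulrDl ler_wpM2r ?hnorm_ge0 // le_eqVlt; apply/orP; left; apply/eqP; field; rewrite gt_eqF.
move=> /(ler_wpM2l (ltW b0)); rewrite mulrA; congr (_ <= _ * _).
by field; rewrite gt_eqF.
Qed.

End PowerDifferences.

(** * Convergence of the Fejer means in Schatten norm *)

Section Weights.
Variable R : realType.
Implicit Types (w : nat -> R) (c d : R).

Lemma sum_nat_le w a N : (forall k, 0 <= w k) -> (a <= N)%N ->
  \sum_(k < a) w k <= \sum_(k < N) w k.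
Proof.
move=> w0 aN; rewrite -!(big_mkord xpredT w) (big_cat_nat (leq0n a) aN) /=.
by rewrite lerDl sumr_ge0.
Qed.

(** For fixed [j] each distance occurs at most twice, once on either side. *)
Lemma sum_natdist w j N : (forall k, 0 <= w k) -> (j < N)%N ->
  \sum_(l < N) w (natdist j l) <= 2 * \sum_(k < N) w k.
Proof.
move=> w0 jN; rewrite -(big_mkord xpredT (fun l => w (natdist j l))).
rewrite (big_cat_nat (leq0n j) (ltnW jN)) /= mulr_natl mulr2n; apply: lerD.
  rewrite big_nat_rev /= add0n big_mkord.
  have -> : \sum_(i < j) w (natdist j (j - i.+1)) = \sum_(i < j) w i.+1.
    apply: eq_bigr => i _; congr w; rewrite /natdist subKn //.
    by rewrite [X in (_ + X)%N](_ : _ = 0)%N ?addn0 //; apply/eqP; rewrite subn_eq0 leq_subr.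
  apply: le_trans (sum_nat_le w0 jN).
  by rewrite [leRHS]big_ord_recl lerDr.
rewrite -{1}[j]add0n big_addn big_mkord.
have -> : \sum_(i < N - j) w (natdist j (i + j)) = \sum_(i < N - j) w i.
  apply: eq_bigr => i _; congr w; rewrite /natdist addnK.
  by rewrite [X in (X + _)%N](_ : _ = 0)%N //; apply/eqP; rewrite subn_eq0 leq_addl.
by apply: sum_nat_le => //; exact: leq_subr.
Qed.

Lemma sum_inv_sq_tail K N : (0 < K)%N ->
  \sum_(k < N) (if (k <= K)%N then 0 else (k%:R ^+ 2)^-1) <= K%:R^-1 :> R.
Proof.
move=> K0.
have h M : \sum_(k < M.+1) (if (k <= K)%N then 0 else (k%:R ^+ 2)^-1) <=
    K%:R^-1 - (maxn M K)%:R^-1 :> R.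
  elim: M => [|M IH]; first by rewrite big_ord_recl big_ord0 /= max0n subrr addr0.
  rewrite big_ord_recr /=; case: (leqP M.+1 K) => MK.
    rewrite addr0; apply: le_trans IH _.
    by rewrite (maxn_idPr (ltnW MK)).
  rewrite ltnS in MK; apply: le_trans (lerD IH (lexx _)) _.
  rewrite (maxn_idPl MK).
  have M0 : 0 < M%:R :> R by rewrite ltr0n; exact: leq_trans MK.
  rewrite -addrA lerD2l -subr_ge0 -natr1.
  have -> : - (M%:R + 1)^-1 - (- M%:R^-1 + ((M%:R + 1) ^+ 2)^-1) =
     (M%:R * (M%:R + 1) ^+ 2)^-1 :> R.
    by field; rewrite !gt_eqF // ltr_wpDl // ltW.
  by rewrite invr_ge0 mulr_ge0 ?exprn_ge0 ?addr_ge0 // ltW.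
case: N => [|N]; first by rewrite big_ord0 invr_ge0.
by apply: le_trans (h N) _; rewrite gerBl invr_ge0.
Qed.

(** Bound for a difference of k-th powers: it vanishes at k = 0, is a small [d] up to [K], where
    convergence is known, and grows linearly beyond, by telescoping. *)
Definition weight K d c (k : nat) : R :=
  if k == 0%N then 0 else if (k <= K)%N then d else c * k%:R.

Lemma weight_ge0 K d c k : 0 <= d -> 0 <= c -> 0 <= weight K d c k.
Proof.
by rewrite /weight => d0 c0; case: eqP => // _; case: ifP => // _; exact: mulr_ge0.
Qed.

(** The bound is free of [N]: the head contributes at most [d] for each of [K] indices, the tail a
    sum of c / k^2 over k > K. *)
Lemma sum_weight K N d c : (0 < K)%N -> 0 <= d -> 0 <= c ->
  \sum_(k < N) weight K d c k / k%:R ^+ 3 <= K%:R * d + c / K%:R.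
Proof.
move=> K0 d0 c0.
have h1 : \sum_(k < N) (if (0 < k <= K)%N then d else 0) <= K%:R * d.
  have h M : \sum_(k < M.+1) (if (0 < k <= K)%N then d else 0) <= (minn M K)%:R * d.
    elim: M => [|M IH]; first by rewrite big_ord_recl big_ord0 /= min0n mul0r addr0.
    rewrite big_ord_recr /=; case: (leqP M.+1 K) => MK.
      rewrite (minn_idPl (ltnW MK)) in IH.
      by rewrite -natr1 mulrDl mul1r lerD2r.
    rewrite addr0; apply: le_trans IH _; apply: ler_wpM2r => //.
    by rewrite ler_nat geq_minr.
  case: N => [|N]; first by rewrite big_ord0 mulr_ge0.
  by apply: le_trans (h N) _; rewrite ler_wpM2r // ler_nat geq_minr.
have h2 : c * \sum_(k < N) (if (k <= K)%N then 0 else (k%:R ^+ 2)^-1) <= c / K%:R.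
  by apply: ler_wpM2l => //; exact: sum_inv_sq_tail.
apply: le_trans (lerD h1 h2); rewrite mulr_sumr -big_split; apply: ler_sum => k _ /=.
rewrite /weight; case: (nat_of_ord k) => [|i]; first by rewrite mul0r mulr0 addr0.
rewrite /=; case: (leqP i.+1 K) => _.
  rewrite mulr0 addr0 ler_pdivrMr ?exprn_gt0 ?ltr0n // ler_peMr // exprn_ege1 //.
  by rewrite ler1n.
rewrite add0r le_eqVlt; apply/orP; left; apply/eqP.
by field; rewrite addrC natr1 pnatr_eq0.
Qed.

End Weights.

(** * Uniform Schatten bounds for Fejer means *)

Section FejerSchatten.
Variables (R : realType) (H : completeNormedModType R[i]).
Variable dot : {dot H for Num.conj}.
Hypothesis dot_norm : forall x : H, `|x| ^+ 2 = dot x x.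
Variables (z : R[i]) (m : nat).
Hypothesis zr : z \isn't Num.real.
Variable p : R.
Hypothesis p1 : 1 <= p.
Implicit Types (A : operator H) (T : nat -> nat -> H -> H).

(** Each row [j] of the double sum is bounded independently of [N], and the prefactor [N%:R^-1]
    averages the [N] rows. *)
Lemma schb_fejer G N M T K (C d c : R) : (0 < N)%N -> (0 < K)%N -> 0 <= C -> 0 <= d -> 0 <= c ->
  (forall j l, (j < N)%N -> (l < N)%N -> j != l ->
    normc (fcoef G M j l) * (natdist j l)%:R ^+ 3 <= C) ->
  (forall j l, schb dot p (T j l) (weight K d c (natdist j l))) ->
  schb dot p (fun x => N%:R^-1 *: \sum_(j < N) \sum_(l < N) fcoef G M j l *: T j l x)
    (2 * C * (K%:R * d + c / K%:R)).
Proof.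
move=> N0 K0 C0 d0 c0 hC hT.
have Np : 0 < N%:R :> R by rewrite ltr0n.
pose w k := weight K d c k / k%:R ^+ 3.
have w0 k : 0 <= w k by rewrite divr_ge0 ?exprn_ge0 ?weight_ge0.
have hs := schb_scale p1 N%:R^-1 (schb_sum p1 (index_enum 'I_N) (fun j : 'I_N =>
  schb_sum p1 (index_enum 'I_N) (fun l : 'I_N => schb_scale p1 (fcoef G M j l) (hT j l)))).
apply: schb_le hs => //; rewrite normcV normc_nat mulrC ler_pdivrMr //.
have term (j l : 'I_N) : normc (fcoef G M j l) * weight K d c (natdist j l) <= C * w (natdist j l).
  rewrite /w; have [->|jl] := eqVneq j l.
    by rewrite /weight /natdist subnn /= mul0r !mulr0.
  have := hC j l (ltn_ord j) (ltn_ord l) jl.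
  case E : (natdist j l) => [|k] h; first by rewrite /weight /= mul0r !mulr0.
  have kp : 0 < k.+1%:R ^+ 3 :> R by rewrite exprn_gt0 // ltr0n.
  by rewrite mulrA ler_pdivlMr // mulrAC ler_wpM2r // weight_ge0.
apply: (@le_trans _ _ (\sum_(j < N) 2 * C * (K%:R * d + c / K%:R))); last first.
  by rewrite sumr_const card_ord mulr_natr.
apply: ler_sum => j _; apply: le_trans (ler_sum _ (fun l _ => term j l)) _.
rewrite -mulr_sumr (mulrC 2) -mulrA; apply: ler_wpM2l => //.
apply: le_trans (sum_natdist w0 (ltn_ord j)) _.
by rewrite ler_pM2l //; exact: sum_weight.
Qed.

Variable g : R -> R[i].
Hypothesis tg_re : test_function (fun t => complex.Re (g t)).
Hypothesis tg_im : test_function (fun t => complex.Im (g t)).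

Lemma vanishing_Re_Im (f : R -> R[i]) : test_function (fun t => complex.Re (f t)) ->
  test_function (fun t => complex.Im (f t)) -> vanishing_eps f.
Proof.
move=> /test_vanishing hr /test_vanishing hi.
have -> : f = fun t => 'i%C * (complex.Im (f t))%:C + (complex.Re (f t))%:C.
  apply/funext => t; case: (f t) => a b /=.
  by apply/eqP; rewrite eq_complex /=; apply/andP; split; apply/eqP; ring.
exact: vanishing_lin.
Qed.

Let vg : vanishing_eps g. Proof. exact: vanishing_Re_Im. Qed.

Lemma schb_fcdiff A1 A2 C : self_adjoint dot A1 -> self_adjoint dot A2 ->
  schb dot p (rdiff z m A1 A2) C -> exists c, schb dot p (fcdiff dot z m g A1 A2) c.
Proof.
move=> sa1 sa2 hZ; have [D [D0 hD]] := fcoef_decay zr tg_re tg_im.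
have [C0 _] := hZ; set c1 := normc (z - conjc z) * C.
have c10 : 0 <= c1 by rewrite mulr_ge0 ?normc_ge0.
(* The weight with [K = 1] and [d = c = c1] is exactly the linear bound [c1 * k]. *)
exists (2 * D * (1%:R * c1 + c1 / 1%:R)); apply: (schb_lim dot_norm p1).
  by rewrite divr1 mul1r mulr_ge0 ?mulr_ge0 // addr_ge0.
move=> e e0; have [N0 hN] := fejer_diff_approx dot_norm m zr vg e0.
(* Four times as many nodes as the degree, so that [fcoef_decay] covers all indices. *)
exists (fejer_diff z m (circ z g) N0.+1 (4 * N0.+1) A1 A2); split; last first.
  by apply: hN => //; rewrite leq_pmull.
apply: schb_fejer => // [j l jN lN jl|j l].
  by apply: hD; rewrite ?muln_gt0 // leq_mul2l ltnW.
apply: schb_le (schb_pdiff dot_norm zr j l p1 sa1 sa2 hZ) => //.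
rewrite -/c1 /weight; case: eqP => [->|_]; first by rewrite mulr0.
by case: leqP => // h; rewrite ler_piMr // lern1.
Qed.

Lemma totally_bounded_fcdiff A1 A2 : self_adjoint dot A1 -> self_adjoint dot A2 ->
  totally_bounded_op (rdiff z m A1 A2) -> totally_bounded_op (fcdiff dot z m g A1 A2).
Proof.
move=> sa1 sa2 tb; apply: totally_bounded_lim => e e0.
have [N0 hN] := fejer_diff_approx dot_norm m zr vg e0.
exists (fejer_diff z m (circ z g) N0.+1 (4 * N0.+1) A1 A2); split; last first.
  by apply: hN => //; rewrite leq_pmull.
apply: totally_bounded_scale; apply: totally_bounded_sum => j.
apply: totally_bounded_sum => l; apply: totally_bounded_scale.
exact: (totally_bounded_pdiff dot_norm zr).
Qed.

Variables (S1_ S2_ : nat -> operator H) (S1 S2 : operator H).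
Hypotheses (saS1_ : forall n, self_adjoint dot (S1_ n))
  (saS2_ : forall n, self_adjoint dot (S2_ n))
  (saS1 : self_adjoint dot S1) (saS2 : self_adjoint dot S2)
  (cvgS1 : strong_resolvent_cvg S1_ S1) (cvgS2 : strong_resolvent_cvg S2_ S2).

Lemma iter_cayley_cvg (A_ : nat -> operator H) A w k x : (forall n, self_adjoint dot (A_ n)) ->
  strong_resolvent_cvg A_ A -> w \isn't Num.real ->
  hlim (fun n => iter k (cayley (A_ n) w) x) (iter k (cayley A w) x).
Proof.
move=> saA_ cvA wr; elim: k => [|k IH] e e0.
  by exists 0%N => n _; rewrite /= subrr hnorm0 ltW.
have e2 : 0 < e / 2 by rewrite divr_gt0.
set y := iter k (cayley A w) x; have [N1 h1] := IH _ e2.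
set c := normc (w - conjc w).
have c0 : 0 <= c by exact: normc_ge0.
have ec : 0 < e / 2 / (c + 1) by rewrite divr_gt0 // ltr_wpDl.
have [N2 h2] := cvg_hlim (cvA w wr y) ec.
exists (maxn N1 N2) => n; rewrite geq_max => /andP[/h1 {}h1 /h2 {}h2]; rewrite !iterS -/y.
have lC := cayley_linear dot_norm (saA_ n) wr.
apply: le_trans (hnorm_triangle (cayley (A_ n) w y) _ _) _.
rewrite -(linear_opB _ _ lC) (hnorm_cayley dot_norm (saA_ n) _ wr).
have -> : cayley (A_ n) w y - cayley A w y =
    (w - conjc w) *: (resolvent (A_ n) w y - resolvent A w y).
  by rewrite /cayley; apply: (dot_inj dot_norm) => v; rewrite !dotE; ring.
rewrite hnormZ -/c.
have h3 : c * hnorm (resolvent (A_ n) w y - resolvent A w y) <= e / 2.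
  apply: (@le_trans _ _ ((c + 1) * (e / 2 / (c + 1)))).
    by apply: ler_pM => //; [exact: hnorm_ge0|rewrite lerDl].
  by rewrite mulrC divfK // gt_eqF // ltr_wpDl.
by apply: le_trans (lerD h1 h3) _; rewrite -splitr.
Qed.

Let zr' : conjc z \isn't Num.real. Proof. by rewrite nonreal_conj. Qed.

Hypothesis tbZ : totally_bounded_op (rdiff z m S1 S2).
Variable C : R.
Hypothesis hZ : schb dot p (rdiff z m S1 S2) C.
Hypothesis cvZ : forall d : R, 0 < d -> exists N, forall n, (N <= n)%N ->
  schb dot p (rdiff z m (S1_ n) (S2_ n) \- rdiff z m S1 S2) d.

Lemma rdiff_iter_cvg w k : w \isn't Num.real ->
  forall d : R, 0 < d -> exists N, forall n, (N <= n)%N ->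
    schb dot p (fun x => rdiff z m (S1_ n) (S2_ n) (iter k (cayley (S2_ n) w) x) -
      rdiff z m S1 S2 (iter k (cayley S2 w) x)) d.
Proof.
move=> wr d d0; have lZ := rdiff_linear dot_norm m zr saS1 saS2.
have ba A : self_adjoint dot A ->
    bounded_adjoint dot (iter k (cayley A w)) (iter k (cayley A (conjc w))) 1.
  by move=> saA; exact: (ba_iter k (ba_cayley dot_norm saA wr)).
apply: (@schb_strong_cvg _ _ _ dot_norm _ p1 _ (fun=> id) (fun=> id) _ _ _ id id _ _ 1 1 _
  (totally_bounded_compact lZ tbZ) hZ _ cvZ ltr01 ltr01 _ (ba_id dot)
  (fun n => ba _ (saS2_ n)) (ba _ saS2) _ _ _ d0).
- by move=> n; exact: (rdiff_linear dot_norm m zr).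
- by move=> _; exact: ba_id.
- by move=> x e e0; exists 0%N => n _; rewrite subrr hnorm0 ltW.
- by move=> x; apply: iter_cayley_cvg => //; rewrite nonreal_conj.
Qed.

(** Both recursions pass to the limit term by term: each term is a Schatten convergent factor
    between strongly convergent unitaries, to which Gruemm's theorem applies. *)
Lemma wdiff_cvg k (d : R) : 0 < d -> exists N, forall n, (N <= n)%N ->
  schb dot p (wdiff z m z (S1_ n) (S2_ n) k \- wdiff z m z S1 S2 k) d /\
  schb dot p (wdiff z m (conjc z) (S1_ n) (S2_ n) k \- wdiff z m (conjc z) S1 S2 k) d.
Proof.
have lm A (saA : self_adjoint dot A) := resolvent_pow_linear dot_norm m saA zr.
elim: k d => [|k IH] d d0.
  exists 0%N => n _.
  have E w A1 A2 : self_adjoint dot A1 -> wdiff z m w A1 A2 0 = fun=> 0.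
    by move=> sa1; apply/funext => x; rewrite /wdiff /= subrr (linear_op0 (lm _ sa1)).
  have h : schb dot p ((fun=> 0) \- (fun=> 0)) d.
    apply: (schb_le p1 (ltW d0)); apply: schb_ext (schb0 dot p1) => x /=.
    by rewrite subrr.
  by rewrite !E.
have d2 : 0 < d / 2 by rewrite divr_gt0.
set c := z - conjc z; have c0 : 0 < normc c + 1 by rewrite ltr_wpDl // normc_ge0.
have dc : 0 < d / 2 / (normc c + 1) by rewrite divr_gt0.
have cd e : 0 <= e -> e <= d / 2 / (normc c + 1) -> normc c * e <= d / 2.
  move=> e0 he; apply: (@le_trans _ _ ((normc c + 1) * (d / 2 / (normc c + 1)))).
    by apply: ler_pM => //; [exact: normc_ge0|rewrite lerDl].
  by rewrite mulrC divfK // gt_eqF.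
have [tb tb'] := totally_bounded_wdiff dot_norm zr k saS1 saS2 tbZ.
have [hs hs'] := schb_wdiff dot_norm zr p1 k saS1 saS2 hZ.
have step w : w \isn't Num.real -> totally_bounded_op (wdiff z m w S1 S2 k) ->
    (exists c, schb dot p (wdiff z m w S1 S2 k) c) ->
    (forall d : R, 0 < d -> exists N, forall n, (N <= n)%N ->
      schb dot p (wdiff z m w (S1_ n) (S2_ n) k \- wdiff z m w S1 S2 k) d) ->
    exists N, forall n, (N <= n)%N -> schb dot p (fun x =>
      cayley (S1_ n) w (wdiff z m w (S1_ n) (S2_ n) k x) -
      cayley S1 w (wdiff z m w S1 S2 k x)) (d / 2).
  move=> wr tbw [c' hw] cvw.
  have lW := wdiff_linear dot_norm m zr k wr saS1 saS2.
  have hlin n : linear (wdiff z m w (S1_ n) (S2_ n) k) := wdiff_linear dot_norm m zr k wr (saS1_ n) (saS2_ n).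
  have cA x : hlim (fun n => cayley (S1_ n) w x) (cayley S1 w x).
    exact: (iter_cayley_cvg 1 x saS1_ cvgS1 wr).
  have cI (x : H) : hlim (fun=> id x) (id x).
    by move=> e e0; exists 0%N => n _; rewrite subrr hnorm0 ltW.
  exact: (schb_strong_cvg dot_norm p1 (totally_bounded_compact lW tbw) hw hlin cvw ltr01 ltr01
    (fun n => ba_cayley dot_norm (saS1_ n) wr) (ba_cayley dot_norm saS1 wr)
    (fun=> ba_id dot) (ba_id dot) cA cI d2).
have [N1 h1] := step z zr tb (ex_intro _ _ hs)
  (fun e e0 => let: ex_intro N h := IH e e0 in ex_intro _ N (fun n hn => (h n hn).1)).
have [N2 h2] := step _ zr' tb' (ex_intro _ _ hs')
  (fun e e0 => let: ex_intro N h := IH e e0 in ex_intro _ N (fun n hn => (h n hn).2)).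
have [N3 h3] := rdiff_iter_cvg k zr dc.
have stepV : exists N, forall n, (N <= n)%N -> schb dot p (fun x =>
    cayley (S1_ n) (conjc z) (rdiff z m (S1_ n) (S2_ n) (iter k.+1 (cayley (S2_ n) (conjc z)) x)) -
    cayley S1 (conjc z) (rdiff z m S1 S2 (iter k.+1 (cayley S2 (conjc z)) x)))
    (d / 2 / (normc c + 1)).
  have lZ := rdiff_linear dot_norm m zr saS1 saS2.
  have ba A : self_adjoint dot A ->
      bounded_adjoint dot (iter k.+1 (cayley A (conjc z))) (iter k.+1 (cayley A (conjc (conjc z)))) 1.
    by move=> saA; exact: (ba_iter k.+1 (ba_cayley dot_norm saA zr')).
  apply: (@schb_strong_cvg _ _ _ dot_norm _ p1 _ _ _ _ _ _ _ _ _ _ 1 1 _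
    (totally_bounded_compact lZ tbZ) hZ _ cvZ ltr01 ltr01
    (fun n => ba_cayley dot_norm (saS1_ n) zr') (ba_cayley dot_norm saS1 zr')
    (fun n => ba _ (saS2_ n)) (ba _ saS2) _ _ _ dc).
  - by move=> n; exact: (rdiff_linear dot_norm m zr).
  - by move=> x; exact: (iter_cayley_cvg 1).
  - by move=> x; apply: iter_cayley_cvg => //; rewrite conjcK.
have [N4 h4] := stepV.
exists (maxn (maxn N1 N2) (maxn N3 N4)) => n; rewrite !geq_max.
move=> /andP[/andP[/h1 {}h1 /h2 {}h2] /andP[/h3 {}h3 /h4 {}h4]].
have l1 := cayley_linear dot_norm (saS1_ n) zr'; have l1' := cayley_linear dot_norm saS1 zr'.
split.
  have H3 := schb_scale p1 c h3.
  apply: schb_le (schb_ext _ (schb_add p1 h1 H3)) => //.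
    by rewrite [leRHS]splitr lerD2l cd // ltW.
  move=> x; rewrite [RHS]/= (wdiffS dot_norm m zr k x (saS1_ n) (saS2_ n)).
  rewrite (wdiffS dot_norm m zr k x saS1 saS2) -/c.
  by apply: (dot_inj dot_norm) => v; rewrite !dotE; ring.
have H4 := schb_scale p1 (- c) h4.
apply: schb_le (schb_ext _ (schb_add p1 h2 H4)) => //.
  by rewrite normcN [leRHS]splitr lerD2l cd // ltW.
move=> x; rewrite [RHS]/= (wdiffS_conj dot_norm m zr k x (saS1_ n) (saS2_ n)).
rewrite (wdiffS_conj dot_norm m zr k x saS1 saS2) -/c.
rewrite (linear_opB _ _ l1) (linear_opB _ _ l1') (linear_opZ _ _ l1) (linear_opZ _ _ l1').
by apply: (dot_inj dot_norm) => v; rewrite !dotE; ring.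
Qed.

Lemma pdiff_cvg K (d : R) : 0 < d -> exists N, forall n, (N <= n)%N ->
  forall j l, (natdist j l <= K)%N ->
  schb dot p (pdiff z m (S1_ n) (S2_ n) j l \- pdiff z m S1 S2 j l) d.
Proof.
move=> d0.
have [N hN] : exists N, forall n, (N <= n)%N -> forall k, (k <= K)%N ->
    schb dot p (wdiff z m z (S1_ n) (S2_ n) k \- wdiff z m z S1 S2 k) d /\
    schb dot p (wdiff z m (conjc z) (S1_ n) (S2_ n) k \- wdiff z m (conjc z) S1 S2 k) d.
  elim: K => [|K [N IH]].
    by have [N hN] := wdiff_cvg 0 d0; exists N => n /hN h k; rewrite leqn0 => /eqP ->.
  have [N' hN] := wdiff_cvg K.+1 d0; exists (maxn N N') => n.
  rewrite geq_max => /andP[/IH h /hN h'] k; rewrite leq_eqVlt => /orP[/eqP -> //|].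
  exact: h.
exists N => n /hN h j l hjl; rewrite !(pdiffE dot_norm m zr) //.
case: leqP => _; first by apply: (h _ _).1; apply: leq_trans hjl; exact: leq_addr.
by apply: (h _ _).2; apply: leq_trans hjl; exact: leq_addl.
Qed.

(** The order of choices matters: [K] makes the tail small, then [e] the head, then the threshold on
    [n] follows from [pdiff_cvg]. Only afterwards is the Fejer degree taken large, and the bound
    does not depend on it. *)
Lemma fcdiff_cvg (d : R) : 0 < d -> exists N, forall n, (N <= n)%N ->
  schb dot p (fcdiff dot z m g (S1_ n) (S2_ n) \- fcdiff dot z m g S1 S2) d.
Proof.
move=> d0; have [D [D0 hD]] := fcoef_decay zr tg_re tg_im.
(* [C] bounds the limiting [rdiff], and [C + 1] the n-th one as soon as it is within 1 of the
   limit. *)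
have [C0 _] := hZ; set c := normc (z - conjc z) * (C + (C + 1)).
have c0 : 0 <= c by rewrite mulr_ge0 ?normc_ge0 // !addr_ge0.
have [N1 h1] := cvZ ltr01.
have d4 : 0 < d / 2 by rewrite divr_gt0.
have [K [K0 hK]] : exists K : nat, (0 < K)%N /\ 2 * D * c / K%:R <= d / 2.
  have D2 : 0 <= 2 * D * c by rewrite mulr_ge0 // mulr_ge0.
  by have [K [K0 hK]] := inv_nat_eps D2 d4; exists K; split=> //; exact: hK.
have Kp : 0 < K%:R :> R by rewrite ltr0n.
(* [D + 1] in place of [D] keeps the denominator positive when [D] is 0. *)
pose e := d / 2 / (2 * (D + 1) * K%:R).
have DK : 0 < 2 * (D + 1) * K%:R by rewrite !mulr_gt0 // ltr_wpDl.
have e0 : 0 < e by rewrite divr_gt0.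
have he : 2 * D * (K%:R * e) <= d / 2.
  apply: (@le_trans _ _ (2 * (D + 1) * K%:R * e)).
    rewrite (mulrA (2 * D)); apply: ler_wpM2r; first exact: ltW.
    by apply: ler_wpM2r; [exact: ltW|rewrite ler_pM2l // lerDl].
  by rewrite /e mulrC divfK // gt_eqF.
have [N2 h2] := pdiff_cvg K e0.
exists (maxn N1 N2) => n; rewrite geq_max => /andP[/h1 {}h1 /h2 {}h2].
have hZn : schb dot p (rdiff z m (S1_ n) (S2_ n)) (C + 1).
  by apply: schb_ext (schb_add p1 hZ h1) => x; rewrite /= addrC subrK.
apply: (schb_lim dot_norm p1) => [|r r0]; first exact: ltW.
have r2 : 0 < r / 2 by rewrite divr_gt0.
have [N0 hN] := fejer_diff_approx dot_norm m zr vg r2.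
pose F A1 A2 := fejer_diff z m (circ z g) N0.+1 (4 * N0.+1) A1 A2.
have NM : (N0.+1 <= 4 * N0.+1)%N by rewrite leq_pmull.
exists (F (S1_ n) (S2_ n) \- F S1 S2); split; last first.
  move=> x; have a1 := hN _ _ _ _ (leqnn _) NM (saS1_ n) (saS2_ n) x.
  have a2 := hN _ _ _ _ (leqnn _) NM saS1 saS2 x.
  rewrite /= in a1 a2 *.
  set u := fcdiff dot z m g (S1_ n) (S2_ n) x in a1 *; set v := fcdiff dot z m g S1 S2 x in a2 *.
  have -> : u - v - (F (S1_ n) (S2_ n) x - F S1 S2 x) =
      u - F (S1_ n) (S2_ n) x - (v - F S1 S2 x).
    by apply: (dot_inj dot_norm) => y; rewrite !dotE; ring.
  apply: le_trans (hnormDB _ _) _; apply: le_trans (lerD a1 a2) _.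
  by rewrite -mulrDl -splitr.
have hF : schb dot p (fun x => N0.+1%:R^-1 *: \sum_(j < N0.+1) \sum_(l < N0.+1)
    fcoef (circ z g) (4 * N0.+1) j l *:
      (pdiff z m (S1_ n) (S2_ n) j l \- pdiff z m S1 S2 j l) x)
    (2 * D * (K%:R * e + c / K%:R)).
  apply: (schb_fejer (T := fun j l => pdiff z m (S1_ n) (S2_ n) j l \- pdiff z m S1 S2 j l)) => //.
  - exact: ltW.
  - by move=> j l jN lN jl; apply: hD; rewrite ?muln_gt0 // leq_mul2l ltnW.
  - move=> j l; rewrite /weight; case: eqP => [jl|_]; last case: leqP => hjl; last first.
    + have a1 := schb_pdiff dot_norm zr j l p1 (saS1_ n) (saS2_ n) hZn.
      have a2 := schb_pdiff dot_norm zr j l p1 saS1 saS2 hZ.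
      apply: schb_le (schb_sub p1 a1 a2) => //.
      by rewrite -mulrDl -mulrDr (addrC (C + 1)).
    + exact: h2.
    + have jE : j = l.
        by apply/eqP; rewrite eqn_leq -!subn_eq0; move/eqP: jl; rewrite /natdist addn_eq0.
      apply: schb_ext (schb0 dot p1) => x /=.
      rewrite jE !(pdiffE dot_norm m zr) // leqnn subnn /wdiff /= !subrr.
      by rewrite (linear_op0 (resolvent_pow_linear dot_norm m (saS1_ n) zr))
        (linear_op0 (resolvent_pow_linear dot_norm m saS1 zr)) subrr.
apply: (schb_le p1 _ (schb_ext _ hF)) => [|x].
  rewrite mulrDr [leRHS]splitr; apply: lerD => //.
  by rewrite mulrA.
rewrite /F /fejer_diff /= -scalerBr; congr (_ *: _).
rewrite -sumrB; apply: eq_bigr => j _; rewrite -sumrB; apply: eq_bigr => l _.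
by rewrite -scalerBr.
Qed.

End FejerSchatten.

(** * Convergence of the functional calculus *)

Section ConvergenceToZero.
Variable R : realType.
Implicit Type u : nat -> \bar R.

Lemma cvg_ereal0_le u (e : R) : u n @[n --> \oo] --> (0 : \bar R) -> 0 < e ->
  exists N, forall n, (N <= n)%N -> (u n <= e%:E)%E.
Proof.
move=> /fine_cvgP[fu cu] e0; have /cvgrPdist_le /(_ _ e0) := cu.
move=> /(filterI fu)[N _ hN]; exists N => n /hN [fn /=].
rewrite sub0r normrN -lee_fin => h; apply: le_trans h.
by rewrite -{1}(fineK fn) lee_fin ler_norm.
Qed.

Lemma cvg_ereal0 u : (forall n, (0 <= u n)%E) ->
  (forall e : R, 0 < e -> exists N, forall n, (N <= n)%N -> (u n <= e%:E)%E) ->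
  u n @[n --> \oo] --> (0 : \bar R).
Proof.
move=> u0 h; apply/fine_cvgP; split.
  have [N hN] := h 1 ltr01; exists N => // n /hN un.
  by rewrite ge0_fin_numE //; apply: le_lt_trans un _; exact: ltry.
apply/cvgrPdist_le => e e0; have [N hN] := h e e0; exists N => // n /hN un /=.
rewrite sub0r normrN ger0_norm ?fine_ge0 // -lee_fin fineK //.
by rewrite ge0_fin_numE //; apply: le_lt_trans un _; exact: ltry.
Qed.

End ConvergenceToZero.

Section CompactlySupported.
Variables (R : realType) (z : R[i]).
Hypothesis zr : z \isn't Num.real.
Implicit Type f : R -> R[i].

Definition ctest_function f : Prop := test_function (fun t => complex.Re (f t)) /\
  test_function (fun t => complex.Im (f t)).

Lemma C0oo_ctest f : C0oo f -> ctest_function f.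
Proof.
move=> [sr si /compact_bounded [M [_ hM]]].
have f0 t : `|M| + 1 <= `|t| - 1 -> f t = 0.
  move=> Mt; apply/eqP; rewrite -[_ == _]negbK; apply/negP => ft.
  have : `|t| <= `|M| + 1.
    apply: (hM (`|M| + 1)); first by rewrite (le_lt_trans (ler_norm M)) // ltrDl.
    exact: subset_closure.
  by move: Mt; lra.
by split; split=> //; exists (`|M| + 1 + 1) => t Mt; rewrite f0 //; move: Mt; lra.
Qed.

Lemma ctest_mul f : ctest_function f -> ctest_function (fun t => (t%:C - z) * f t).
Proof.
move=> [tr ti].
have sc (c : R) : smooth (fun=> c) by exact: smooth_cst.
have st : smooth (fun t : R => t + - complex.Re z).
  by apply: smooth_add (sc _); exact: smooth_id.
split.
  have -> : (fun t => complex.Re ((t%:C - z) * f t)) =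
    (fun t => (t + - complex.Re z) * complex.Re (f t) + complex.Im z * complex.Im (f t)).
    by apply/funext => t; case: (z) => a b; case: (f t) => c d /=; ring.
  by apply: test_add; exact: test_mul.
have -> : (fun t => complex.Im ((t%:C - z) * f t)) =
  (fun t => (t + - complex.Re z) * complex.Im (f t) + - complex.Im z * complex.Re (f t)).
  by apply/funext => t; case: (z) => a b; case: (f t) => c d /=; ring.
by apply: test_add; exact: test_mul.
Qed.

Lemma ctest_exp f k : ctest_function f -> ctest_function (fun t => (t%:C - z) ^+ k * f t).
Proof.
move=> tf; elim: k => [|k IH].
  by have -> : (fun t => (t%:C - z) ^+ 0 * f t) = f by apply/funext => t; rewrite mul1r.
have -> : (fun t => (t%:C - z) ^+ k.+1 * f t) =
  (fun t => (t%:C - z) * ((t%:C - z) ^+ k * f t)).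
  by apply/funext => t; rewrite exprS mulrA.
exact: ctest_mul.
Qed.

End CompactlySupported.

(** * The two ideals *)

Section MainProof.
Variables (R : realType) (H : completeNormedModType R[i]).
Variable dot : {dot H for Num.conj}.
Hypothesis dot_norm : forall x : H, `|x| ^+ 2 = dot x x.
Implicit Types (A : operator H) (f g : R -> R[i]).

Lemma operator_norm_ge0 (T : H -> H) : linear T -> (0 <= operator_norm T)%E.
Proof.
move=> lT; apply: ereal_sup_ubound; exists 0 => /=; first by rewrite normr0.
by rewrite (linear_op0 lT) normr0.
Qed.

Variable z : R[i].
Hypothesis zr : z \isn't Num.real.

Lemma fcalc_diff_linear A1 A2 f : self_adjoint dot A1 -> self_adjoint dot A2 ->
  vanishing_eps f -> linear (fcalc dot A2 f \- fcalc dot A1 f).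
Proof.
by move=> sa1 sa2 vf; apply: (linear_op_sub dot_norm); exact: (fcalc_linear dot_norm _ zr).
Qed.

Lemma resolvent_pow_diff_linear A1 A2 w m : self_adjoint dot A1 -> self_adjoint dot A2 ->
  w \isn't Num.real -> linear (resolvent_pow A2 w m \- resolvent_pow A1 w m).
Proof.
by move=> sa1 sa2 wr; apply: (linear_op_sub dot_norm); exact: (resolvent_pow_linear dot_norm).
Qed.

(** The constant comes from the sup of [g], so one [b] serves the whole sequence, as Gruemm's
    theorem demands. *)
Lemma fcalc_bounded_adjoint g : vanishing_eps g -> exists2 b : R, 0 < b &
  forall A, self_adjoint dot A ->
  bounded_adjoint dot (fcalc dot A g) (fcalc dot A (fun t => conjc (g t))) b.
Proof.
move=> vg; have vg' := vanishing_conj vg; have [B hB] := vanishing_bounded vg.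
have hB' t : normc (g t) <= `|B| + 1.
  by apply: le_trans (hB t) _; apply: le_trans (ler_norm B) _; rewrite lerDl.
exists (`|B| + 1) => [|A saA]; first by rewrite ltr_wpDl.
split.
- exact: (fcalc_linear dot_norm saA zr).
- exact: (fcalc_linear dot_norm saA zr).
- by move=> x y; exact: (fcalc_adjoint dot_norm saA zr).
- exact: (fcalc_bound dot_norm saA zr).
- by apply: (fcalc_bound dot_norm saA zr) => // t; rewrite normc_conj.
Qed.

Variable m : nat.
Hypothesis m_gt0 : (0 < m)%N.

Lemma fcalc_factor A f : self_adjoint dot A -> ctest_function f ->
  fcalc dot A f = resolvent_pow A z m \o fcalc dot A (fun t => (t%:C - z) ^+ m * f t).
Proof.
move=> saA tf; have [tr ti] := ctest_exp z m tf.
case: m m_gt0 tr ti => // k _ tr ti.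
have vg := vanishing_Re_Im tr ti.
rewrite -(fcalc_resolvent_pow dot_norm saA zr k zr).
rewrite -(fcalc_mul dot_norm saA zr (vanishing_resf_exp k zr) vg); congr fcalc.
apply/funext => t; rewrite mulrA -exprMn mulVf ?expr1n ?mul1r //.
exact: subr_nonreal.
Qed.

Lemma fcalc_diff_factor A1 A2 f (g := fun t => (t%:C - z) ^+ m * f t) x :
  self_adjoint dot A1 -> self_adjoint dot A2 -> ctest_function f ->
  (fcalc dot A2 f \- fcalc dot A1 f) x =
  (resolvent_pow A2 z m \- resolvent_pow A1 z m) (fcalc dot A2 g x) + fcdiff dot z m g A1 A2 x.
Proof.
move=> sa1 sa2 tf; rewrite /= (fcalc_factor sa1 tf) (fcalc_factor sa2 tf) /= -/g /fcdiff.
rewrite (linear_opB _ _ (resolvent_pow_linear dot_norm m sa1 zr)).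
by apply: (dot_inj dot_norm) => v; rewrite !dotE; ring.
Qed.

Variables (S1_ S2_ : nat -> operator H) (S1 S2 : operator H).
Hypotheses (saS1_ : forall n, self_adjoint dot (S1_ n))
  (saS2_ : forall n, self_adjoint dot (S2_ n))
  (saS1 : self_adjoint dot S1) (saS2 : self_adjoint dot S2).

Lemma bounded_case f : vanishing_eps f ->
  (forall w, w \isn't Num.real ->
    operator_norm ((resolvent_pow (S2_ n) w m \- resolvent_pow (S1_ n) w m) \-
       (resolvent_pow S2 w m \- resolvent_pow S1 w m)) @[n --> \oo] --> (0 : \bar R)) ->
  (forall n, bounded_operator ((fcalc dot (S2_ n) f \- fcalc dot (S1_ n) f) \-
       (fcalc dot S2 f \- fcalc dot S1 f))) /\
  operator_norm ((fcalc dot (S2_ n) f \- fcalc dot (S1_ n) f) \-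
       (fcalc dot S2 f \- fcalc dot S1 f)) @[n --> \oo] --> (0 : \bar R).
Proof.
move=> vf hb.
have lX n : linear ((fcalc dot (S2_ n) f \- fcalc dot (S1_ n) f) \-
    (fcalc dot S2 f \- fcalc dot S1 f)).
  by apply: (linear_op_sub dot_norm); exact: fcalc_diff_linear.
split=> [n|].
  apply/bounded_operatorP; split; first exact: lX.
  have [b b0 hB] := fcalc_bounded_adjoint vf.
  have := ba_bnd (ba_sub dot_norm (ba_sub dot_norm (hB _ (saS2_ n)) (hB _ (saS1_ n)))
    (ba_sub dot_norm (hB _ saS2) (hB _ saS1))).
  by move=> h; exists (b + b + (b + b)); split=> //; rewrite !addr_ge0 // ltW.
apply: cvg_ereal0 => [n|e e0]; first exact: operator_norm_ge0.
have hres w : w \isn't Num.real -> forall e : R, 0 < e -> exists N, forall n, (N <= n)%N ->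
    opbound ((resolvent_pow (S2_ n) w m \- resolvent_pow (S1_ n) w m) \-
      (resolvent_pow S2 w m \- resolvent_pow S1 w m)) e.
  move=> wr d d0; have [N hN] := cvg_ereal0_le (hb w wr) d0.
  exists N => n /hN; apply: opbound_operator_norm; last exact: ltW.
  by apply: (linear_op_sub dot_norm); exact: resolvent_pow_diff_linear.
have [N hN] := fcalc_norm_cvg dot_norm saS1_ saS2_ saS1 saS2 m_gt0 hres vf e0.
by exists N => n /hN; apply: operator_norm_le; exact: ltW.
Qed.

Hypotheses (cvgS1 : strong_resolvent_cvg S1_ S1) (cvgS2 : strong_resolvent_cvg S2_ S2).
Variable p : R.
Hypothesis p1 : 1 <= p.

Lemma schatten_norm_cvgP (T_ : nat -> H -> H) T : (forall n, linear (T_ n)) -> linear T ->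
  (forall n, totally_bounded_op (T_ n)) -> totally_bounded_op T ->
  schatten_norm dot p (T_ n \- T) @[n --> \oo] --> (0 : \bar R) <->
  forall d : R, 0 < d -> exists N, forall n, (N <= n)%N -> schb dot p (T_ n \- T) d.
Proof.
move=> lT_ lT tT_ tT.
have lD n : linear (T_ n \- T) by exact: (linear_op_sub dot_norm).
split=> [h d d0|h].
  have [N hN] := cvg_ereal0_le h d0; exists N => n /hN; apply: schatten_norm_schb => //.
    by apply: totally_bounded_compact => //; exact: totally_bounded_sub.
  exact: ltW.
apply: cvg_ereal0 => [n|e e0]; first exact: schatten_norm_ge0.
by have [N hN] := h e e0; exists N => n /hN; exact: schb_schatten_norm.
Qed.

Lemma schatten_case f : ctest_function f ->
  (forall n, schatten dot p (resolvent_pow (S2_ n) z m \- resolvent_pow (S1_ n) z m)) ->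
  schatten dot p (resolvent_pow S2 z m \- resolvent_pow S1 z m) ->
  schatten_norm dot p ((resolvent_pow (S2_ n) z m \- resolvent_pow (S1_ n) z m) \-
     (resolvent_pow S2 z m \- resolvent_pow S1 z m)) @[n --> \oo] --> (0 : \bar R) ->
  (forall n, schatten dot p (rdiff z m (S1_ n) (S2_ n))) ->
  schatten dot p (rdiff z m S1 S2) ->
  schatten_norm dot p (rdiff z m (S1_ n) (S2_ n) \- rdiff z m S1 S2)
    @[n --> \oo] --> (0 : \bar R) ->
  (forall n, schatten dot p ((fcalc dot (S2_ n) f \- fcalc dot (S1_ n) f) \-
       (fcalc dot S2 f \- fcalc dot S1 f))) /\
  schatten_norm dot p ((fcalc dot (S2_ n) f \- fcalc dot (S1_ n) f) \-
       (fcalc dot S2 f \- fcalc dot S1 f)) @[n --> \oo] --> (0 : \bar R).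
Proof.
move=> tf sD_ sD cD sZ_ sZ cZ.
have tg := ctest_exp z m tf; set g := (fun t => _ * f t) in tg.
have [tgr tgi] := tg; have vg := vanishing_Re_Im tgr tgi.
have vf : vanishing_eps f by case: tf => [tr ti]; exact: vanishing_Re_Im.
have [b b0 hB] := fcalc_bounded_adjoint vg.
have D_ n := (schattenP dot_norm p1 _).1 (sD_ n).
have Z_ n := (schattenP dot_norm p1 _).1 (sZ_ n).
have [cpD [cD0 bD]] := (schattenP dot_norm p1 _).1 sD.
have [cpZ [cZ0 bZ]] := (schattenP dot_norm p1 _).1 sZ.
have lD_ n := resolvent_pow_diff_linear m (saS1_ n) (saS2_ n) zr.
have lD := resolvent_pow_diff_linear m saS1 saS2 zr.
have lZ_ n := rdiff_linear dot_norm m zr (saS1_ n) (saS2_ n).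
have lZ := rdiff_linear dot_norm m zr saS1 saS2.
have tb := compact_totally_bounded cpZ.
have tb_ n := compact_totally_bounded (Z_ n).1.
have tD_ n := compact_totally_bounded (D_ n).1.
have tD := compact_totally_bounded cpD.
have lX_ n := fcalc_diff_linear (saS1_ n) (saS2_ n) vf.
have lX := fcalc_diff_linear saS1 saS2 vf.
have part A1 A2 (sa1 : self_adjoint dot A1) (sa2 : self_adjoint dot A2) :
    schatten dot p (resolvent_pow A2 z m \- resolvent_pow A1 z m) ->
    schatten dot p (rdiff z m A1 A2) ->
    totally_bounded_op (fcalc dot A2 f \- fcalc dot A1 f) /\
    exists c, schb dot p (fcalc dot A2 f \- fcalc dot A1 f) c.
  move=> /(schattenP dot_norm p1)[cpD' [c hD]] /(schattenP dot_norm p1)[cpZ' [c' hZ]].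
  have lD' := resolvent_pow_diff_linear m sa1 sa2 zr.
  have E := funext (fun x => fcalc_diff_factor x sa1 sa2 tf).
  rewrite E -/g; split.
    apply: totally_bounded_add.
      by apply: totally_bounded_compr lD' (ba_bnd (hB _ sa2)) _; exact: compact_totally_bounded.
    by apply: (totally_bounded_fcdiff dot_norm) => //; exact: compact_totally_bounded.
  have [c2 h2] := schb_fcdiff dot_norm zr p1 tgr tgi sa1 sa2 hZ.
  have h1 := schb_comp p1 ltr01 b0 lD' (ba_lin (ba_id dot)) (ba_adj (ba_id dot))
    (ba_adj (hB _ sa2)) (ba_bnd (ba_id dot)) (ba_bnd' (hB _ sa2)) hD.
  by exists (1 * b * c + c2); exact: schb_add.
have [tX [c hX]] := part _ _ saS1 saS2 sD sZ.
have tX_ n := (part _ _ (saS1_ n) (saS2_ n) (sD_ n) (sZ_ n)).1.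
have hX_ n := (part _ _ (saS1_ n) (saS2_ n) (sD_ n) (sZ_ n)).2.
split=> [n|].
  apply/(schattenP dot_norm p1); split; last first.
    by have [c' hn] := hX_ n; exists (c' + c); exact: schb_sub.
  apply: totally_bounded_compact; last exact: totally_bounded_sub.
  exact: (linear_op_sub dot_norm).
apply/schatten_norm_cvgP => // d d0.
have d2 : 0 < d / 2 by rewrite divr_gt0.
have cvD := (schatten_norm_cvgP lD_ lD tD_ tD).1 cD.
have cvZ := (schatten_norm_cvgP lZ_ lZ tb_ tb).1 cZ.
have [N1 h1] := fcdiff_cvg dot_norm zr p1 tgr tgi saS1_ saS2_ saS1 saS2 cvgS1 cvgS2 tb bZ cvZ d2.
have cI (x : H) : hlim (fun=> id x) (id x).
  by move=> e e0; exists 0%N => n _; rewrite subrr hnorm0 ltW.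
(* A right factor in Gruemm's theorem needs strong convergence of its adjoints, here given by the
   conjugate function. *)
have cB x : hlim (fun n => fcalc dot (S2_ n) (fun t => conjc (g t)) x)
    (fcalc dot S2 (fun t => conjc (g t)) x).
  by apply: (fcalc_strong_cvg dot_norm) => //; exact: vanishing_conj.
have id1 : bounded_adjoint dot id id 1 := ba_id dot.
have [N2 h2] := schb_strong_cvg dot_norm p1 cpD bD lD_ cvD ltr01 b0 (fun=> id1) id1
  (fun n => hB _ (saS2_ n)) (hB _ saS2) cI cB d2.
exists (maxn N1 N2) => n; rewrite geq_max => /andP[/h1 {}h1 /h2 {}h2].
rewrite [d]splitr; apply: schb_ext (schb_add p1 h2 h1) => x.
rewrite -[RHS]/((fcalc dot (S2_ n) f \- fcalc dot (S1_ n) f) x -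
  (fcalc dot S2 f \- fcalc dot S1 f) x).
rewrite (fcalc_diff_factor x (saS1_ n) (saS2_ n) tf) (fcalc_diff_factor x saS1 saS2 tf) -/g /=.
by apply: (dot_inj dot_norm) => v; rewrite !dotE; ring.
Qed.

End MainProof.

Unset Implicit Arguments.
Theorem theorem3p8 (R : realType) (H : completeNormedModType R[i])
  (dot : {dot H for Num.conj}) (dot_norm : forall x : H, `|x| ^+ 2 = dot x x)
  (sepH : separable_space H)
  (S1_ S2_ : nat -> operator H) (S1 S2 : operator H)
  (saS1_ : forall n, self_adjoint dot (S1_ n))
  (saS2_ : forall n, self_adjoint dot (S2_ n))
  (saS1 : self_adjoint dot S1) (saS2 : self_adjoint dot S2)
  (cvgS1 : strong_resolvent_cvg S1_ S1) (cvgS2 : strong_resolvent_cvg S2_ S2)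
  (m : nat) (m_gt0 : (0 < m)%N)
  (J : operator_ideal R) (hJ : admissible_ideal J)
  (ha : forall z : R[i], z \isn't Num.real ->
    (forall n, in_ideal dot J
      (resolvent_pow (S2_ n) z m \- resolvent_pow (S1_ n) z m)) /\
    in_ideal dot J (resolvent_pow S2 z m \- resolvent_pow S1 z m))
  (hb : forall z : R[i], z \isn't Num.real ->
    ideal_norm dot J
      ((resolvent_pow (S2_ n) z m \- resolvent_pow (S1_ n) z m) \-
       (resolvent_pow S2 z m \- resolvent_pow S1 z m))
      @[n --> \oo] --> (0 : \bar R))
  (z0 : R[i]) (z0_nonreal : z0 \isn't Num.real)
  (hc : (forall n, in_ideal dot J
      (resolvent_pow (S1_ n) z0 m \o
       (resolvent (S2_ n) z0 \- resolvent (S1_ n) z0))) /\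
    in_ideal dot J
      (resolvent_pow S1 z0 m \o (resolvent S2 z0 \- resolvent S1 z0)))
  (hd : ideal_norm dot J
      ((resolvent_pow (S1_ n) z0 m \o
        (resolvent (S2_ n) z0 \- resolvent (S1_ n) z0)) \-
       (resolvent_pow S1 z0 m \o (resolvent S2 z0 \- resolvent S1 z0)))
      @[n --> \oo] --> (0 : \bar R)) :
  forall f : R -> R[i], C0oo f ->
    (forall n, in_ideal dot J
      ((fcalc dot (S2_ n) f \- fcalc dot (S1_ n) f) \-
       (fcalc dot S2 f \- fcalc dot S1 f))) /\
    ideal_norm dot J
      ((fcalc dot (S2_ n) f \- fcalc dot (S1_ n) f) \-
       (fcalc dot S2 f \- fcalc dot S1 f))
      @[n --> \oo] --> (0 : \bar R).
Proof.
move=> f /C0oo_ctest tf.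
case: J hJ ha hb hc hd => [p|] /= p1 ha' hb' hc' hd'.
  (* The factorization of [f] is made at [z0], so (a) and (b) are taken at the point at which (c)
     and (d) are given. *)
  exact: (schatten_case dot_norm z0_nonreal m_gt0 saS1_ saS2_ saS1 saS2 cvgS1 cvgS2 p1 tf
    (ha' z0 z0_nonreal).1 (ha' z0 z0_nonreal).2 (hb' z0 z0_nonreal) hc'.1 hc'.2 hd').
apply: (bounded_case dot_norm z0_nonreal m_gt0) => //.
by case: tf; exact: vanishing_Re_Im.
Qed.
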